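(* Let $q$ be a nonzero complex number which is not a root of unity. Let $\mu(u)=\sum_{r\ge0}\mu^{(r)}u^{-r}$ and $\bar\mu(u)=\sum_{r\ge 0}\bar\mu^{(r)}u^r$ be formal power series with complex coefficients, and let $V(\mu(u);\bar\mu(u))$ be the irreducible highest weight representation of $\mathrm{Y}'_q(\mathfrak{sp}_2)$ with highest weight $(\mu(u);\bar\mu(u))$. Then $V(\mu(u);\bar\mu(u))$ is finite-dimensional if and only if there exists a polynomial $P(u)$ in $u$ of even degree with constant term $1$ such that $u^{\deg P}P(u^{-1})=q^{-\deg P}P(uq^2)$ and $$\frac{\bar\mu(u^{-1})}{\mu(u)}=q^{-\deg P}\,\frac{P(uq^2)}{P(u)}$$ (as power series in $u^{-1}$). In this case $P(u)$ is unique.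
   Context: Let $E_{ij}$ denote matrix units. $R(u,v)=(u-v)\sum_{i\ne j}E_{ii}\otimes E_{jj}+(q^{-1}u-qv)\sum_i E_{ii}\otimes E_{ii}+(q^{-1}-q)u\sum_{i>j}E_{ij}\otimes E_{ji}+(q^{-1}-q)v\sum_{i<j}E_{ij}\otimes E_{ji}$ (indices in $\{1,2\}$). The algebra $\mathrm{U}^{\rm ext}_q(\widehat{\mathfrak{gl}}_2)$ has generators $t_{ij}^{(r)},\bar t_{ij}^{(r)}$ ($i,j\in\{1,2\}$, $r\ge0$) and $(t_{ii}^{(0)})^{-1},(\bar t_{ii}^{(0)})^{-1}$; with $t_{ij}(u)=\sum_r t_{ij}^{(r)}u^{-r}$, $\bar t_{ij}(u)=\sum_r\bar t_{ij}^{(r)}u^r$, $T(u)=\sum t_{ij}(u)\otimes E_{ij}$, $\overline T(u)=\sum \bar t_{ij}(u)\otimes E_{ij}$, relations: $t_{12}^{(0)}=\bar t_{21}^{(0)}=0$; $t_{ii}^{(0)}\bar t_{ii}^{(0)}=\bar t_{ii}^{(0)}t_{ii}^{(0)}$; the listed inverses are two-sided inverses; $R(u,v)T_1(u)T_2(v)=T_2(v)T_1(u)R(u,v)$, $R(u,v)\overline T_1(u)\overline T_2(v)=\overline T_2(v)\overline T_1(u)R(u,v)$, $R(u,v)\overline T_1(u)T_2(v)=T_2(v)\overline T_1(u)R(u,v)$. $\mathrm{Y}'_q(\mathfrak{sp}_2)$ is the subalgebra generated by the coefficients $s_{ij}^{(r)}$ of $s_{ij}(u)=q\,t_{i1}(u)\bar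 t_{j2}(u^{-1})-t_{i2}(u)\bar t_{j1}(u^{-1})=\sum_{r\ge0}s_{ij}^{(r)}u^{-r}$ together with $(s_{12}^{(0)})^{-1}$ (where $s_{12}^{(0)}=q\,t_{11}^{(0)}\bar t_{22}^{(0)}$). Also $\bar s_{ij}(u)=q\,\bar t_{i1}(u)t_{j2}(u^{-1})-\bar t_{i2}(u)t_{j1}(u^{-1})$, a power series in $u$ with coefficients in $\mathrm{Y}'_q(\mathfrak{sp}_2)$. A highest weight representation with highest weight $(\mu(u);\bar\mu(u))$ is one generated by a nonzero $\xi$ with $s_{11}(u)\xi=0$, $s_{21}(u)\xi=\mu(u)\xi$, $\bar s_{21}(u)\xi=\bar\mu(u)\xi$. The Verma module is the quotient of $\mathrm{Y}'_q(\mathfrak{sp}_2)$ by the left ideal generated by the coefficients of $s_{11}(u)$, $s_{21}(u)-\mu(u)$, $\bar s_{21}(u)-\bar\mu(u)$; it has a unique maximal proper submodule, and $V(\mu(u);\bar\mu(u))$ is the irreducible quotient. *)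

(* Defs.v *)
From HB Require Import structures.
From mathcomp Require Import all_boot all_order all_algebra.
From mathcomp Require Import complex Rstruct.
Set Implicit Arguments. Unset Strict Implicit. Unset Printing Implicit Defensive.
Import Order.TTheory GRing.Theory Num.Theory.
Local Open Scope ring_scope.

Definition C : fieldType := (Rdefinitions.R)[i].

(* Matrix indices 1,2 are encoded as the ordinals 0,1 of 'I_2. *)
Definition o1 : 'I_2 := ord0.
Definition o2 : 'I_2 := ord_max.

(* The R-matrix R(u,v) = sum_{i,k,a,b} R_{(i,k),(a,b)}(u,v) E_ia (x) E_kb, whose
   entries are linear in u,v: R_{(i,k),(a,b)}(u,v) = Ral i k a b * u + Rbe i k a b * v. *)
Definition Ral (q : C) (i k a b : 'I_2) : C :=
  if (i == a) && (k == b) then (if i == k then q^-1 else 1)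
  else if [&& i == b, k == a & (k < i)%N] then q^-1 - q else 0.
Definition Rbe (q : C) (i k a b : 'I_2) : C :=
  if (i == a) && (k == b) then (if i == k then - q else - 1)
  else if [&& i == b, k == a & (i < k)%N] then q^-1 - q else 0.

Definition pc (A : algType C) (f : nat -> A) (n : nat) : A :=
  if n is m.+1 then f m else 0.

(* Entry (i,k),(j,l) of the matrix identity  R X_1 Y_2 = Y_2 X_1 R, after extracting
   one coefficient: Xa,Ya are the coefficients of X,Y multiplying the u-part of R,
   Xb,Yb those multiplying the v-part of R (u is the variable of X, v that of Y). *)
Definition rtt_entry (q : C) (A : algType C) (Xa Ya Xb Yb : 'I_2 -> 'I_2 -> A)
  (i j k l : 'I_2) : Prop :=
  \sum_(a < 2) \sum_(b < 2)
     (Ral q i k a b *: (Xa a j * Ya b l) + Rbe q i k a b *: (Xb a j * Yb b l))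
  = \sum_(a < 2) \sum_(b < 2)
     (Ral q a b j l *: (Ya k b * Xa i a) + Rbe q a b j l *: (Yb k b * Xb i a)).

(* Defining relations of U^ext_q(gl_2^) on elements
   t i j r = t_ij^(r), tb i j r = tbar_ij^(r), ti i = (t_ii^(0))^-1, tbi i = (tbar_ii^(0))^-1. *)
Definition Uext_rels (q : C) (A : algType C) (t tb : 'I_2 -> 'I_2 -> nat -> A)
  (ti tbi : 'I_2 -> A) : Prop :=
  [/\ t o1 o2 0%N = 0, tb o2 o1 0%N = 0,
      (forall i, t i i 0%N * tb i i 0%N = tb i i 0%N * t i i 0%N),
      (forall i, [/\ t i i 0%N * ti i = 1, ti i * t i i 0%N = 1,
                    tb i i 0%N * tbi i = 1 & tbi i * tb i i 0%N = 1]) &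
      forall (r s : nat) (i j k l : 'I_2),
        (* R(u,v) T_1(u) T_2(v) = T_2(v) T_1(u) R(u,v): coefficient of u^(1-r) v^(1-s) *)
        [/\ rtt_entry q (fun a b => t a b r) (fun a b => pc (t a b) s)
                        (fun a b => pc (t a b) r) (fun a b => t a b s) i j k l,
        (* R(u,v) Tb_1(u) Tb_2(v) = Tb_2(v) Tb_1(u) R(u,v): coefficient of u^r v^s *)
            rtt_entry q (fun a b => pc (tb a b) r) (fun a b => tb a b s)
                        (fun a b => tb a b r) (fun a b => pc (tb a b) s) i j k l &
        (* R(u,v) Tb_1(u) T_2(v) = T_2(v) Tb_1(u) R(u,v): coefficient of u^r v^(1-s) *)
            rtt_entry q (fun a b => pc (tb a b) r) (fun a b => pc (t a b) s)
                        (fun a b => tb a b r) (fun a b => t a b s) i j k l]].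

Definition alg_hom (A B : algType C) (f : A -> B) : Prop :=
  [/\ forall x y, f (x + y) = f x + f y,
      forall (c : C) x, f (c *: x) = c *: f x,
      forall x y, f (x * y) = f x * f y & f 1 = 1].

Definition is_Uext (q : C) (A : algType C) (t tb : 'I_2 -> 'I_2 -> nat -> A)
  (ti tbi : 'I_2 -> A) : Prop :=
  Uext_rels q t tb ti tbi /\
  forall (B : algType C) (t' tb' : 'I_2 -> 'I_2 -> nat -> B) (ti' tbi' : 'I_2 -> B),
    Uext_rels q t' tb' ti' tbi' ->
    exists f : A -> B,
      [/\ alg_hom f,
          (forall i j r, f (t i j r) = t' i j r /\ f (tb i j r) = tb' i j r),
          (forall i, f (ti i) = ti' i /\ f (tbi i) = tbi' i) &
          forall g : A -> B, alg_hom g ->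
            (forall i j r, g (t i j r) = t' i j r /\ g (tb i j r) = tb' i j r) ->
            (forall i, g (ti i) = ti' i /\ g (tbi i) = tbi' i) ->
            forall x, g x = f x].

(* Coefficients: s_ij(u) = sum_r s_ij^(r) u^-r, sbar_ij(u) = sum_r sbar_ij^(r) u^r. *)
Definition s_coef (q : C) (A : algType C) (t tb : 'I_2 -> 'I_2 -> nat -> A)
  (i j : 'I_2) (r : nat) : A :=
  \sum_(a < r.+1) (q *: (t i o1 a * tb j o2 (r - a)%N) - t i o2 a * tb j o1 (r - a)%N).
Definition sb_coef (q : C) (A : algType C) (t tb : 'I_2 -> 'I_2 -> nat -> A)
  (i j : 'I_2) (r : nat) : A :=
  \sum_(a < r.+1) (q *: (tb i o1 a * t j o2 (r - a)%N) - tb i o2 a * t j o1 (r - a)%N).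
(* The two-sided inverse of s_12^(0) = q t_11^(0) tbar_22^(0). *)
Definition s12inv (q : C) (A : algType C) (ti tbi : 'I_2 -> A) : A :=
  q^-1 *: (tbi o2 * ti o1).

Definition subalg (A : algType C) (S : A -> Prop) : Prop :=
  [/\ S 1, forall x y, S x -> S y -> S (x + y),
      forall (c : C) x, S x -> S (c *: x) & forall x y, S x -> S y -> S (x * y)].

Definition Yq (q : C) (A : algType C) (t tb : 'I_2 -> 'I_2 -> nat -> A)
  (ti tbi : 'I_2 -> A) (x : A) : Prop :=
  forall S : A -> Prop, subalg S ->
    (forall i j r, S (s_coef q t tb i j r)) -> S (s12inv q ti tbi) -> S x.

Definition left_ideal (A : algType C) (Y N : A -> Prop) : Prop :=
  [/\ forall x, N x -> Y x, N 0, forall x y, N x -> N y -> N (x + y) &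
      forall y x, Y y -> N x -> N (y * x)].

Definition verma_ideal (q : C) (A : algType C) (t tb : 'I_2 -> 'I_2 -> nat -> A)
  (ti tbi : 'I_2 -> A) (mu mub : nat -> C) (x : A) : Prop :=
  forall N : A -> Prop, left_ideal (Yq q t tb ti tbi) N ->
    (forall r, N (s_coef q t tb o1 o1 r)) ->
    (forall r, N (s_coef q t tb o2 o1 r - mu r *: 1)) ->
    (forall r, N (sb_coef q t tb o2 o1 r - mub r *: 1)) -> N x.

(* Submodules of M = Y'/I correspond to left ideals N of Y' with I <= N; such a
   submodule is proper iff 1 (the class of which is the generator xi) is not in N. *)
Definition proper_sub (q : C) (A : algType C) (t tb : 'I_2 -> 'I_2 -> nat -> A)
  (ti tbi : 'I_2 -> A) (mu mub : nat -> C) (N : A -> Prop) : Prop :=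
  [/\ left_ideal (Yq q t tb ti tbi) N,
      (forall x, verma_ideal q t tb ti tbi mu mub x -> N x) & ~ N 1].

(* The maximal proper submodule (the sum of all proper submodules), as a left ideal
   of Y' containing the Verma ideal. *)
Definition max_sub (q : C) (A : algType C) (t tb : 'I_2 -> 'I_2 -> nat -> A)
  (ti tbi : 'I_2 -> A) (mu mub : nat -> C) (x : A) : Prop :=
  forall S : A -> Prop, S 0 -> (forall x y, S x -> S y -> S (x + y)) ->
    (forall N, proper_sub q t tb ti tbi mu mub N -> forall y, N y -> S y) -> S x.

(* V(mu(u); mub(u)) = Y'/J (J = max_sub) is finite-dimensional over C:
   Y' is spanned by finitely many elements modulo J. *)
Definition V_findim (q : C) (A : algType C) (t tb : 'I_2 -> 'I_2 -> nat -> A)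
  (ti tbi : 'I_2 -> A) (mu mub : nat -> C) : Prop :=
  exists (n : nat) (v : 'I_n -> A),
    (forall k, Yq q t tb ti tbi (v k)) /\
    forall y, Yq q t tb ti tbi y ->
      exists c : 'I_n -> C, max_sub q t tb ti tbi mu mub (y - \sum_(k < n) c k *: v k).

Definition revp (P : {poly C}) : {poly C} :=
  \poly_(k < size P) P`_((size P).-1 - k).

Definition ser_mul (f g : nat -> C) (r : nat) : C :=
  \sum_(a < r.+1) f a * g (r - a)%N.

(* The condition on P in Theorem 4.6.  Writing d = deg P:
   - d is even and P(0) = 1;
   - u^d P(u^-1) = q^-d P(u q^2);
   - mub(u^-1)/mu(u) = q^-d P(u q^2)/P(u) as power series in w = u^-1.  Here
     mub(u^-1) = sum_r mub_r w^r, mu(u) = sum_r mu_r w^r, and multiplying the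
     numerator and denominator of the right side by w^d gives the polynomials
     revp (P(q^2 X)) and revp P in w; the quotient by mu(u) in C[[w]] exists iff
     mu_0 <> 0, and then the identity is equivalent to the cross-multiplied one. *)
Definition good_P (q : C) (mu mub : nat -> C) (P : {poly C}) : Prop :=
  let d := (size P).-1 in
  let Pq := P \Po (q ^+ 2 *: 'X) in
  [/\ ~~ odd d, P`_0 = 1,
      revp P = q ^- d *: Pq,
      mu 0%N != 0 &
      forall r, ser_mul mub (fun k => (revp P)`_k) r
                = q ^- d * ser_mul mu (fun k => (revp Pq)`_k) r].

(* Main.v *)
Require Import Defs.
From HB Require Import structures.
From mathcomp Require Import all_boot all_order all_algebra.
From mathcomp Require Import complex Rstruct boolp functions ring.
Set Implicit Arguments. Unset Strict Implicit. Unset Printing Implicit Defensive.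
Import Order.TTheory GRing.Theory Num.Theory.
Local Open Scope ring_scope.

(* Put w = 1/u. The series s_ij satisfy a reflection equation. It makes the quotient of Y' by a
   highest weight ideal graded by the eigenvalues sig_0 q^(-2k) of s_12^(0), where s_22 raises k
   and s_11 lowers it. If the quotient is finite-dimensional, the coefficients of s_22 acting on
   the generator xi are linearly dependent; as s_11(w) s_22(z) xi is an explicit multiple of xi,
   this gives mub prod (w - rho) = mu prod (1 - rho w) for an even number of nonzero rho.

   Group the rho in pairs (x, y). Up to multiplication of T(u) by a scalar series, this highest
   weight is that of a tensor product of evaluation modules L(x, y), where L(x, y) is a string of
   k + 1 vectors if x y q^(2k) = 1 and is infinite-dimensional if there is no such k. When the
   pairs are chosen greedily, with the shortest strings first, xi is the only singular vector of
   the tensor product, so every nonzero vector generates xi. Hence V is finite-dimensional iff all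
   strings are finite, and then P is the product of (1 - x q^(2j) u) (1 - y q^(2j) u) over all
   pairs and all j < k. Conversely P splits into factors (1 - rho u) (1 - u / (q^2 rho)), each
   realized by a two-dimensional evaluation module. *)

(** * Formal power series *)

(** Linear dependence gives only the ratio of two mutually reversed polynomials, which does not
    suffice: what decides is whether the roots can be grouped into finite strings. The delicate
    point is that a string without end makes V infinite-dimensional, and only there is the
    irreducibility of a tensor product used. In the opposite direction it is enough that V is a
    quotient of the cyclic module generated by the highest vector. The shape of [P] comes from
    telescoping: in P(q^2 u)/P(u) neighbouring factors along a string cancel and only its two ends
    survive. [P] is unique because the quotient of two candidates is invariant under u -> q^2 u.
    Quotient modules are never formed: a module is the left ideal of Y' annihilating its generator,
    and statements about it are congruences. Tensor products live in one fixed space of functions,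
    so that the universal property is applied to a single algebra of operators. Y' is only a
    one-sided coideal: adding an evaluation factor turns S into L S' Lb^t, so factors are put in
    front one at a time, starting from the trivial representation. *)

Definition ps (R : Type) : Type := nat -> R.

Section PowerSeriesRing.
Variable R : nzRingType.
Implicit Types f g h : ps R.

HB.instance Definition _ := gen_eqMixin (ps R).
HB.instance Definition _ := gen_choiceMixin (ps R).

Definition ps_add f g : ps R := fun n => f n + g n.
Definition ps_opp f : ps R := fun n => - f n.
Definition ps_mul f g : ps R := fun n => \sum_(i < n.+1) f i * g (n - i)%N.
Definition ps_const (a : R) : ps R := fun n => if n is 0%N then a else 0.

Lemma psP f g : (forall n, f n = g n) <-> f = g.
Proof. by split=> [/funext//|->]. Qed.

Fact ps_addA : associative ps_add.
Proof. by move=> f g h; apply/psP=> n; rewrite /ps_add addrA. Qed.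
Fact ps_addC : commutative ps_add.
Proof. by move=> f g; apply/psP=> n; rewrite /ps_add addrC. Qed.
Fact ps_add0 : left_id (ps_const 0) ps_add.
Proof. by move=> f; apply/psP=> -[|n]; rewrite /ps_add add0r. Qed.
Fact ps_addN : left_inverse (ps_const 0) ps_opp ps_add.
Proof. by move=> f; apply/psP=> -[|n]; rewrite /ps_add /ps_opp addNr. Qed.

HB.instance Definition _ :=
  GRing.isZmodule.Build (ps R) ps_addA ps_addC ps_add0 ps_addN.

Lemma psD f g n : (f + g) n = f n + g n. Proof. by []. Qed.
Lemma psN f n : (- f) n = - f n. Proof. by []. Qed.
Lemma ps0 n : (0 : ps R) n = 0. Proof. by case: n. Qed.

Definition ptrunc N f : {poly R} := \poly_(i < N.+1) f i.

Lemma coef_ptrunc N f n : (n <= N)%N -> (ptrunc N f)`_n = f n.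
Proof. by move=> le; rewrite coef_poly ltnS le. Qed.

(** A coefficient of a product involves only finitely many coefficients of the factors, so
    associativity can be borrowed from polynomials. *)
Lemma ps_mul_trunc N f g n : (n <= N)%N ->
  ps_mul f g n = (ptrunc N f * ptrunc N g)`_n.
Proof.
move=> le; rewrite coefM; apply: eq_bigr => i _.
by rewrite !coef_ptrunc //; apply: leq_trans le; [apply: leq_subr | rewrite -ltnS].
Qed.

Fact ps_mulA : associative ps_mul.
Proof.
move=> f g h; apply/psP=> n.
transitivity ((ptrunc n f * (ptrunc n g * ptrunc n h))`_n).
  rewrite coefM; apply: eq_bigr => i _; rewrite (@ps_mul_trunc n) ?leq_subr //.
  by rewrite coef_ptrunc // -ltnS.
rewrite mulrA coefM; apply: eq_bigr => i _; rewrite (@ps_mul_trunc n) -1?ltnS //.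
by rewrite coef_ptrunc // leq_subr.
Qed.
Fact ps_mul1 : left_id (ps_const 1) ps_mul.
Proof.
move=> f; apply/psP=> n; rewrite /ps_mul big_ord_recl mul1r subn0 big1 ?addr0 //.
by move=> i _; rewrite mul0r.
Qed.
Fact ps_mulr1 : right_id (ps_const 1) ps_mul.
Proof.
move=> f; apply/psP=> n; rewrite /ps_mul big_ord_recr /= subnn mulr1 big1 ?add0r //.
move=> i _; case E: (n - i)%N => /=; last by rewrite mulr0.
by move/eqP: E; rewrite subn_eq0 leqNgt ltn_ord.
Qed.
Fact ps_mulDl : left_distributive ps_mul ps_add.
Proof.
move=> f g h; apply/psP=> n; rewrite /ps_mul /ps_add -big_split.
by apply: eq_bigr => i _; rewrite mulrDl.
Qed.
Fact ps_mulDr : right_distributive ps_mul ps_add.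
Proof.
move=> f g h; apply/psP=> n; rewrite /ps_mul /ps_add -big_split.
by apply: eq_bigr => i _; rewrite mulrDr.
Qed.
Fact ps_1neq0 : ps_const 1 != 0.
Proof. by apply/eqP => /psP /(_ 0%N) /= /eqP; rewrite oner_eq0. Qed.

HB.instance Definition _ := GRing.Zmodule_isNzRing.Build (ps R)
  ps_mulA ps_mul1 ps_mulr1 ps_mulDl ps_mulDr ps_1neq0.

Lemma psM f g n : (f * g) n = \sum_(i < n.+1) f i * g (n - i)%N.
Proof. by []. Qed.
Lemma psM0 f g : (f * g) 0%N = f 0%N * g 0%N.
Proof. by rewrite psM big_ord1. Qed.

Definition psX : ps R := fun n => (n == 1%N)%:R.

Lemma psXM f n : (psX * f) n = if n is m.+1 then f m else 0.
Proof.
rewrite psM; case: n => [|n]; first by rewrite big_ord1 /= mul0r.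
rewrite (bigD1 (lift ord0 ord0)) //= mul1r subSS subn0 big1 ?addr0 // => i.
by rewrite /psX -val_eqE /= => /negPf ->; rewrite mul0r.
Qed.


Lemma psC_mul a f n : (ps_const a * f) n = a * f n.
Proof.
rewrite psM big_ord_recl /= subn0 big1 ?addr0 // => i _; exact: mul0r.
Qed.
Lemma ps_mulC f a n : (f * ps_const a) n = f n * a.
Proof.
rewrite psM big_ord_recr /= subnn big1 ?add0r // => i _.
case E: (n - i)%N => /=; last by rewrite mulr0.
by move/eqP: E; rewrite subn_eq0 leqNgt ltn_ord.
Qed.

Fact ps_const_zmod : zmod_morphism ps_const.
Proof. by move=> a b; apply/psP=> -[|n] //=; rewrite psD psN subr0. Qed.
HB.instance Definition _ :=
  GRing.isZmodMorphism.Build R (ps R) ps_const ps_const_zmod.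
Fact ps_const_monoid : monoid_morphism ps_const.
Proof.
split=> // a b; apply/psP=> n; rewrite psC_mul.
by case: n => //= n; rewrite mulr0.
Qed.
HB.instance Definition _ :=
  GRing.isMonoidMorphism.Build R (ps R) ps_const ps_const_monoid.

End PowerSeriesRing.

Arguments psX {R}.

Section PowerSeriesComRing.
Variable R : comNzRingType.
Fact ps_mul_comm : commutative (@ps_mul R).
Proof.
move=> f g; apply/psP=> n; rewrite /ps_mul (reindex_inj rev_ord_inj) /=.
apply: eq_bigr => i _; rewrite mulrC subSS subKn //; exact: (ltn_ord i).
Qed.
HB.instance Definition _ :=
  GRing.PzRing_hasCommutativeMul.Build (ps R) ps_mul_comm.
End PowerSeriesComRing.

Section PowerSeriesAlgebra.
Variables (K : comNzRingType) (A : algType K).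
Implicit Types (f g : ps K) (x y : ps A).

(** Embeds scalar series as central elements. Through it [ps A] becomes an algebra over [ps K], and
    relations whose coefficients depend on the spectral parameter become linear identities. *)
Definition ps_alg f : ps A := fun n => (f n)%:A.
Fact ps_alg_zmod : zmod_morphism ps_alg.
Proof.
by move=> f g; apply/psP => n; rewrite /ps_alg psD psN scalerDl scaleNr.
Qed.
HB.instance Definition _ :=
  GRing.isZmodMorphism.Build (ps K) (ps A) ps_alg ps_alg_zmod.
Fact ps_alg_monoid : monoid_morphism ps_alg.
Proof.
split=> [|f g]; apply/psP=> n.
  by case: n => [|n]; rewrite /ps_alg /= ?scale1r ?scale0r.
rewrite psM /ps_alg psM scaler_suml; apply: eq_bigr => i _.
by rewrite -scalerAl mul1r scalerA.
Qed.
HB.instance Definition _ :=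
  GRing.isMonoidMorphism.Build (ps K) (ps A) ps_alg ps_alg_monoid.

Lemma ps_alg_comm f x : ps_alg f * x = x * ps_alg f.
Proof.
apply/psP=> n; rewrite !psM (reindex_inj rev_ord_inj) /=.
apply: eq_bigr => i _; rewrite /ps_alg subSS subKn -1?ltnS //.
by rewrite mulr_algl mulr_algr.
Qed.

Definition ps_scale f x : ps A := ps_alg f * x.
Fact ps_scaleA f g x : ps_scale f (ps_scale g x) = ps_scale (f * g) x.
Proof. by rewrite /ps_scale rmorphM mulrA. Qed.
Fact ps_scale1 : left_id 1 ps_scale.
Proof. by move=> x; rewrite /ps_scale rmorph1 mul1r. Qed.
Fact ps_scaleDr : right_distributive ps_scale +%R.
Proof. by move=> f x y; rewrite /ps_scale mulrDr. Qed.
Fact ps_scaleDl x : {morph ps_scale^~ x : f g / f + g}.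
Proof. by move=> f g; rewrite /ps_scale rmorphD mulrDl. Qed.
HB.instance Definition _ := GRing.Zmodule_isLmodule.Build (ps K) (ps A)
  ps_scaleA ps_scale1 ps_scaleDr ps_scaleDl.
Fact ps_scaleAl f x y : f *: (x * y) = (f *: x) * y.
Proof. by rewrite /GRing.scale /= /ps_scale mulrA. Qed.
HB.instance Definition _ := GRing.Lmodule_isLalgebra.Build (ps K) (ps A) ps_scaleAl.
Fact ps_scaleAr f x y : f *: (x * y) = x * (f *: y).
Proof. by rewrite /GRing.scale /= /ps_scale !mulrA ps_alg_comm. Qed.
HB.instance Definition _ := GRing.Lalgebra_isAlgebra.Build (ps K) (ps A) ps_scaleAr.

Lemma psZ f x n : (f *: x) n = \sum_(i < n.+1) f i *: x (n - i)%N.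
Proof. by apply: eq_bigr => i _; rewrite mulr_algl. Qed.
Lemma psZX x n : (psX *: x) n = if n is m.+1 then x m else 0.
Proof.
suff -> : psX *: x = psX * x by rewrite psXM.
rewrite /GRing.scale /= /ps_scale; congr (_ * _); apply/psP=> m.
by rewrite /ps_alg /psX scaler_nat.
Qed.
Lemma psZC a x n : (ps_const a *: x) n = a *: x n.
Proof.
rewrite psZ big_ord_recl subn0 big1 ?addr0 // => i _; exact: scale0r.
Qed.
End PowerSeriesAlgebra.

Lemma ord2P (i : 'I_2) : i = o1 \/ i = o2.
Proof. by case: i => -[|[|//]] h; [left | right]; apply/val_inj. Qed.

Lemma sum_ord2 (V : nmodType) (F : 'I_2 -> V) : \sum_(i < 2) F i = F o1 + F o2.
Proof. by rewrite big_ord_recl big_ord1; congr (_ + F _); apply/val_inj. Qed.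

Lemma o12_neq : (o1 == o2) = false. Proof. by []. Qed.
Lemma o21_neq : (o2 == o1) = false. Proof. by []. Qed.
Definition o_eqs := (o12_neq, o21_neq).

Local Notation P := ('I_2 * 'I_2)%type.

Lemma sum_pair2 (V : nmodType) (F : P -> V) :
  \sum_s F s = \sum_(a < 2) \sum_(b < 2) F (a, b).
Proof. by rewrite pair_bigA; apply: eq_bigr => -[]. Qed.

(** * Series in two variables with noncommutative coefficients *)

Section TwoVariables.
Variable A : algType C.

(* Series in z with coefficients in series in w. *)
Definition ps2 : Type := ps (ps A).
HB.instance Definition _ := GRing.Algebra.on ps2.

Definition inw (f : ps A) : ps2 := ps_const f.
Definition inz (f : ps A) : ps2 := fun n => ps_const (f n).

HB.instance Definition _ := GRing.RMorphism.copy inw (@ps_const (ps A)).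

Fact inz_zmod : zmod_morphism inz.
Proof. by move=> f g; apply/psP=> n; rewrite psD psN /inz psD psN rmorphB. Qed.
HB.instance Definition _ := GRing.isZmodMorphism.Build (ps A) ps2 inz inz_zmod.
Fact inz_monoid : monoid_morphism inz.
Proof.
split=> [|f g]; apply/psP=> n; rewrite /inz; first by case: n => [|n] /=; rewrite ?rmorph0.
by rewrite psM [RHS]psM rmorph_sum; apply: eq_bigr => i _; rewrite rmorphM.
Qed.
HB.instance Definition _ := GRing.isMonoidMorphism.Build (ps A) ps2 inz inz_monoid.

End TwoVariables.

Definition K2 : Type := ps (ps C).
HB.instance Definition _ := GRing.ComNzRing.on K2.
Definition zK : K2 := psX.
Definition wK : K2 := ps_const psX.
Definition cK (c : C) : K2 := ps_const (ps_const c).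
HB.instance Definition _ := GRing.RMorphism.copy cK (@ps_const (ps C) \o @ps_const C).

(** Subspaces are predicates, so that one lemma serves left ideals, weight spaces and the zero
    subspace. *)
Definition linear_pred (V : lmodType C) (L : V -> Prop) : Prop :=
  [/\ L 0, forall a b : V, L a -> L b -> L (a + b) & forall (c : C) (a : V), L a -> L (c *: a)].

Lemma linear_pred_sum (V : lmodType C) (L : V -> Prop) I (r : seq I) (F : I -> V) :
  linear_pred L -> (forall i, L (F i)) -> L (\sum_(i <- r) F i).
Proof. by case=> L0 LD _ LF; elim/big_ind: _. Qed.

Section TwoVariableCoefficients.
Variable A : algType C.
Implicit Types (x y : ps A) (f : ps2 A).

Lemma inwM_inz x y n m : (inw x * inz y : ps2 A) n m = x m * y n.
Proof. by rewrite psC_mul ps_mulC. Qed.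
Lemma inzM_inw x y n m : (inz y * inw x : ps2 A) n m = y n * x m.
Proof. by rewrite ps_mulC psC_mul. Qed.
Lemma zKE f n m : (zK *: f) n m = if n is k.+1 then f k m else 0.
Proof. by rewrite psZX; case: n => [|n] //; rewrite ps0. Qed.
Lemma wKE f n m : (wK *: f) n m = if m is k.+1 then f n k else 0.
Proof. by rewrite psZC psZX. Qed.
Lemma cKE c f n m : (cK c *: f) n m = c *: f n m.
Proof. by rewrite !psZC. Qed.

Definition coefs_in (L : A -> Prop) f : Prop := forall n m, L (f n m).

Lemma linear_predZ_ps (L : A -> Prop) (g : ps C) x :
  linear_pred L -> (forall n, L (x n)) -> forall n, L ((g *: x) n).
Proof.
move=> HL Lx n; rewrite psZ; apply: linear_pred_sum => // i.
by case: HL => _ _; apply.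
Qed.

Lemma coefs_inZ (L : A -> Prop) (k : K2) f :
  linear_pred L -> coefs_in L f -> coefs_in L (k *: f).
Proof.
move=> HL Lf n m; rewrite psZ.
have: forall r : seq 'I_n.+1, L ((\sum_(i <- r) k i *: f (n - i)%N : ps A) m).
  elim=> [|i r IH]; first by rewrite big_nil ps0; case: HL.
  rewrite big_cons psD; have [L0 LD LZ] := HL; apply: LD => //.
  exact: linear_predZ_ps.
by move=> H; exact: H.
Qed.

Lemma coefs_inD (L : A -> Prop) f g :
  linear_pred L -> coefs_in L f -> coefs_in L g -> coefs_in L (f + g).
Proof. by case=> _ LD _ Lf Lg n m; apply: LD. Qed.

(** Replaces inverting [k], which is impossible for factors such as (z - w)(1 - zw). Induction on
    the power of z: the z^n coefficient of [k *: f] is [k 0 *: f n] plus contributions of lower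
    coefficients of [f], and multiplication by c w^j only shifts and rescales. *)
Lemma coefs_in_divide (L : A -> Prop) (k : K2) (c : C) j f :
  linear_pred L -> k 0%N = ps_const c * psX ^+ j -> c != 0 ->
  coefs_in L (k *: f) -> coefs_in L f.
Proof.
move=> HL k0 c0 Lkf n.
have [L0 LD LZ] := HL.
elim/ltn_ind: n => n IH m.
have E : forall m, L ((k 0%N *: f n) m).
  move=> m'; have := Lkf n m'; rewrite psZ big_ord_recl subn0 psD => H.
  have -> : (k 0%N *: f n) m' = ((k 0%N *: f n) m' + (\sum_(i < n) k (lift ord0 i) *: f (n - lift
    ord0 i)%N : ps A) m')
     + (-1) *: ((\sum_(i < n) k (lift ord0 i) *: f (n - lift ord0 i)%N : ps A) m').
    by rewrite scaleN1r addrK.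
  apply: (LD) => //; apply: (LZ).
  have: forall r : seq 'I_n, L ((\sum_(i <- r) k (lift ord0 i) *: f (n - lift ord0 i)%N : ps A) m').
    elim=> [|i r IHr]; first by rewrite big_nil ps0.
    rewrite big_cons psD; apply: (LD); last exact: IHr.
    apply: linear_predZ_ps => // s; apply: (IH).
    by rewrite lift0 ltn_subrL /= (leq_ltn_trans (leq0n i)).
  by move=> H1; exact: H1.
have {}E := E (m + j)%N; rewrite k0 -scalerA psZC in E.
have XE : forall (x : ps A), (psX ^+ j *: x) (m + j)%N = x m.
  elim: (j) => [|i IHi] x; first by rewrite expr0 scale1r addn0.
  by rewrite exprS -scalerA addnS psZX IHi.
by rewrite XE in E; have := LZ c^-1 _ E; rewrite scalerA mulVf // scale1r.
Qed.

Lemma K2_regular (k : K2) (c : C) j f g :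
  k 0%N = ps_const c * psX ^+ j -> c != 0 -> k *: f = k *: g -> f = g.
Proof.
move=> k0 c0 E; apply/subr0_eq/psP=> n; apply/psP=> m; rewrite !ps0.
refine (@coefs_in_divide (fun a : A => a = 0) k c j (f - g) _ k0 c0 _ n m).
  split=> // [a b -> ->|a b ->]; [exact: addr0|exact: scaler0].
by move=> {}n {}m; rewrite scalerBr E subrr !ps0.
Qed.

End TwoVariableCoefficients.

(** * Matrices on the tensor square of a plane *)

Section TensorMatrices.
Variables (K : comNzRingType) (E : algType K).
Implicit Types (X Y Z : P -> P -> E) (x y : 'I_2 -> 'I_2 -> E) (M : P -> P -> K).

Definition mm X Y : P -> P -> E := fun p r => \sum_s X p s * Y s r.
Definition leg1 x : P -> P -> E := fun p r => if p.2 == r.2 then x p.1 r.1 else 0.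
Definition leg2 x : P -> P -> E := fun p r => if p.1 == r.1 then x p.2 r.2 else 0.
Definition emb M : P -> P -> E := fun p r => (M p r)%:A.

Lemma mat_ext X Y : (forall i k j l, X (i, k) (j, l) = Y (i, k) (j, l)) -> X = Y.
Proof. by move=> H; apply/funext=> -[i k]; apply/funext=> -[j l]. Qed.

Lemma mmA X Y Z : mm X (mm Y Z) = mm (mm X Y) Z.
Proof.
apply/mat_ext=> i k j l; rewrite /mm.
under eq_bigr do rewrite big_distrr; rewrite exchange_big; apply: eq_bigr => s _.
by rewrite big_distrl; apply: eq_bigr => s' _; rewrite /= mulrA.
Qed.

Lemma mm_leg1l x X i k r : mm (leg1 x) X (i, k) r = \sum_a x i a * X (a, k) r.
Proof.
rewrite /mm sum_pair2; apply: eq_bigr => a _; rewrite (bigD1 k) //= /leg1 eqxx.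
by rewrite big1 ?addr0 // => b /negPf; rewrite eq_sym /= => ->; rewrite mul0r.
Qed.
Lemma mm_leg2l x X i k r : mm (leg2 x) X (i, k) r = \sum_b x k b * X (i, b) r.
Proof.
rewrite /mm sum_pair2 exchange_big; apply: eq_bigr => b _.
rewrite (bigD1 i) //= /leg2 eqxx.
by rewrite big1 ?addr0 // => a /negPf; rewrite eq_sym /= => ->; rewrite mul0r.
Qed.
Lemma mm_leg1r x X p j l : mm X (leg1 x) p (j, l) = \sum_a X p (a, l) * x a j.
Proof.
rewrite /mm sum_pair2; apply: eq_bigr => a _; rewrite (bigD1 l) //= /leg1 eqxx.
by rewrite big1 ?addr0 // => b /negPf /= ->; rewrite mulr0.
Qed.
Lemma mm_leg2r x X p j l : mm X (leg2 x) p (j, l) = \sum_b X p (j, b) * x b l.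
Proof.
rewrite /mm sum_pair2 exchange_big; apply: eq_bigr => b _.
rewrite (bigD1 j) //= /leg2 eqxx.
by rewrite big1 ?addr0 // => a /negPf /= ->; rewrite mulr0.
Qed.

Lemma mm_leg12 x y i k j l : mm (leg1 x) (leg2 y) (i, k) (j, l) = x i j * y k l.
Proof.
rewrite mm_leg1l (bigD1 j) //= /leg2 /= eqxx big1 ?addr0 // => a /negPf ->.
exact: mulr0.
Qed.
Lemma mm_leg21 x y i k j l : mm (leg2 y) (leg1 x) (i, k) (j, l) = y k l * x i j.
Proof.
rewrite mm_leg2l (bigD1 l) //= /leg1 /= eqxx big1 ?addr0 // => a /negPf ->.
exact: mulr0.
Qed.

Lemma mm_legC x y : (forall i j k l, GRing.comm (x i j) (y k l)) ->
  mm (leg1 x) (leg2 y) = mm (leg2 y) (leg1 x).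
Proof. by move=> H; apply/mat_ext=> i k j l; rewrite mm_leg12 mm_leg21; exact: H. Qed.

Lemma mm_embl M X p r : mm (emb M) X p r = \sum_(a < 2) \sum_(b < 2) M p (a, b) *: X (a, b) r.
Proof. by rewrite /mm sum_pair2; do 2! apply: eq_bigr => ? _; rewrite mulr_algl. Qed.
Lemma mm_embr M X p r : mm X (emb M) p r = \sum_(a < 2) \sum_(b < 2) M (a, b) r *: X p (a, b).
Proof. by rewrite /mm sum_pair2; do 2! apply: eq_bigr => ? _; rewrite mulr_algr. Qed.

Lemma leg1M x y : mm (leg1 x) (leg1 y) = leg1 (fun i j => \sum_a x i a * y a j).
Proof.
apply/mat_ext=> i k j l; rewrite mm_leg1l /leg1 /=; case: (k == l) => //.
by rewrite big1 // => a _; rewrite mulr0.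
Qed.
Lemma leg2M x y : mm (leg2 x) (leg2 y) = leg2 (fun i j => \sum_a x i a * y a j).
Proof.
apply/mat_ext=> i k j l; rewrite mm_leg2l /leg2 /=; case: (i == j) => //.
by rewrite big1 // => a _; rewrite mulr0.
Qed.
End TensorMatrices.

(** * The reflection equation *)

Section SeriesRTT.
Variables (q : C) (A : algType C).
Implicit Types (x y : 'I_2 -> 'I_2 -> nat -> A).

(** R(u, v) is homogeneous of degree one, so only the ratio of its arguments matters. With T a
    series in 1/u and Tb a series in u, the three defining relations need the arguments (z, w), (w,
    z) and (zw, 1). *)
Definition Rk (al be : K2) (p r : P) : K2 :=
  cK (Ral q p.1 p.2 r.1 r.2) * al + cK (Rbe q p.1 p.2 r.1 r.2) * be.

Definition rtt (al be : K2) (X Y : 'I_2 -> 'I_2 -> ps2 A) : Prop :=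
  forall i k j l,
    \sum_(a < 2) \sum_(b < 2) Rk al be (i, k) (a, b) *: (X a j * Y b l)
    = \sum_(a < 2) \sum_(b < 2) Rk al be (a, b) (j, l) *: (Y k b * X i a).

Definition mapw x : 'I_2 -> 'I_2 -> ps2 A := fun i j => inw (x i j).
Definition mapz x : 'I_2 -> 'I_2 -> ps2 A := fun i j => inz (x i j).

Definition mon (i j : bool) : K2 := zK ^+ i * wK ^+ j.
Definition shift (i : bool) (f : nat -> A) := if i then pc f else f.

Lemma monE i j (f : ps2 A) n m :
  (mon i j *: f) n m = shift i (fun n => shift j (f n) m) n.
Proof.
rewrite /mon -scalerA; case: i; case: j; rewrite ?expr1 ?expr0 ?scale1r ?zKE ?wKE //=;
  by case: n => [|n] //=; rewrite ?wKE; case: m.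
Qed.

Lemma ps_sum (V : nzRingType) I (r : seq I) (F : I -> ps V) n :
  (\sum_(i <- r) F i : ps V) n = \sum_(i <- r) F i n.
Proof.
by elim: r => [|i r IH]; rewrite ?big_nil ?ps0 // !big_cons psD IH.
Qed.


(** Multiplying R by z or w shifts one of the two indices; this is what [pc] encodes in the defining
    relations. *)
Lemma rtt_coefP i1 j1 i2 j2 x y :
  rtt (mon i1 j1) (mon i2 j2) (mapw x) (mapz y) <->
  forall r s i j k l,
    rtt_entry q (fun a b => shift j1 (x a b) r) (fun a b => shift i1 (y a b) s)
                (fun a b => shift j2 (x a b) r) (fun a b => shift i2 (y a b) s) i j k l.
Proof.
have Lc al be : forall i' j' (X Y : nat -> A) n m,
   ((cK al * mon i' j' + be) *: (inw X * inz Y : ps2 A)) n m =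
   al *: (shift j' X m * shift i' Y n) + (be *: (inw X * inz Y : ps2 A)) n m.
  move=> i' j' X Y n m; rewrite scalerDl -scalerA 2!psD cKE monE; congr (_ *: _ + _).
  case: i'; case: j'; rewrite /= ?inwM_inz //; case: n => [|n]; case: m => [|m] /=;
    by rewrite ?inwM_inz ?mulr0 ?mul0r.
have Lc' al be : forall i' j' (X Y : nat -> A) n m,
   ((cK al * mon i' j' + be) *: (inz Y * inw X : ps2 A)) n m =
   al *: (shift i' Y n * shift j' X m) + (be *: (inz Y * inw X : ps2 A)) n m.
  move=> i' j' X Y n m; rewrite scalerDl -scalerA 2!psD cKE monE; congr (_ *: _ + _).
  case: i'; case: j'; rewrite /= ?inzM_inw //; case: n => [|n]; case: m => [|m] /=;
    by rewrite ?inzM_inw ?mulr0 ?mul0r.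
have L al be X Y n m :
   ((cK al * mon i1 j1 + cK be * mon i2 j2) *: (inw X * inz Y : ps2 A)) n m =
   al *: (shift j1 X m * shift i1 Y n) + be *: (shift j2 X m * shift i2 Y n).
  by rewrite Lc -(addr0 (_ * mon i2 j2)) Lc scale0r !ps0 addr0.
have L' al be X Y n m :
   ((cK al * mon i1 j1 + cK be * mon i2 j2) *: (inz Y * inw X : ps2 A)) n m =
   al *: (shift i1 Y n * shift j1 X m) + be *: (shift i2 Y n * shift j2 X m).
  by rewrite Lc' -(addr0 (_ * mon i2 j2)) Lc' scale0r !ps0 addr0.
split=> H.
  move=> r s i j k l; rewrite /rtt_entry.
  have := f_equal (fun f : ps2 A => f s r) (H i k j l).
  rewrite /= !sum_ord2 /mapw /mapz /Rk /= 6!psD !L => ->.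
  by rewrite 6!psD !L'.
move=> i k j l; apply/psP=> s; apply/psP=> r.
have := H r s i j k l; rewrite /rtt_entry !sum_ord2 /mapw /mapz /Rk /=.
by rewrite 6!psD !L => ->; rewrite 6!psD !L'.
Qed.
End SeriesRTT.

(** The derivation of the reflection equation for S = T G U as a computation with words: [r] is R,
    [p] its partial transpose, and [t], [g], [u] are T, a constant matrix and the transposed Tb in
    the leg given by the index. *)
Lemma assoc_reflection (T : Type) (m : T -> T -> T) (r p t1 t2 g1 g2 u1 u2 : T) :
  associative m ->
  m r (m t1 t2) = m (m t2 t1) r -> m u1 (m p t2) = m t2 (m p u1) ->
  m t1 (m p u2) = m u2 (m p t1) -> m r (m u1 u2) = m (m u2 u1) r ->
  m r (m g1 (m p g2)) = m (m (m g2 p) g1) r ->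
  m t1 g2 = m g2 t1 -> m g1 t2 = m t2 g1 -> m u1 g2 = m g2 u1 -> m g1 u2 = m u2 g1 ->
  m (m (m r (m t1 (m g1 u1))) p) (m t2 (m g2 u2))
  = m (m (m (m t2 (m g2 u2)) p) (m t1 (m g1 u1))) r.
Proof.
move=> mA rt ut tu rb gg tg gt ug gu.
have rtx x : m r (m t1 (m t2 x)) = m t2 (m t1 (m r x)) by rewrite (mA t1) mA rt -!mA.
have utx x : m u1 (m p (m t2 x)) = m t2 (m p (m u1 x)) by rewrite (mA p) mA ut -!mA.
have tux x : m t1 (m p (m u2 x)) = m u2 (m p (m t1 x)) by rewrite (mA p) mA tu -!mA.
have ggx x : m r (m g1 (m p (m g2 x))) = m g2 (m p (m g1 (m r x))).
  by rewrite (mA p) (mA g1) mA gg -!mA.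
have tgx x : m t1 (m g2 x) = m g2 (m t1 x) by rewrite mA tg -mA.
have gtx x : m g1 (m t2 x) = m t2 (m g1 x) by rewrite mA gt -mA.
have ugx x : m u1 (m g2 x) = m g2 (m u1 x) by rewrite mA ug -mA.
have gux x : m g1 (m u2 x) = m u2 (m g1 x) by rewrite mA gu -mA.
by rewrite -!mA utx gtx ugx rtx ggx rb -mA tgx gux tux.
Qed.

Section Reflection.
Variables (q : C) (q0 : q != 0) (A : algType C).
Variables (t tb : 'I_2 -> 'I_2 -> nat -> A) (ti tbi : 'I_2 -> A).
Hypothesis HU : Uext_rels q t tb ti tbi.

Lemma rtt_TT : rtt q zK wK (mapw t) (mapz t).
Proof.
have := @rtt_coefP q A true false false true t t.
rewrite /mon !expr1 !expr0 mulr1 mul1r => -[_]; apply=> r s i j k l /=.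
by case: HU => _ _ _ _ /(_ r s i j k l) [].
Qed.
Lemma rtt_BB : rtt q wK zK (mapw tb) (mapz tb).
Proof.
have := @rtt_coefP q A false true true false tb tb.
rewrite /mon !expr1 !expr0 mulr1 mul1r => -[_]; apply=> r s i j k l /=.
by case: HU => _ _ _ _ /(_ r s i j k l) [].
Qed.
Lemma rtt_BT : rtt q (zK * wK) 1 (mapw tb) (mapz t).
Proof.
have := @rtt_coefP q A true true false false tb t.
rewrite /mon !expr1 !expr0 mulr1 => -[_]; apply=> r s i j k l /=.
by case: HU => _ _ _ _ /(_ r s i j k l) [].
Qed.

(** The reflection equation also needs the mixed relation with T in w and Tb in z; exchanging the
    two variables produces it from [rtt_BT]. *)
Definition swap_zw (f : ps2 A) : ps2 A := fun n m => f m n.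

Lemma swap_zwZ i j i' j' (c c' : C) x y :
  swap_zw ((cK c * mon i j + cK c' * mon i' j') *: (inw x * inz y))
  = (cK c * mon j i + cK c' * mon j' i') *: (inz x * inw y).
Proof.
have E k l a : swap_zw ((cK a * mon k l) *: (inw x * inz y)) = (cK a * mon l k) *: (inz x * inw y).
  apply/psP=> n; apply/psP=> m; rewrite -(scalerA _ (mon l k)) /swap_zw -(scalerA _ (mon k l)) !cKE
    !monE; congr (_ *: _).
  case: k; case: l; rewrite /= ?inwM_inz ?inzM_inw //;
  by case: n => [|n] /=; case: m => [|m] /=; rewrite ?inwM_inz ?inzM_inw.
by rewrite 2!scalerDl -!E.
Qed.
Lemma swap_zwZ' i j i' j' (c c' : C) x y :
  swap_zw ((cK c * mon i j + cK c' * mon i' j') *: (inz y * inw x))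
  = (cK c * mon j i + cK c' * mon j' i') *: (inw y * inz x).
Proof.
have E k l a : swap_zw ((cK a * mon k l) *: (inz y * inw x)) = (cK a * mon l k) *: (inw y * inz x).
  apply/psP=> n; apply/psP=> m; rewrite -(scalerA _ (mon l k)) /swap_zw -(scalerA _ (mon k l)) !cKE
    !monE; congr (_ *: _).
  case: k; case: l; rewrite /= ?inwM_inz ?inzM_inw //;
  by case: n => [|n] /=; case: m => [|m] /=; rewrite ?inwM_inz ?inzM_inw.
by rewrite 2!scalerDl -!E.
Qed.
Lemma swap_zwD (f g : ps2 A) : swap_zw (f + g) = swap_zw f + swap_zw g.
Proof. by []. Qed.

Lemma rtt_BT_swap : rtt q (zK * wK) 1 (mapz tb) (mapw t).
Proof.
move=> i k j l; have := f_equal swap_zw (rtt_BT i k j l).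
rewrite !sum_ord2 !swap_zwD /mapw /mapz /Rk /=.
have -> : zK * wK = mon true true by rewrite /mon !expr1.
have -> : 1 = mon false false by rewrite /mon !expr0 mulr1.
by rewrite !swap_zwZ !swap_zwZ'.
Qed.

Local Notation Qk := (cK q).
Local Notation Qi := (cK q^-1).
Lemma QkV : Qk * Qi = 1. Proof. by rewrite -rmorphM mulfV ?rmorph1. Qed.

Local Notation s_ := (s_coef q t tb).

Lemma s_coefE i j :
  s_ i j = ps_const q *: ((t i o1 : ps A) * tb j o2) - (t i o2 : ps A) * tb j o1 :> ps A.
Proof.
apply/psP=> n; rewrite psD psN psZC !psM scaler_sumr -sumrB.
by apply: eq_bigr.
Qed.
Lemma sb_coefE i j :
  sb_coef q t tb i j
  = ps_const q *: ((tb i o1 : ps A) * t j o2) - (tb i o2 : ps A) * t j o1 :> ps A.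
Proof.
apply/psP=> n; rewrite psD psN psZC !psM scaler_sumr -sumrB.
by apply: eq_bigr.
Qed.

Definition gK (i j : 'I_2) : K2 :=
  if (i == o1) && (j == o2) then Qk else if (i == o2) && (j == o1) then - 1 else 0.
Definition gE i j : ps2 A := (gK i j)%:A.

Lemma inwZC (c : C) (f : ps A) : inw (ps_const c *: f) = cK c *: inw f.
Proof. by apply/psP=> n; rewrite psZC; case: n => [|n] //=; rewrite scaler0. Qed.
Lemma inzZC (c : C) (f : ps A) : inz (ps_const c *: f) = cK c *: inz f.
Proof.
apply/psP=> n; apply/psP=> m; rewrite cKE /inz psZC.
by case: m => [|m] //=; rewrite scaler0.
Qed.

Lemma inwB (f g : ps A) : inw (f - g) = inw f - inw g. Proof. exact: raddfB. Qed.
Lemma inwM (f g : ps A) : inw (f * g) = inw f * inw g. Proof. exact: rmorphM. Qed.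
Lemma inzB (f g : ps A) : inz (f - g) = inz f - inz g. Proof. exact: raddfB. Qed.
Lemma inzM (f g : ps A) : inz (f * g) = inz f * inz g. Proof. exact: rmorphM. Qed.

Let uw i j := mapw tb j i.
Let uz i j := mapz tb j i.
Let T1 := leg1 (mapw t). Let T2 := leg2 (mapz t).
Let U1 := leg1 uw. Let U2 := leg2 uz.
Let G1 := leg1 gE. Let G2 := leg2 gE.
Let S1 := leg1 (mapw s_). Let S2 := leg2 (mapz s_).
Let RR := Rk q zK wK.
Let RP (p r : P) := Rk q (zK * wK) 1 (r.1, p.2) (p.1, r.2).
Let ER : P -> P -> ps2 A := emb _ RR.
Let EP : P -> P -> ps2 A := emb _ RP.

Lemma S1E : S1 = mm T1 (mm G1 U1).
Proof.
rewrite /S1 /T1 /G1 /U1 !leg1M; congr leg1; apply/funext=> i; apply/funext=> j.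
rewrite !sum_ord2 /uw /mapw /gE /gK !eqxx !o_eqs /= s_coefE inwB inwZC !inwM.
by rewrite !mulr_algl !scale0r add0r addr0 scaleN1r mulrN -scalerAr.
Qed.
Lemma S2E : S2 = mm T2 (mm G2 U2).
Proof.
rewrite /S2 /T2 /G2 /U2 !leg2M; congr leg2; apply/funext=> i; apply/funext=> j.
rewrite !sum_ord2 /uz /mapz /gE /gK !eqxx !o_eqs /= s_coefE inzB inzZC !inzM.
by rewrite !mulr_algl !scale0r add0r addr0 scaleN1r mulrN -scalerAr.
Qed.

Lemma R_TT : mm ER (mm T1 T2) = mm (mm T2 T1) ER.
Proof.
apply/mat_ext=> i k j l; rewrite mm_embl mm_embr.
under eq_bigr do under eq_bigr do rewrite mm_leg12.
under [RHS]eq_bigr do under eq_bigr do rewrite mm_leg21.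
exact: rtt_TT.
Qed.

Lemma RP_UT : mm U1 (mm EP T2) = mm T2 (mm EP U1).
Proof.
apply/mat_ext=> i k j l; rewrite mm_leg1l mm_leg2l.
transitivity (\sum_(a < 2) \sum_(b < 2)
   Rk q (zK * wK) 1 (j, k) (a, b) *: (mapw tb a i * mapz t b l)).
  apply: eq_bigr => a _; rewrite mm_leg2r big_distrr; apply: eq_bigr => b _.
  by rewrite /= mulr_algl -scalerAr.
rewrite rtt_BT exchange_big; apply: eq_bigr => b _; rewrite mm_leg1r big_distrr.
by apply: eq_bigr => a _; rewrite /= mulr_algl -scalerAr.
Qed.

Lemma Rk_tr al be i k j l : Rk q al be (i, k) (j, l) = Rk q al be (l, j) (k, i).
Proof.
by rewrite /Rk /=; congr (cK _ * _ + cK _ * _); rewrite /Ral /Rbe;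
 case: (ord2P i) => ->; case: (ord2P k) => ->; case: (ord2P j) => ->; case: (ord2P l) => ->;
 rewrite ?eqxx ?o_eqs /=.
Qed.

Lemma RP_TU : mm T1 (mm EP U2) = mm U2 (mm EP T1).
Proof.
apply/mat_ext=> i k j l; rewrite mm_leg1l mm_leg2l.
transitivity (\sum_(b < 2) \sum_(a < 2)
   Rk q (zK * wK) 1 (a, b) (k, j) *: (mapw t i b * mapz tb l a)).
  apply: eq_bigr => b _; rewrite mm_leg2r big_distrr; apply: eq_bigr => a _.
  by rewrite /= mulr_algl -scalerAr /RP /= Rk_tr.
rewrite exchange_big -(rtt_BT_swap l i k j).
apply: eq_bigr => b _; rewrite mm_leg1r big_distrr.
by apply: eq_bigr => a _; rewrite /= mulr_algl -scalerAr /RP /= Rk_tr.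
Qed.

(** The scalar in the unitarity relation R(z, w) R_21(w, z) = rho. The matrix [RT] is the transpose
    of R(w, z), which is R_21(w, z) by [Rk_tr]. Transposing the relation for Tb yields an exchange
    rule with [RT]; unitarity converts it into one with R(z, w). *)
Definition rho : K2 := (Qi * zK - Qk * wK) * (Qi * wK - Qk * zK).
Let RT (p r : P) : K2 := Rk q wK zK r p.

Lemma cKB a b : cK (a - b) = cK a - cK b. Proof. exact: rmorphB. Qed.
Lemma cKN a : cK (- a) = - cK a. Proof. exact: rmorphN. Qed.
Lemma cK1 : cK 1 = 1. Proof. exact: rmorph1. Qed.
Lemma cK0 : cK 0 = 0. Proof. exact: rmorph0. Qed.

Lemma RkE i k a b al be : Rk q al be (i, k) (a, b) =
  if (i == a) && (k == b) then (if i == k then Qi * al - Qk * be else al - be)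
  else if (i == b) && (k == a) then (if (k < i)%N then (Qi - Qk) * al else if (i < k)%N then (Qi -
    Qk) * be else 0)
  else 0.
Proof.
rewrite /Rk [_.1]/= [_.2]/= [(a, b).1]/= [(a, b).2]/= /Ral /Rbe.
case: ((i == a) && (k == b)).
  case: (i == k); first by rewrite cKN mulNr.
  by rewrite cK1 cKN cK1 mul1r mulN1r.
case: (i == b); case: (k == a); rewrite /andb ?cK0 ?mul0r ?addr0 //.
by case: ltngtP; rewrite ?cKB ?cK0 ?mul0r ?addr0 ?add0r.
Qed.

Lemma RRT p r : \sum_s RR p s * RT s r = rho * (p == r)%:R.
Proof.
have := QkV; rewrite /rho; move: (cK q) (cK q^-1) (RkE) => Q I RE QI.
case: p => i k; case: r => j l; rewrite sum_pair2 !sum_ord2 /RR /RT !RE -pair_eqE /=.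
case: (ord2P i) => ->; case: (ord2P k) => ->; case: (ord2P j) => ->; case: (ord2P l) => ->;
  rewrite ?eqxx ?o_eqs /=; ring: QI.
Qed.

Lemma RTR p r : \sum_s RT p s * RR s r = rho * (p == r)%:R.
Proof.
have := QkV; rewrite /rho; move: (cK q) (cK q^-1) (RkE) => Q I RE QI.
case: p => i k; case: r => j l; rewrite sum_pair2 !sum_ord2 /RR /RT !RE -pair_eqE /=.
case: (ord2P i) => ->; case: (ord2P k) => ->; case: (ord2P j) => ->; case: (ord2P l) => ->;
  rewrite ?eqxx ?o_eqs /=; ring: QI.
Qed.

Lemma mm_embM (M N : P -> P -> K2) (L : P -> P -> K2) :
  (forall p r, \sum_s M p s * N s r = L p r) ->
  mm (emb (ps2 A) M) (emb (ps2 A) N) = emb (ps2 A) L.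
Proof.
move=> H; apply/funext=> p; apply/funext=> r; rewrite /mm /emb -H scaler_suml.
by apply: eq_bigr => s _; rewrite mulr_algl scalerA.
Qed.

Lemma mm_embrho (M : P -> P -> ps2 A) :
  mm (emb (ps2 A) (fun p r => rho * (p == r)%:R)) M = fun p r => rho *: M p r.
Proof.
apply/funext=> p; apply/funext=> r; rewrite /mm (bigD1 p) //= big1 ?addr0 => [|s /negPf].
  by rewrite /emb eqxx mulr1 mulr_algl.
by rewrite eq_sym /emb => ->; rewrite mulr0 scale0r mul0r.
Qed.
Lemma mm_rhoemb (M : P -> P -> ps2 A) :
  mm M (emb (ps2 A) (fun p r => rho * (p == r)%:R)) = fun p r => rho *: M p r.
Proof.
apply/funext=> p; apply/funext=> r; rewrite /mm (bigD1 r) //= big1 ?addr0 => [|s /negPf].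
  by rewrite /emb eqxx mulr1 mulr_algr.
by rewrite /emb => ->; rewrite mulr0 scale0r mulr0.
Qed.

Lemma rho_regular (f g : ps2 A) : rho *: f = rho *: g -> f = g.
Proof.
apply: (@K2_regular A rho (-1) 2) => //; last by rewrite oppr_eq0 oner_eq0.
have -> : rho = cK (-1) * wK ^+ 2 + zK * ((Qi ^+ 2 + Qk ^+ 2) * wK - zK).
  by rewrite /rho cKN cK1; ring: QkV.
by rewrite psD psXM addr0 psC_mul /wK -rmorphXn.
Qed.

Lemma R_BB_tr : mm (mm U1 U2) (emb _ RT) = mm (emb _ RT) (mm U2 U1).
Proof.
apply/mat_ext=> i k j l; rewrite mm_embl mm_embr.
transitivity (\sum_(a < 2) \sum_(b < 2) Rk q wK zK (j, l) (a, b) *: (mapw tb a i * mapz tb b k)).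
  apply: eq_bigr => a _; apply: eq_bigr => b _; rewrite mm_leg12 /RT /=.
  by rewrite Rk_tr.
rewrite (rtt_BB j l i k); apply: eq_bigr => a _; apply: eq_bigr => b _.
by rewrite mm_leg21 /RT Rk_tr.
Qed.

(** Conjugation by M without an inverse: multiply X N = N Y by M from both sides and cancel the
    central factor [rho]. *)
Lemma mm_cancel_rho (M N X Y : P -> P -> ps2 A) :
  mm M N = emb _ (fun p r => rho * (p == r)%:R) ->
  mm N M = emb _ (fun p r => rho * (p == r)%:R) ->
  mm X N = mm N Y -> mm M X = mm Y M.
Proof.
move=> E1 E2 H.
have H1 : mm (mm M X) (mm N M) = mm (mm M N) (mm Y M).
  rewrite -mmA.
  rewrite (mmA X).
  rewrite H.
  rewrite -(mmA N).
  by rewrite mmA.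
rewrite E1 in H1.
rewrite E2 in H1.
rewrite (mm_rhoemb (mm M X)) in H1.
rewrite (mm_embrho (mm Y M)) in H1.
apply/mat_ext=> i k j l; apply: rho_regular.
exact: (f_equal (fun F => F (i, k) (j, l)) H1).
Qed.

Lemma R_BB : mm ER (mm U1 U2) = mm (mm U2 U1) ER.
Proof.
have E1 : mm ER (emb _ RT) = emb _ (fun p r => rho * (p == r)%:R) by exact: mm_embM RRT.
have E2 : mm (emb _ RT) ER = emb _ (fun p r => rho * (p == r)%:R) by exact: mm_embM RTR.
refine (mm_cancel_rho E1 E2 _).
exact: R_BB_tr.
Qed.

Let RPG (p r : P) : K2 := \sum_a gK p.1 a * \sum_b RP (a, p.2) (r.1, b) * gK b r.2.
Let GRP (p r : P) : K2 := \sum_a (\sum_b gK p.2 b * RP (p.1, b) (a, r.2)) * gK a r.1.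

Lemma RPGE i k j l : RPG (i, k) (j, l) =
  gK i o1 * (RP (o1, k) (j, o1) * gK o1 l + RP (o1, k) (j, o2) * gK o2 l)
  + gK i o2 * (RP (o2, k) (j, o1) * gK o1 l + RP (o2, k) (j, o2) * gK o2 l).
Proof. by rewrite /RPG 3!sum_ord2. Qed.
Lemma GRPE i k j l : GRP (i, k) (j, l) =
  (gK k o1 * RP (i, o1) (o1, l) + gK k o2 * RP (i, o2) (o1, l)) * gK o1 j
  + (gK k o1 * RP (i, o1) (o2, l) + gK k o2 * RP (i, o2) (o2, l)) * gK o2 j.
Proof. by rewrite /GRP 3!sum_ord2. Qed.

Lemma sum_pair4 (V : nmodType) (F : P -> V) :
  \sum_s F s = (F (o1, o1) + F (o1, o2)) + (F (o2, o1) + F (o2, o2)).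
Proof. by rewrite sum_pair2 3!sum_ord2. Qed.

(** The constant matrix G is itself a solution of the reflection equation; this is where its special
    form matters. It is an identity of scalars, verified entry by entry. *)
Lemma RGG : forall p r, \sum_s RR p s * RPG s r = \sum_s GRP p s * RR s r.
Proof.
case=> i k [j l]; rewrite 2!sum_pair4 !RPGE !GRPE /RR /RP /fst /snd.
have := QkV; rewrite /gK; move: (cK q) (cK q^-1) (RkE) => Q I RE QI.
rewrite !RE {RE}; move: zK wK QI => z w.
case: (ord2P i) => ->; case: (ord2P k) => ->; case: (ord2P j) => ->; case: (ord2P l) => -> QI;
  rewrite ?eqxx ?o_eqs /=; ring: QI.
Qed.

Lemma G1RPG2 : mm G1 (mm EP G2) = emb _ RPG.
Proof.
apply/mat_ext=> i k j l; rewrite mm_leg1l /emb /RPG scaler_suml; apply: eq_bigr => a _.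
rewrite mm_leg2r mulr_algl -scalerA scaler_suml; congr (_ *: _); apply: eq_bigr => b _.
by rewrite mulr_algl scalerA.
Qed.
Lemma G2RPG1 : mm (mm G2 EP) G1 = emb _ GRP.
Proof.
apply/mat_ext=> i k j l; rewrite mm_leg1r /emb /GRP scaler_suml; apply: eq_bigr => a _.
rewrite mm_leg2l mulr_algr mulrC -scalerA scaler_suml; congr (_ *: _); apply: eq_bigr => b _.
by rewrite mulr_algl scalerA.
Qed.

Lemma gE_comm i j x : GRing.comm (gE i j) x.
Proof. by rewrite /GRing.comm mulr_algl mulr_algr. Qed.

(* S = T G Tb^t with G = [[0, q], [-1, 0]]; EP is the partial transpose of R at (wz, 1). *)
Lemma reflection : mm (mm (mm ER S1) EP) S2 = mm (mm (mm S2 EP) S1) ER.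
Proof.
have TG : mm T1 G2 = mm G2 T1 by apply: mm_legC => *; exact/commr_sym/gE_comm.
have GT : mm G1 T2 = mm T2 G1 by apply: mm_legC => *; exact: gE_comm.
have UG : mm U1 G2 = mm G2 U1 by apply: mm_legC => *; exact/commr_sym/gE_comm.
have GU : mm G1 U2 = mm U2 G1 by apply: mm_legC => *; exact: gE_comm.
have GG : mm ER (mm G1 (mm EP G2)) = mm (mm (mm G2 EP) G1) ER.
  by rewrite G1RPG2 G2RPG1; rewrite (mm_embM RGG) (mm_embM (fun p r => erefl)).
rewrite S1E S2E.
exact: (assoc_reflection (@mmA _ _) R_TT RP_UT RP_TU R_BB GG TG GT UG GU).
Qed.
End Reflection.

(** * Linear identities in a noncommutative algebra, decided by computation *)

Section LinearReflection.
Variables (K : comNzRingType) (V : lmodType K).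

Inductive lin_expr : Type :=
  | LinAtom of nat | LinAdd of lin_expr & lin_expr | LinOpp of lin_expr
  | LinScale of K & lin_expr | LinZero.

Fixpoint lin_eval (env : seq V) e : V :=
  match e with
  | LinAtom n => nth 0 env n
  | LinAdd e1 e2 => lin_eval env e1 + lin_eval env e2
  | LinOpp e1 => - lin_eval env e1
  | LinScale k e1 => k *: lin_eval env e1
  | LinZero => 0
  end.

Fixpoint lin_coef (n : nat) e : K :=
  match e with
  | LinAtom m => if eqn m n then 1 else 0
  | LinAdd e1 e2 => lin_coef n e1 + lin_coef n e2
  | LinOpp e1 => - lin_coef n e1
  | LinScale k e1 => k * lin_coef n e1
  | LinZero => 0
  end.

Fixpoint lin_same N e1 e2 : Prop :=
  if N is N'.+1 then lin_coef N' e1 = lin_coef N' e2 /\ lin_same N' e1 e2 else True.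

Lemma lin_evalE env e : lin_eval env e = \sum_(i < size env) lin_coef i e *: env`_i.
Proof.
elim: e => [n|e1 IH1 e2 IH2|e IH|k e IH|] /=.
- have [lt|ge] := ltnP n (size env).
    rewrite (bigD1 (Ordinal lt)) //= eqnE eqxx scale1r big1 ?addr0 // => i.
    by rewrite -val_eqE /= ?eqnE eq_sym => /negPf ->; rewrite scale0r.
  rewrite nth_default // big1 // => i _; rewrite eqnE; case: eqP => [E|_]; last exact: scale0r.
  by move: ge; rewrite E leqNgt ltn_ord.
- by rewrite IH1 IH2 -big_split; apply: eq_bigr => i _; rewrite scalerDl.
- by rewrite IH -sumrN; apply: eq_bigr => i _; rewrite scaleNr.
- by rewrite IH scaler_sumr; apply: eq_bigr => i _; rewrite scalerA.
by rewrite big1 // => i _; rewrite scale0r.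
Qed.

Lemma lin_same_eval env e1 e2 :
  lin_same (size env) e1 e2 -> lin_eval env e1 = lin_eval env e2.
Proof.
move=> H; rewrite !lin_evalE; apply: eq_bigr => i _; congr (_ *: _).
elim: (size env) i H => [[]//|N IH] i /= [E H].
have [->//|ne] := eqVneq (i : nat) N.
have lt : (i < N)%N by rewrite ltn_neqAle ne -ltnS ltn_ord.
exact: (IH (Ordinal lt)).
Qed.
End LinearReflection.

(** The form in which a known relation [c = d] enters: what remains is [a - b = c - d], an identity
    of linear combinations that can be checked atom by atom with [lin_split]. *)
Lemma eq_of_subr (V : zmodType) (a b c d : V) : c = d -> a - b = c - d -> a = b.
Proof. by move=> -> /eqP; rewrite subrr subr_eq0 => /eqP. Qed.

Ltac lin_mem a l :=
  lazymatch l with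
  | nil => constr:(false)
  | cons ?b ?l' =>
    match goal with
    | _ => let _ := match goal with _ => unify a b end in constr:(true)
    | _ => lin_mem a l'
    end
  end.
Ltac lin_atoms t l :=
  lazymatch t with
  | (?a + ?b)%R => let l1 := lin_atoms a l in lin_atoms b l1
  | (- ?a)%R => lin_atoms a l
  | (_ *: ?a)%R => lin_atoms a l
  | 0%R => l
  | _ => let m := lin_mem t l in
         lazymatch m with true => l | false => constr:(cons t l) end
  end.
Ltac lin_index a l :=
  lazymatch l with
  | cons ?b ?l' =>
    match goal with
    | _ => let _ := match goal with _ => unify a b end in constr:(O)
    | _ => let n := lin_index a l' in constr:(S n)
    end
  end.
Ltac lin_reify K t l :=
  lazymatch t with
  | (?a + ?b)%R => let x := lin_reify K a l in let y := lin_reify K b l in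
                   constr:(@LinAdd K x y)
  | (- ?a)%R => let x := lin_reify K a l in constr:(@LinOpp K x)
  | (?k *: ?a)%R => let x := lin_reify K a l in constr:(@LinScale K k x)
  | 0%R => constr:(@LinZero K)
  | _ => let n := lin_index t l in constr:(@LinAtom K n)
  end.
(* Reduces an equality of linear combinations over K to one equality in K per atom. *)
Ltac lin_split K V :=
  lazymatch goal with
  | |- ?a = ?b =>
    let l0 := lin_atoms a constr:(@nil V) in let l := lin_atoms b l0 in
    let x := lin_reify K a l in let y := lin_reify K b l in
    refine (@lin_same_eval K V l x y _);
    cbn [lin_same lin_coef size eqn];
    repeat (split; [idtac|]); try exact I
  end.

(** * Commutation relations between the entries of S *)

Section AbstractRelations.
Variables (K : comNzRingType) (E : algType K) (Q I z w : K) (QI : Q * I = 1).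
Variables sw sz : 'I_2 -> 'I_2 -> E.

(** The entries of R as in [RkE], over an arbitrary commutative ring, so that [ring] works with
    indeterminates instead of power series. *)
Definition rmat (al be : K) (i k a b : 'I_2) : K :=
  if (i == a) && (k == b) then (if i == k then I * al - Q * be else al - be)
  else if (i == b) && (k == a) then (if (k < i)%N then (I - Q) * al else if (i < k)%N then (I - Q)
    * be else 0)
  else 0.

Hypothesis refl : forall i k j l,
  \sum_(a < 2) \sum_(b < 2) \sum_(a2 < 2) \sum_(b2 < 2)
     (rmat z w i k a b * rmat (z * w) 1 j b a2 b2) *: (sw a a2 * sz b2 l)
  = \sum_(a2 < 2) \sum_(b2 < 2) \sum_(b < 2) \sum_(a < 2)
     (rmat z w a2 b2 j l * rmat (z * w) 1 a b i b2) *: (sz k b * sw a a2).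

Local Notation h := (I - Q).

(** One entry of the reflection equation, solved for s21 s22 so that s22 can be moved to the left.
    The next two relations do the same for s12, where products s21 s22 remain on the right, and for
    s11. *)
Lemma abs_comm_ab :
  ((z - w) * (1 - z * w)) *: (sz o2 o1 * sw o2 o2)
  = ((z - Q ^+ 2 * w) * (1 - I ^+ 2 * (z * w))) *: (sw o2 o2 * sz o2 o1)
    - (h * w * (Q - I * (z * w))) *: (sz o2 o2 * sw o2 o1)
    + (h * (z - w)) *: (sz o2 o2 * sw o1 o2).
Proof.
have := refl o2 o2 o2 o1; rewrite 30!sum_ord2 /rmat ?eqxx ?o_eqs /= => H.
apply: (eq_of_subr H); lin_split K E; ring: QI.
Qed.

Lemma abs_comm_eb :
  ((z - w) * (Q - I * (z * w))) *: (sw o1 o2 * sz o2 o2)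
  = ((I * z * (1 - z * w) - Q * w * (1 - z * w))) *: (sz o2 o2 * sw o1 o2)
    + (h ^+ 2 * (z * w ^+ 2)) *: (sw o2 o1 * sz o2 o2)
    - (h * w * (1 - z * w)) *: (sw o2 o2 * sz o1 o2)
    + (z * w * (z + w - I ^+ 2 * z - Q ^+ 2 * w)) *: (sz o2 o1 * sw o2 o2).
Proof.
have := refl o1 o2 o2 o2; rewrite 30!sum_ord2 /rmat ?eqxx ?o_eqs /= => /esym H.
apply: (eq_of_subr H); lin_split K E; ring: QI.
Qed.

Lemma abs_comm_cb :
  ((z - w) * (1 - z * w)) *: (sw o1 o1 * sz o2 o2 - sz o2 o2 * sw o1 o1)
  = (z * h * (Q - I * (z * w))) *: (sz o2 o1 * sw o1 o2)
    + (h * (z - w)) *: (sw o1 o2 * sz o1 o2)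
    - (w * h * (Q - I * (z * w))) *: (sw o2 o1 * sz o1 o2)
    - (h * (z * w * (z - w))) *: (sz o2 o1 * sw o2 o1).
Proof.
have := refl o1 o2 o1 o2; rewrite 30!sum_ord2 /rmat ?eqxx ?o_eqs /= => /esym H.
apply: (eq_of_subr H); lin_split K E; ring: QI.
Qed.
End AbstractRelations.

Section Relations.
Variables (q : C) (q0 : q != 0) (A : algType C).
Variables (t tb : 'I_2 -> 'I_2 -> nat -> A) (ti tbi : 'I_2 -> A).
Hypothesis HU : Uext_rels q t tb ti tbi.

Local Notation s_ := (s_coef q t tb).
Local Notation Rzw := (Rk q zK wK).
Local Notation Rp p r := (Rk q (zK * wK) 1 (r.1, p.2) (p.1, r.2)).

Lemma reflection_entry i k j l :
  \sum_(a < 2) \sum_(b < 2) \sum_(a2 < 2) \sum_(b2 < 2)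
     (Rzw (i, k) (a, b) * Rk q (zK * wK) 1 (j, b) (a2, b2))
       *: (inw (s_ a a2) * inz (s_ b2 l) : ps2 A)
  = \sum_(a2 < 2) \sum_(b2 < 2) \sum_(b < 2) \sum_(a < 2)
     (Rzw (a2, b2) (j, l) * Rk q (zK * wK) 1 (a, b) (i, b2))
       *: (inz (s_ k b) * inw (s_ a a2) : ps2 A).
Proof.
have := f_equal (fun X => X (i, k) (j, l)) (reflection q0 HU).
rewrite -!mmA => H.
have L (X Y : 'I_2 -> 'I_2 -> ps2 A) (M N : _ -> _ -> K2) :
   mm (emb _ M) (mm (leg1 X) (mm (emb _ N) (leg2 Y))) (i, k) (j, l)
   = \sum_(a < 2) \sum_(b < 2) \sum_(a2 < 2) \sum_(b2 < 2)
       (M (i, k) (a, b) * N (a2, b) (j, b2)) *: (X a a2 * Y b2 l).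
  rewrite mm_embl; apply: eq_bigr => a _; apply: eq_bigr => b _.
  rewrite mm_leg1l scaler_sumr; apply: eq_bigr => a2 _.
  rewrite mm_leg2r big_distrr scaler_sumr; apply: eq_bigr => b2 _.
  by rewrite /= mulr_algl -scalerAr scalerA.
have L' (X Y : 'I_2 -> 'I_2 -> ps2 A) (M N : _ -> _ -> K2) :
   mm (leg2 Y) (mm (emb _ N) (mm (leg1 X) (emb _ M))) (i, k) (j, l)
   = \sum_(a2 < 2) \sum_(b2 < 2) \sum_(b < 2) \sum_(a < 2)
       (M (a2, b2) (j, l) * N (i, b) (a, b2)) *: (Y k b * X a a2).
  rewrite (mmA (emb _ N)) mmA mm_embr; apply: eq_bigr => a2 _; apply: eq_bigr => b2 _.
  rewrite mm_leg2l scaler_sumr; apply: eq_bigr => b _.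
  rewrite mm_leg1r big_distrr scaler_sumr; apply: eq_bigr => a _.
  by rewrite /= mulr_algl -scalerAr scalerA.
pose N (p r : 'I_2 * 'I_2) : K2 := Rp p r.
exact: (etrans (esym (L (mapw s_) (mapz s_) Rzw N)) (etrans H (L' (mapw s_) (mapz s_) Rzw N))).
Qed.

Local Notation Qk := (cK q).
Local Notation Qi := (cK q^-1).
Local Notation a_ := (s_ o2 o1).
Local Notation b_ := (s_ o2 o2).
Local Notation c_ := (s_ o1 o1).
Local Notation e_ := (s_ o1 o2).
Local Notation hK := (Qi - Qk).

Let refl i k j l :
  \sum_(a < 2) \sum_(b < 2) \sum_(a2 < 2) \sum_(b2 < 2)
     (rmat Qk Qi zK wK i k a b * rmat Qk Qi (zK * wK) 1 j b a2 b2)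
     *: (mapw s_ a a2 * mapz s_ b2 l)
  = \sum_(a2 < 2) \sum_(b2 < 2) \sum_(b < 2) \sum_(a < 2)
     (rmat Qk Qi zK wK a2 b2 j l * rmat Qk Qi (zK * wK) 1 a b i b2)
     *: (mapz s_ k b * mapw s_ a a2).
Proof.
have := reflection_entry i k j l.
by rewrite /rmat; under eq_bigr do under eq_bigr do under eq_bigr do under eq_bigr do rewrite !RkE;
 under [RHS]eq_bigr do under eq_bigr do under eq_bigr do under eq_bigr do rewrite !RkE.
Qed.

Definition comm_ab := abs_comm_ab (QkV q0) refl.
Definition comm_eb := abs_comm_eb (QkV q0) refl.
Definition comm_cb := abs_comm_cb (QkV q0) refl.
End Relations.

Section OneVariable.
Variable A : algType C.
Implicit Types x y : ps A.

Lemma ps_divide (L : A -> Prop) (f : ps C) x : linear_pred L -> f 0%N != 0 ->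
  (forall n, L ((f *: x) n)) -> forall n, L (x n).
Proof.
move=> [L0 LD LZ] f0 H; elim/ltn_ind=> n IH; have := H n.
rewrite psZ big_ord_recl subn0 => Hn.
set s := \sum_(i < n) _ in Hn.
have Ls : L s.
  apply: (@linear_pred_sum A L); first by split.
  move=> i; apply: (LZ); apply: (IH).
  by rewrite lift0 ltn_subrL /= (leq_ltn_trans (leq0n i)).
have := LZ (f 0%N)^-1 _ (LD _ _ Hn (LZ (-1) _ Ls)).
by rewrite scaleN1r addrK scalerA mulVf // scale1r.
Qed.

Lemma ps_regular (f : ps C) x y : f 0%N != 0 -> f *: x = f *: y -> x = y.
Proof.
move=> f0 E; apply/subr0_eq/psP=> n; rewrite ps0.
refine (@ps_divide (fun a : A => a = 0) f (x - y) _ f0 _ n).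
  by split=> // [a b -> ->|c a ->]; rewrite ?addr0 ?scaler0.
by move=> m; rewrite scalerBr E subrr ps0.
Qed.
End OneVariable.

Section SettingWToZero.
Variable R : nzRingType.
Definition evw0 (f : ps (ps R)) : ps R := fun n => f n 0%N.
Fact evw0_zmod : zmod_morphism evw0. Proof. by []. Qed.
HB.instance Definition _ :=
  GRing.isZmodMorphism.Build (ps (ps R)) (ps R) evw0 evw0_zmod.
Fact evw0_monoid : monoid_morphism evw0.
Proof.
split=> [|f g]; apply/psP=> n; rewrite /evw0; first by case: n.
by rewrite !psM ps_sum; apply: eq_bigr => i _; rewrite psM0.
Qed.
HB.instance Definition _ :=
  GRing.isMonoidMorphism.Build (ps (ps R)) (ps R) evw0 evw0_monoid.
End SettingWToZero.

Definition evK (k : K2) : ps C := evw0 k.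
Lemma evKz : evK zK = psX. Proof. by apply/psP=> -[|[|n]]. Qed.
Lemma evKw : evK wK = 0. Proof. by apply/psP=> -[|n]; rewrite ps0. Qed.
Lemma evKc c : evK (cK c) = ps_const c. Proof. by apply/psP=> -[|n]. Qed.
Lemma evK1 : evK 1 = 1. Proof. exact: rmorph1. Qed.
Lemma evKM k l : evK (k * l) = evK k * evK l. Proof. exact: rmorphM. Qed.
Lemma evKB k l : evK (k - l) = evK k - evK l. Proof. exact: raddfB. Qed.
Lemma evKD k l : evK (k + l) = evK k + evK l. Proof. exact: raddfD. Qed.
Definition evKE := (evKM, evKB, evKD, evKz, evKw, evKc, evK1).

Lemma evw0D (A : algType C) (f g : ps2 A) : evw0 (f + g) = evw0 f + evw0 g. Proof. by []. Qed.
Lemma evw0B (A : algType C) (f g : ps2 A) : evw0 (f - g) = evw0 f - evw0 g. Proof. by []. Qed.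
Lemma evw0Z (A : algType C) (k : K2) (f : ps2 A) : evw0 (k *: f) = evK k *: evw0 f.
Proof.
apply/psP=> n; rewrite /evw0 !psZ ps_sum; apply: eq_bigr => i _.
by rewrite psZ big_ord1.
Qed.

(** The mixed RTT relation at z = w relates the products tb t to the products t tb; this combination
    of four entries isolates the two products that make up sb21. The factor 1 - q^2 w^2 common to
    both sides is cancelled in [smat_bar]. *)
Lemma abs_smat_bar (K : comNzRingType) (E : algType K) (Q I w : K) (QI : Q * I = 1)
   (t tb : 'I_2 -> 'I_2 -> E) :
  (forall i k j l, \sum_(a < 2) \sum_(b < 2) rmat Q I (w ^+ 2) 1 i k a b *: (tb a j * t b l)
  = \sum_(a < 2) \sum_(b < 2) rmat Q I (w ^+ 2) 1 a b j l *: (t k b * tb i a)) ->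
  ((1 - Q ^+ 2 * w ^+ 2) * (1 - I ^+ 2 * w ^+ 2)) *: (Q *: (tb o2 o1 * t o1 o2) - tb o2 o2 * t o1 o1)
  = (1 - Q ^+ 2 * w ^+ 2) *: ((I * (w ^+ 2 - 1)) *: (Q *: (t o1 o1 * tb o2 o2) - t o1 o2 * tb o2 o1)
      - (I * (I - Q) * w ^+ 2) *: (Q *: (t o2 o1 * tb o1 o2) - t o2 o2 * tb o1 o1)).
Proof.
move=> H; have := (H o2 o1 o2 o1, H o2 o1 o1 o2, H o1 o2 o1 o2, H o1 o2 o2 o1).
rewrite !sum_ord2 /rmat ?eqxx ?o_eqs /= => -[[[H1 H2] H3] H4].
have {H H1 H2 H3 H4}H := f_equal2 +%R (f_equal2 +%R (f_equal ( *:%R (Q * (w ^+ 2 - 1))) H2)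
  (f_equal ( *:%R (- (Q * (I - Q) * w ^+ 2))) H3))
  (f_equal2 +%R (f_equal ( *:%R (- (w ^+ 2 - 1))) H1) (f_equal ( *:%R ((I - Q) * w ^+ 2)) H4)).
apply: (eq_of_subr H); lin_split K E; ring: QI.
Qed.

Section ConstantTerms.
Variables (q : C) (q0 : q != 0) (A : algType C).
Variables (t tb : 'I_2 -> 'I_2 -> nat -> A) (ti tbi : 'I_2 -> A).
Hypothesis HU : Uext_rels q t tb ti tbi.
Local Notation s_ := (s_coef q t tb).
Local Notation h := (q^-1 - q).

Let evwz i j k l n : evw0 (mapw s_ i j * mapz s_ k l) n = s_ i j 0%N * s_ k l n.
Proof. by rewrite /evw0 inwM_inz. Qed.
Let evzw i j k l n : evw0 (mapz s_ i j * mapw s_ k l) n = s_ i j n * s_ k l 0%N.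
Proof. by rewrite /evw0 inzM_inw. Qed.

Lemma comm_ab0 n :
  s_ o2 o1 n * s_ o2 o2 0%N = s_ o2 o2 0%N * s_ o2 o1 n + h *: (s_ o2 o2 n * s_ o1 o2 0%N).
Proof.
(* At w = 0 every surviving coefficient of the relation contains a factor z, hence the index
   [n.+1]. *)
have := f_equal (fun f : ps2 A => evw0 f n.+1) (comm_ab q0 HU).
rewrite evw0D evw0B !evw0Z !evKE -[ps_const 1]/(1 : ps C).
have -> : (psX - 0) * (1 - psX * 0) = psX :> ps C by ring.
have -> : (psX - ps_const q * ps_const q * 0) *
   (1 - ps_const q^-1 * ps_const q^-1 * (psX * 0)) = psX :> ps C by ring.
have -> : (ps_const q^-1 - ps_const q) * 0 *
   (ps_const q - ps_const q^-1 * (psX * 0)) = 0 :> ps C by ring.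
have -> : (ps_const q^-1 - ps_const q) * (psX - 0) = psX * ps_const h.
  by rewrite rmorphB subr0 mulrC.
rewrite scale0r subr0 -scalerA psD !psZX psZC /=.
by rewrite evwz !evzw.
Qed.

Lemma comm_eb0 n :
  s_ o1 o2 0%N * s_ o2 o2 n = q ^- 2 *: (s_ o2 o2 n * s_ o1 o2 0%N).
Proof.
have := f_equal (fun f : ps2 A => evw0 f n.+1) (comm_eb q0 HU).
rewrite evw0D evw0B evw0D !evw0Z !evKE -[ps_const 1]/(1 : ps C).
have -> : (psX - 0) * (ps_const q - ps_const q^-1 * (psX * 0)) = psX * ps_const q :> ps C by ring.
have -> : ps_const q^-1 * psX * (1 - psX * 0) - ps_const q * 0 * (1 - psX * 0)
  = psX * ps_const q^-1 :> ps C by ring.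
have -> : (ps_const q^-1 - ps_const q) * (ps_const q^-1 - ps_const q) *
   (psX * (0 * 0)) = 0 :> ps C by ring.
have -> : (ps_const q^-1 - ps_const q) * 0 * (1 - psX * 0) = 0 :> ps C by ring.
have -> : psX * 0 * (psX + 0 - ps_const q^-1 * ps_const q^-1 * psX -
    ps_const q * ps_const q * 0) = 0 :> ps C by ring.
rewrite !scale0r !addr0 subr0 -!scalerA !psZX !psZC evwz evzw => E.
by rewrite -[LHS](scalerK q0) E scalerA -invfM.
Qed.

Lemma comm_cb0 n :
  s_ o1 o1 0%N * s_ o2 o2 n - s_ o2 o2 n * s_ o1 o1 0%N
  = h *: (q *: (s_ o2 o1 n * s_ o1 o2 0%N) + s_ o1 o2 0%N * s_ o1 o2 n).
Proof.
have := f_equal (fun f : ps2 A => evw0 f n.+1) (comm_cb q0 HU).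
rewrite 2!evw0B evw0D !evw0Z evw0B !evKE -[ps_const 1]/(1 : ps C).
have -> : (psX - 0) * (1 - psX * 0) = psX :> ps C by ring.
have -> : psX * (ps_const q^-1 - ps_const q) * (ps_const q - ps_const q^-1 * (psX * 0))
  = psX * ps_const (h * q) by rewrite rmorphM rmorphB; ring.
have -> : (ps_const q^-1 - ps_const q) * (psX - 0) = psX * ps_const h.
  by rewrite rmorphB subr0 mulrC.
have -> : 0 * (ps_const q^-1 - ps_const q) * (ps_const q - ps_const q^-1 * (psX * 0)) = 0 :> ps C
  by ring.
have -> : (ps_const q^-1 - ps_const q) * (psX * 0 * (psX - 0)) = 0 :> ps C by ring.
rewrite !scale0r !subr0 -!scalerA psD !psZX !psZC psD psN /= !evwz !evzw => ->.
by rewrite scalerDr scalerA.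
Qed.

Local Notation t_ i j := (t i j : ps A).
Local Notation tb_ i j := (tb i j : ps A).
Let Rd (p r : 'I_2 * 'I_2) : ps C :=
  rmat (ps_const q) (ps_const q^-1) (psX ^+ 2) 1 p.1 p.2 r.1 r.2.

(** On the diagonal z = w the coefficient of index N is the sum of the defining relations with r + s
    = N. *)
Let rtt_diag i k j l :
  \sum_(a < 2) \sum_(b < 2) Rd (i, k) (a, b) *: (tb_ a j * t_ b l)
  = \sum_(a < 2) \sum_(b < 2) Rd (a, b) (j, l) *: (t_ k b * tb_ i a).
Proof.
have RdE p r : Rd p r = ps_const (Ral q p.1 p.2 r.1 r.2) * psX ^+ 2 + ps_const (Rbe q p.1 p.2 r.1
  r.2).
  rewrite /Rd /rmat /Ral /Rbe.
  case: ((p.1 == r.1) && (p.2 == r.2)).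
    by case: (p.1 == p.2); rewrite ?rmorphN ?rmorph1 ?mul1r ?mulr1.
  case: (p.1 == r.2); case: (p.2 == r.1); rewrite /andb ?rmorph0 ?mul0r ?addr0 //.
  by case: ltngtP; rewrite ?rmorphB ?rmorph0 ?mul0r ?mulr1 ?addr0 ?add0r.
have pcE (f : nat -> A) : pc f = psX *: (f : ps A) :> ps A.
  by apply/psP=> -[|n]; rewrite psZX.
have X2 (x y : nat -> A) N : (psX ^+ 2 *: ((x : ps A) * y)) N
     = \sum_(r < N.+1) pc x r * pc y (N - r)%N.
  by rewrite -psM !pcE -scalerAl -scalerAr scalerA.
apply/psP=> N; rewrite !ps_sum.
have L al be (x y : nat -> A) : ((ps_const al * psX ^+ 2 + ps_const be) *: ((x : ps A) * y)) N
    = \sum_(r < N.+1) (al *: (pc x r * pc y (N - r)%N) + be *: (x r * y (N - r)%N)).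
  by rewrite scalerDl psD -scalerA !psZC X2 psM !scaler_sumr -big_split.
have L' al be (x y : nat -> A) : ((ps_const al * psX ^+ 2 + ps_const be) *: ((y : ps A) * x)) N
    = \sum_(r < N.+1) (al *: (pc y (N - r)%N * pc x r) + be *: (y (N - r)%N * x r)).
  rewrite L (reindex_inj rev_ord_inj) /=; apply: eq_bigr => s _.
  by rewrite subSS subKn -1?ltnS.
transitivity (\sum_(r < N.+1) \sum_(a < 2) \sum_(b < 2)
   (Ral q i k a b *: (pc (tb a j) r * pc (t b l) (N - r)%N) + Rbe q i k a b *: (tb a j r * t b l (N
     - r)%N))).
  rewrite [RHS]exchange_big; apply: eq_bigr => a _; rewrite ps_sum [RHS]exchange_big.
  by apply: eq_bigr => b _; rewrite RdE L.
transitivity (\sum_(r < N.+1) \sum_(a < 2) \sum_(b < 2)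
   (Ral q a b j l *: (pc (t k b) (N - r)%N * pc (tb i a) r) + Rbe q a b j l *: (t k b (N - r)%N *
     tb i a r))).
  apply: eq_bigr => r _; have [_ _ _ _ /(_ r (N - r)%N i j k l) [_ _]] := HU.
  exact.
rewrite exchange_big; apply: eq_bigr => a _; rewrite ps_sum exchange_big.
by apply: eq_bigr => b _; rewrite RdE L'.
Qed.

(** Two consequences: the coefficients of sb21 lie in Y', and on a highest weight vector s12 acts by
    a scalar series determined by [mu] and [mub]. *)
Lemma smat_bar :
  (1 - ps_const (q ^- 2) * psX ^+ 2) *: (sb_coef q t tb o2 o1 : ps A)
  = ps_const q^-1 *: ((psX ^+ 2 - 1) *: (s_ o1 o2 : ps A)
                      - (ps_const h * psX ^+ 2) *: (s_ o2 o1 : ps A)).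
Proof.
have QI : ps_const q * ps_const q^-1 = 1 by rewrite -rmorphM mulfV ?rmorph1.
have := abs_smat_bar QI rtt_diag; rewrite -sb_coefE -!s_coefE -scalerA => /ps_regular E.
have -> : 1 - ps_const (q ^- 2) * psX ^+ 2 = 1 - ps_const q^-1 ^+ 2 * psX ^+ 2 :> ps C.
  by rewrite -rmorphXn exprVn.
rewrite E; last first.
  by rewrite psD psN (expr2 psX) 2!psM0 [psX _]/= !mulr0 subr0 oner_eq0.
by rewrite [in RHS]scalerBr; congr (_ - _); rewrite scalerA ?rmorphB ?mulrA.
Qed.
End ConstantTerms.


(** * Highest weight ideals *)

Section Weights.
Variables (q : C) (q0 : q != 0).
Hypothesis hq : forall n : nat, (0 < n)%N -> q ^+ n != 1.
Variables (A : algType C) (t tb : 'I_2 -> 'I_2 -> nat -> A) (ti tbi : 'I_2 -> A).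
Hypothesis HU : Uext_rels q t tb ti tbi.

Local Notation s_ := (s_coef q t tb).
Local Notation Y := (Yq q t tb ti tbi).
Local Notation a_ := (s_ o2 o1).
Local Notation b_ := (s_ o2 o2).
Local Notation c_ := (s_ o1 o1).
Local Notation e_ := (s_ o1 o2).
Local Notation d_ := (sb_coef q t tb o2 o1).
Local Notation h := (q^-1 - q).

Lemma Yq_subalg : subalg Y.
Proof.
split=> [S [] //|x y Yx Yy S HS Hs Hi|c x Yx S HS Hs Hi|x y Yx Yy S HS Hs Hi].
- by have [_ SD _ _] := HS; apply: SD; [apply: Yx | apply: Yy].
- by have [_ _ SZ _] := HS; apply: SZ; apply: Yx.
- by have [_ _ _ SM] := HS; apply: SM; [apply: Yx | apply: Yy].
Qed.
Lemma Yq_s i j r : Y (s_ i j r). Proof. by move=> S _ Hs _; exact: Hs. Qed.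
Lemma Yq_inv : Y (s12inv q ti tbi). Proof. by move=> S _ _; exact. Qed.
Lemma Yq1 : Y 1. Proof. by have [] := Yq_subalg. Qed.
Lemma YqD x y : Y x -> Y y -> Y (x + y). Proof. by have [_ H _ _] := Yq_subalg; exact: H. Qed.
Lemma YqZ c x : Y x -> Y (c *: x). Proof. by have [_ _ H _] := Yq_subalg; exact: H. Qed.
Lemma YqM x y : Y x -> Y y -> Y (x * y). Proof. by have [_ _ _ H] := Yq_subalg; exact: H. Qed.
Lemma Yq0 : Y 0. Proof. by rewrite -(scale0r (1 : A)); apply: YqZ Yq1. Qed.
Lemma Yq_lin : linear_pred Y.
Proof. by split; [exact: Yq0 | exact: YqD | exact: YqZ]. Qed.

Lemma s12_unit : e_ 0%N * s12inv q ti tbi = 1 /\ s12inv q ti tbi * e_ 0%N = 1.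
Proof.
have [t120 _ _ H _] := HU; have [t1 t1' _ _] := H o1; have [_ _ b2 b2'] := H o2.
have -> : e_ 0%N = q *: (t o1 o1 0%N * tb o2 o2 0%N).
  by rewrite /s_coef big_ord1 t120 mul0r subr0.
rewrite /s12inv -!scalerAl -!scalerAr !scalerA mulfV // mulVf // !scale1r.
by rewrite !mulrA -(mulrA (t _ _ _)) b2 mulr1 t1 -(mulrA (tbi _)) t1' mulr1 b2'.
Qed.

Lemma sb_div (L : A -> Prop) (x : ps A) : linear_pred L ->
  (forall n, L (((1 - ps_const (q ^- 2) * psX ^+ 2) *: x) n)) -> forall n, L (x n).
Proof.
move=> HL; apply: ps_divide => //.
by rewrite psD psN (expr2 psX) 2!psM0 [psX _]/= !mulr0 subr0 oner_eq0.
Qed.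

Lemma Yq_sb r : Y (d_ r).
Proof.
apply: (@sb_div Y (d_ : ps A)); first exact: Yq_lin.
rewrite (smat_bar q0 HU); apply: linear_predZ_ps => //; first exact: Yq_lin.
move=> n; rewrite psD psN -scaleN1r; apply: YqD; last apply: YqZ;
 apply: linear_predZ_ps => //; do ?exact: Yq_lin; move=> m; exact: Yq_s.
Qed.

Variables mu mub : nat -> C.

Definition geo2 : ps C := fun n => (~~ odd n)%:R.
Lemma geo2E : (1 - psX ^+ 2) * geo2 = 1.
Proof.
apply/psP=> n; rewrite mulrBl mul1r expr2 -mulrA psD psN psXM.
case: n => [|[|n]]; rewrite ?psXM /geo2 /= ?subr0 ?negbK ?subrr //.
Qed.

(** The eigenvalue of s12 on the highest weight vector, found by solving [smat_bar]; [geo2] is 1/(1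
    - w^2). *)
Definition sig : ps C :=
  - geo2 * (ps_const q * (1 - ps_const (q ^- 2) * psX ^+ 2) * (mub : ps C)
            + ps_const h * psX ^+ 2 * (mu : ps C)).
Lemma sigE : (psX ^+ 2 - 1) * sig
  = ps_const q * (1 - ps_const (q ^- 2) * psX ^+ 2) * (mub : ps C)
            + ps_const h * psX ^+ 2 * (mu : ps C).
Proof.
have E (S : ps C) : (psX ^+ 2 - 1) * (- geo2 * S) = ((1 - psX ^+ 2) * geo2) * S by ring.
by rewrite E geo2E mul1r.
Qed.
Lemma sig0 : sig 0%N = - (q * mub 0%N).
Proof.
have := f_equal (fun f : ps C => f 0%N) sigE.
rewrite expr2 psM0 psD psN psD !psM0 psD psN !psM0 [psX _]/= !(mul0r, mulr0) sub0r subr0 mulr1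
  mulN1r addr0.
by move=> <-; rewrite opprK.
Qed.

(** Stands for the highest weight module Y'/N, with 1 in the role of xi. It is applied to the Verma
    ideal, to the proper submodules and to their sum. *)
Definition hw_ideal (N : A -> Prop) : Prop :=
  [/\ left_ideal Y N, forall r, N (c_ r), forall r, N (a_ r - mu r *: 1)
    & forall r, N (d_ r - mub r *: 1)].

Section HighestWeightIdeal.
Variables (N : A -> Prop) (HN : hw_ideal N).

Lemma hwY x : N x -> Y x. Proof. by have [[H _ _ _] _ _ _] := HN; exact: H. Qed.
Lemma hw0 : N 0. Proof. by have [[_ H _ _] _ _ _] := HN. Qed.
Lemma hwD x y : N x -> N y -> N (x + y). Proof. by have [[_ _ H _] _ _ _] := HN; exact: H. Qed.
Lemma hwM y x : Y y -> N x -> N (y * x). Proof. by have [[_ _ _ H] _ _ _] := HN; exact: H. Qed.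
Lemma hwZ c x : N x -> N (c *: x).
Proof. by move=> Nx; rewrite -mulr_algl; apply: hwM => //; apply: YqZ Yq1. Qed.
Lemma hwB x y : N x -> N y -> N (x - y).
Proof. by move=> Nx Ny; apply: hwD => //; rewrite -scaleN1r; apply: hwZ. Qed.
Lemma hw_lin : linear_pred N.
Proof. by split; [exact: hw0 | exact: hwD | exact: hwZ]. Qed.
Lemma hw_c r : N (c_ r). Proof. by have [] := HN. Qed.
Lemma hw_a r : N (a_ r - mu r *: 1). Proof. by have [] := HN. Qed.
Lemma hw_d r : N (d_ r - mub r *: 1). Proof. by have [] := HN. Qed.

Lemma hw_e r : N (e_ r - sig r *: 1).
Proof.
have algZ (k f : ps C) : k *: ps_alg A f = ps_alg A (k * f) by rewrite rmorphM.
pose x : ps A := (e_ : ps A) - ps_alg A sig.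
suff: forall n, N (x n) by exact.
apply: (@ps_divide A N (psX ^+ 2 - 1)); [exact: hw_lin | | ].
  by rewrite psD psN (expr2 psX) psM0 [psX _]/= mulr0 sub0r oppr_eq0 oner_eq0.
have -> : (psX ^+ 2 - 1) *: x
   = ps_const q *: ((1 - ps_const (q ^- 2) * psX ^+ 2) *: ((d_ : ps A) - ps_alg A mub))
     + (ps_const h * psX ^+ 2) *: ((a_ : ps A) - ps_alg A mu).
  rewrite /x !scalerBr (smat_bar q0 HU) !algZ sigE !scalerA -rmorphM mulfV // rmorph1 scale1r.
  by rewrite raddfD mulrA /= [in RHS]addrACA subrK opprD.
move=> n; rewrite psD; apply: hwD.
  rewrite psZC; apply: hwZ; apply: linear_predZ_ps => [|m]; first exact: hw_lin.
  exact: hw_d.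
apply: linear_predZ_ps => [|m]; first exact: hw_lin.
exact: hw_a.
Qed.

Inductive wt_step (W : A -> Prop) : A -> Prop :=
  | wt_step_ideal x : N x -> wt_step W x
  | wt_step_b r v : W v -> wt_step W (b_ r * v)
  | wt_step_add x y : wt_step W x -> wt_step W y -> wt_step W (x + y)
  | wt_step_scale c x : wt_step W x -> wt_step W (c *: x).

(* The part of weight q^(-2k) of Y'/N, spanned by the products of k factors b_r. *)
Fixpoint wt k : A -> Prop :=
  if k is k'.+1 then wt_step (wt k') else fun x => exists c : C, N (x - c *: 1).

Lemma wt_ideal k x : N x -> wt k x.
Proof.
case: k => [|k] Nx; last exact: wt_step_ideal.
by exists 0; rewrite scale0r subr0.
Qed.
Lemma wt_lin k : linear_pred (wt k).
Proof.
split; first exact/wt_ideal/hw0.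
  case: k => [|k] x y; last exact: wt_step_add.
  move=> [c Nx] [d Ny]; exists (c + d); rewrite scalerDl opprD addrACA; exact: hwD.
case: k => [|k] c x; last exact: wt_step_scale.
by move=> [d Nx]; exists (c * d); rewrite -scalerA -scalerBr; apply: hwZ.
Qed.
Lemma wtD k x y : wt k x -> wt k y -> wt k (x + y).
Proof. by have [_ H _] := wt_lin k; exact: H. Qed.
Lemma wtZ k c x : wt k x -> wt k (c *: x).
Proof. by have [_ _ H] := wt_lin k; exact: H. Qed.
Lemma wtY k x : wt k x -> Y x.
Proof.
elim: k x => [|k IH] x.
  by move=> [c Nx]; rewrite -(subrK (c *: 1) x); apply: YqD; [exact: hwY | apply: YqZ Yq1].
elim=> [{}x|r v Wv|{}x y _ Yx _ Yy|c {}x _ Yx].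
- exact: hwY.
- by apply: YqM; [exact: Yq_s | exact: IH].
- exact: YqD.
exact: YqZ.
Qed.

(** The target of s11; below the highest weight there is only zero, that is, the ideal. *)
Definition wt_below k : A -> Prop := if k is k'.+1 then wt k' else N.

Lemma wt_below_b k r v : wt_below k v -> wt k (b_ r * v).
Proof.
case: k => [|k] Wv; last exact: wt_step_b.
by apply: wt_ideal; apply: hwM => //; exact: Yq_s.
Qed.

Lemma lin_mulr (L : A -> Prop) v : linear_pred L -> linear_pred (fun x => L (x * v)).
Proof.
move=> [L0 LD LZ]; split=> [|x y|c x]; rewrite ?mul0r // ?mulrDl -?scalerAl.
  exact: LD.
exact: LZ.
Qed.

Let divK (L : A -> Prop) (k k' : K2) (c : C) f : k = cK c * wK + zK * k' -> c != 0 ->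
  linear_pred L -> coefs_in L (k *: f : ps2 A) -> coefs_in L f.
Proof.
move=> kE c0 HL; apply: (@coefs_in_divide A L k c 1) => //.
by rewrite kE psD psXM addr0 psC_mul expr1.
Qed.

Let in_wz (L : A -> Prop) (x y : ps A) :
  (forall n m, L (x m * y n)) -> coefs_in L (inw x * inz y : ps2 A).
Proof. by move=> H n m; rewrite inwM_inz. Qed.
Let in_zw (L : A -> Prop) (x y : ps A) :
  (forall n m, L (y n * x m)) -> coefs_in L (inz y * inw x : ps2 A).
Proof. by move=> H n m; rewrite inzM_inw. Qed.
Let coefs_inB (L : A -> Prop) (f g : ps2 A) :
  linear_pred L -> coefs_in L f -> coefs_in L g -> coefs_in L (f - g).
Proof. by move=> HL Lf Lg; apply: coefs_inD => // n m; rewrite psN psN -scaleN1r;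
  have [_ _ LZ] := HL; exact: LZ. Qed.

(** Induction on k, moving each generator past the leftmost factor [b_ r]. The order of the steps
    matters: the relation for s12 s22 contains s21 s22, while the one for s11 s22 needs only the
    action of s12 and s21 on weight k. The factor on the left of each relation is c w plus a
    multiple of z, so [divK] removes it. By [comm_eb0] every [b_ r] multiplies the eigenvalue of
    [e_ 0] by q^(-2). *)
Lemma wt_act k v : wt k v ->
  [/\ forall r, wt k (a_ r * v), forall r, wt k (e_ r * v),
      forall r, wt_below k (c_ r * v) & N (e_ 0%N * v - (sig 0%N * q ^- (2 * k)) *: v)].
Proof.
elim: k v => [|k IHk] v.
  move=> [c Nv]; have E y : y * v = y * (v - c *: 1) + c *: y.
    by rewrite mulrBr -scalerAr mulr1 subrK.
  split=> [r|r|r|]; rewrite ?E /wt_below.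
  - exists (c * mu r); rewrite -scalerA -addrA -scalerBr; apply: hwD.
      by apply: hwM => //; exact: Yq_s.
    by apply: hwZ; exact: hw_a.
  - exists (c * sig r); rewrite -scalerA -addrA -scalerBr; apply: hwD.
      by apply: hwM => //; exact: Yq_s.
    by apply: hwZ; exact: hw_e.
  - by apply: hwD; [apply: hwM => //; exact: Yq_s | apply: hwZ; exact: hw_c].
  rewrite muln0 expr0 invr1 mulr1 -{2}(subrK (c *: 1) v) scalerDr opprD addrACA.
  apply: hwD; first by apply: hwB; [apply: hwM => //; exact: Yq_s | exact: hwZ].
  by rewrite scalerA mulrC -scalerA -scalerBr; apply: hwZ; exact: hw_e.
elim=> [{}v Nv|r {}v Wv|x y _ IHx _ IHy|c x _ IHx].
- split=> [r|r|r|]; try (apply: wt_ideal; apply: hwM => //; exact: Yq_s).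
  by apply: hwB; [apply: hwM => //; exact: Yq_s | exact: hwZ].
- have [av ev cv e0v] := IHk v Wv.
  have QI := QkV q0.
  pose L x := wt k.+1 (x * v); have HL : linear_pred L by exact/lin_mulr/wt_lin.
  have ab : forall i j, L (a_ i * b_ j).
    have H : coefs_in L (mapz s_ o2 o1 * mapw s_ o2 o2).
      apply: (@divK L ((zK - wK) * (1 - zK * wK)) (1 - zK * wK + wK ^+ 2) (-1) _ _ _ HL);
        last rewrite (comm_ab q0 HU).
      - by rewrite cKN cK1; ring.
      - by rewrite oppr_eq0 oner_eq0.
      apply: coefs_inD => //; first apply: coefs_inB => //.
      - by apply: coefs_inZ => //; apply: in_wz => n m; rewrite /L -mulrA; apply: wt_step_b;
        (exact: av || exact: ev).
      - by apply: coefs_inZ => //; apply: in_zw => n m; rewrite /L -mulrA; apply: wt_step_b;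
        (exact: av || exact: ev).
      by apply: coefs_inZ => //; apply: in_zw => n m; rewrite /L -mulrA; apply: wt_step_b;
        (exact: av || exact: ev).
    by move=> i j; have := H i j; rewrite inzM_inw.
  have eb : forall i j, L (e_ i * b_ j).
    have H : coefs_in L (mapw s_ o1 o2 * mapz s_ o2 o2).
      apply: (@divK L ((zK - wK) * (cK q - cK q^-1 * (zK * wK))) (cK q - cK q^-1 * (zK * wK) + cK
        q^-1 * wK ^+ 2) (- q) _ _ _ HL); last rewrite (comm_eb q0 HU).
      - by rewrite cKN; ring.
      - by rewrite oppr_eq0.
      apply: coefs_inD => //; first apply: coefs_inB => //; first apply: coefs_inD => //.
      - by apply: coefs_inZ => //; apply: in_zw => n m; rewrite /L -mulrA; apply: wt_step_b;
        (exact: av || exact: ev).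
      - by apply: coefs_inZ => //; apply: in_wz => n m; exact: ab.
      - by apply: coefs_inZ => //; apply: in_wz => n m; rewrite /L -mulrA; apply: wt_step_b;
        (exact: av || exact: ev).
      by apply: coefs_inZ => //; apply: in_zw => n m; exact: ab.
    by move=> i j; have := H j i; rewrite inwM_inz.
  split=> [i|i|i|].
  + by rewrite mulrA; exact: ab.
  + by rewrite mulrA; exact: eb.
  + rewrite /wt_below.
    pose L' x := wt k (x * v); have HL' : linear_pred L' by exact/lin_mulr/wt_lin.
    have Waa x y i' j' : (forall r u, wt k u -> wt k (x r * u)) -> wt k (y j' * v) ->
        L' ((x : ps A) i' * (y : ps A) j').
      by move=> H1 H2; rewrite /L' -mulrA; exact: H1.
    have Wa r' u : wt k u -> wt k (a_ r' * u) by move/IHk=> [].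
    have We r' u : wt k u -> wt k (e_ r' * u) by move/IHk=> [].
    have H : coefs_in L' (mapw s_ o1 o1 * mapz s_ o2 o2 - mapz s_ o2 o2 * mapw s_ o1 o1).
      apply: (@divK L' ((zK - wK) * (1 - zK * wK)) (1 - zK * wK + wK ^+ 2) (-1) _ _ _ HL');
        last rewrite (comm_cb q0 HU).
      - by rewrite cKN cK1; ring.
      - by rewrite oppr_eq0 oner_eq0.
      apply: coefs_inB => //; first apply: coefs_inB => //; first apply: coefs_inD => //.
      - by apply: coefs_inZ => //; apply: in_zw => n m; exact: (@Waa a_ e_).
      - by apply: coefs_inZ => //; apply: in_wz => n m; exact: (@Waa e_ e_).
      - by apply: coefs_inZ => //; apply: in_wz => n m; exact: (@Waa a_ e_).
      by apply: coefs_inZ => //; apply: in_zw => n m; exact: (@Waa a_ a_).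
    have := H r i; rewrite psD psD psN psN inwM_inz inzM_inw /L' mulrBl => H1.
    rewrite -[_ * _](subrK (b_ r * c_ i * v)) -mulrA; apply: wtD.
      by move: H1; rewrite !mulrA.
    by apply: wt_below_b; exact: cv.
  rewrite mulrA (comm_eb0 q0 HU) -scalerAl -mulrA.
  have -> : (sig 0%N * q ^- (2 * k.+1)) *: (b_ r * v)
       = q ^- 2 *: (b_ r * ((sig 0%N * q ^- (2 * k)) *: v)).
    rewrite -[in RHS]scalerAr scalerA; congr (_ *: _).
    by rewrite mulnS exprD invfM mulrCA.
  by rewrite -scalerBr -mulrBr; apply: hwZ; apply: hwM => //; exact: Yq_s.
- have [ax ex cx Nx] := IHx; have [ay ey cy Ny] := IHy.
  split=> [r|r|r|]; rewrite mulrDr; [exact: wtD|exact: wtD|apply: (@wtD k); [exact: cx | exact: cy]|].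
  by rewrite scalerDr opprD addrACA; exact: hwD.
have [ax ex cx Nx] := IHx.
split=> [r|r|r|]; rewrite -scalerAr; [exact: wtZ|exact: wtZ|apply: (@wtZ k); exact: cx|].
by rewrite scalerA mulrC -scalerA -scalerBr; exact: hwZ.
Qed.

Section NonTrivial.
Hypothesis N1 : ~ N 1.
Local Notation e0 := (e_ 0%N).
Local Notation e0i := (s12inv q ti tbi).

Lemma sig0_neq0 : sig 0%N != 0.
Proof.
apply/eqP=> E; apply: N1; have [_ <-] := s12_unit; apply: hwM; first exact: Yq_inv.
by have := hw_e 0; rewrite E scale0r subr0.
Qed.

Lemma qpow_neq0 n : q ^- n != 0.
Proof. by rewrite invr_eq0 expf_neq0. Qed.

Lemma wt_inv k v : wt k v -> wt k (e0i * v).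
Proof.
move=> Wv; have [_ _ _ H] := wt_act Wv.
have nz : sig 0%N * q ^- (2 * k) != 0 by rewrite mulf_neq0 ?sig0_neq0 ?qpow_neq0.
move: (sig 0%N * _) nz H => la nz H.
have {}H := hwM Yq_inv H; rewrite mulrBr mulrA (proj2 s12_unit) mul1r -scalerAr in H.
have -> : e0i * v = la^-1 *: v + la^-1 *: ((-1) *: (v - la *: (e0i * v))).
  by rewrite -scalerDr scaleN1r opprB addrC subrK scalerA mulVf // scale1r.
by apply: wtD; [exact: wtZ | apply/wtZ/wtZ/wt_ideal].
Qed.

Inductive wtot : A -> Prop :=
  | wtot_wt k x : wt k x -> wtot x
  | wtot_add x y : wtot x -> wtot y -> wtot (x + y).

(** The elements that preserve sums of weight vectors form a subalgebra containing all generators of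
    Y', and 1 is a weight vector. *)
Lemma wtot_full y : Y y -> wtot y.
Proof.
move=> Yy; suff H : forall x, wtot x -> wtot (y * x).
  rewrite -(mulr1 y); apply: H; apply: (@wtot_wt 0); exists 1.
  by rewrite scale1r subrr; exact: hw0.
have Hgen z : (forall k x, wt k x -> wtot (z * x)) -> forall x, wtot x -> wtot (z * x).
  move=> Hz x; elim=> [k {}x|{}x x' _ H1 _ H2]; first exact: Hz.
  by rewrite mulrDr; exact: wtot_add.
apply: (Yy (fun z => forall x, wtot x -> wtot (z * x))).
- split=> [x|x x' Hx Hy z Wz|c x Hx|x x' Hx Hy z Wz].
  + by rewrite mul1r.
  + by rewrite mulrDl; apply: wtot_add; [apply: Hx | apply: Hy].
  + apply: Hgen => k v Wv; rewrite -scalerAl scalerAr; apply: Hx; apply: (@wtot_wt k).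
    exact: wtZ.
  by rewrite -mulrA; apply: Hx; apply: Hy.
- move=> i j r; apply: Hgen => k v Wv; have [Ha He Hc _] := wt_act Wv.
  case: (ord2P i) => ->; case: (ord2P j) => ->.
  + case: k Wv Hc {Ha He} => [|k] Wv Hc; last exact: (@wtot_wt k _ (Hc r)).
    by apply: (@wtot_wt 0); apply: wt_ideal; exact: (Hc r).
  + exact: (@wtot_wt k _ (He r)).
  + exact: (@wtot_wt k _ (Ha r)).
  by apply: (@wtot_wt k.+1); exact: wt_step_b.
by apply: Hgen => k v Wv; apply: (@wtot_wt k); exact: wt_inv.
Qed.

Local Notation pe := (horner_alg e0).

Lemma Yq_pe p : Y (pe p).
Proof.
elim/poly_ind: p => [|p c IH]; first by rewrite rmorph0; exact: Yq0.
rewrite rmorphD rmorphM /= horner_algX horner_algC; apply: YqD.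
  by apply: YqM => //; exact: Yq_s.
apply: YqZ; exact: Yq1.
Qed.

Lemma pe_comm p r : pe p * pe r = pe r * pe p.
Proof. by rewrite -!rmorphM mulrC. Qed.

Lemma pe_eigen x la p : N (e0 * x - la *: x) -> N (pe p * x - p.[la] *: x).
Proof.
move=> H; elim/poly_ind: p => [|p c IH].
  by rewrite rmorph0 horner0 mul0r scale0r subrr; exact: hw0.
rewrite rmorphD rmorphM /= horner_algX horner_algC !hornerE.
rewrite mulrDl scalerDl mulr_algl opprD addrACA subrr addr0 -mulrA.
have -> : pe p * (e0 * x) - (p.[la] * la) *: x
   = pe p * (e0 * x - la *: x) + la *: (pe p * x - p.[la] *: x).
  by rewrite mulrBr -scalerAr scalerBr scalerA (mulrC la) addrA subrK.
by apply: hwD; [apply: hwM => //; exact: Yq_pe | exact: hwZ].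
Qed.

Lemma pe_1 p : N (pe p - p.[sig 0%N] *: 1).
Proof.
by have := @pe_eigen 1 (sig 0%N) p; rewrite !mulr1; apply; exact: hw_e.
Qed.

(* p kills the parts of nonzero weight in y, so y lies in a proper submodule only if c = 0. *)
Lemma separate y : Y y ->
  exists (c : C) (p : {poly C}), p.[sig 0%N] != 0 /\ N (pe p * (y - c *: 1)).
Proof.
move/wtot_full; elim=> [k x Wx|x x' _ [c [p [p0 H]]] _ [c' [p' [p0' H']]]].
  case: k Wx => [[c Nx]|k Wx].
    by exists c, 1; rewrite hornerE oner_eq0 rmorph1 mul1r.
  exists 0, ('X - (sig 0%N * q ^- (2 * k.+1))%:P); split.
    rewrite !hornerE -{1}(mulr1 (sig 0%N)) -mulrBr mulf_neq0 ?sig0_neq0 //.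
    by rewrite subr_eq0 eq_sym invr_eq1 hq.
  rewrite rmorphB /= horner_algX horner_algC scale0r subr0 mulrBl mulr_algl.
  by have [_ _ _] := wt_act Wx.
exists (c + c'), (p * p'); split; first by rewrite hornerM mulf_neq0.
rewrite scalerDl opprD addrACA mulrDr rmorphM /= {1}pe_comm -!mulrA.
by apply: hwD; apply: hwM => //; exact: Yq_pe.
Qed.
End NonTrivial.
End HighestWeightIdeal.

Local Notation Z := (verma_ideal q t tb ti tbi mu mub).
Local Notation J := (max_sub q t tb ti tbi mu mub).

Lemma Yq_left_ideal : left_ideal Y Y.
Proof. by split=> // [|x y|y x]; [exact: Yq0 | exact: YqD | exact: YqM]. Qed.

Lemma verma_hw : hw_ideal Z.
Proof.
split; last 3 first.
- by move=> r N _ H _ _.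
- by move=> r N _ _ H _.
- by move=> r N _ _ _ H.
split=> [x Zx|N HN Ha Hb Hc|x y Zx Zy N HN Ha Hb Hc|y x Yy Zx N HN Ha Hb Hc].
- have Y1 c : Y (c *: 1) by apply: YqZ; exact: Yq1.
  have YB u c : Y u -> Y (u - c *: 1) by move=> Yu; rewrite -scaleNr; apply: YqD.
  apply: Zx; first exact: Yq_left_ideal.
  + by move=> r; exact: Yq_s.
  + by move=> r; apply: YB; exact: Yq_s.
  by move=> r; apply: YB; exact: Yq_sb.
- by have [] := HN.
- by have [_ _ HD _] := HN; apply: HD; [exact: Zx | exact: Zy].
by have [_ _ _ HM] := HN; apply: HM => //; exact: Zx.
Qed.

Lemma proper_sub_hw N : Defs.proper_sub q t tb ti tbi mu mub N -> hw_ideal N.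
Proof.
move=> [HN ZN _]; have [_ H1 H2 H3] := verma_hw.
by split=> // r; apply: ZN; [exact: H1 | exact: H2 | exact: H3].
Qed.

(** The degenerate case: no submodule is then proper, and the sum of the empty family is 0. *)
Lemma max_sub_trivial x : Z 1 -> J x -> x = 0.
Proof.
move=> Z1 Jx; apply: (Jx (fun x => x = 0)) => [//|y z -> ->|N [_ ZN N1]].
  exact: addr0.
by have := N1 (ZN _ Z1).
Qed.

Lemma max_sub_proper : ~ Z 1 -> Defs.proper_sub q t tb ti tbi mu mub J.
Proof.
move=> Z1; have HZ := verma_hw.
have ZJ x : Z x -> J x.
  move=> Zx S S0 SD SN; apply: (SN Z) => //; split=> //.
  by have [] := HZ.
(* Lying in some proper submodule is not visibly additive. Being killed, modulo the Verma ideal, by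
   a polynomial in [e_ 0] that does not vanish at [sig 0] is additive, since the two polynomials can
   be multiplied, and it fails for 1. *)
have JS x : J x -> Y x /\ exists p : {poly C},
    p.[sig 0%N] != 0 /\ Z (horner_alg (e_ 0%N) p * x).
  move=> Jx; apply: (Jx (fun x => Y x /\ exists p : {poly C},
    p.[sig 0%N] != 0 /\ Z (horner_alg (e_ 0%N) p * x))) => [|x1 x2 [Yx1 [p1 [p10 H1]]] [Yx2 [p2
      [p20 H2]]]|N HN y Ny].
  - split; first exact: Yq0.
    by exists 1; rewrite hornerE oner_eq0 mulr0; split=> //; exact: (hw0 HZ).
  - split; first exact: YqD.
    exists (p1 * p2); split; first by rewrite hornerM mulf_neq0.
    rewrite rmorphM mulrDr /= {1}pe_comm -!mulrA.
    by apply: (hwD HZ); apply: (hwM HZ) => //; exact: Yq_pe.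
  have HN' := proper_sub_hw HN; have Yy := hwY HN' Ny; split=> //.
  have [c [p [p0 H]]] := separate HZ Z1 Yy; exists p; split=> //.
  suff c0 : c = 0 by rewrite c0 scale0r subr0 in H.
  have [_ ZN N1] := HN; apply/eqP; apply: contra_notT N1 => cn.
  have H1 : N (c *: horner_alg (e_ 0%N) p).
    have -> : c *: horner_alg (e_ 0%N) p
       = horner_alg (e_ 0%N) p * y - horner_alg (e_ 0%N) p * (y - c *: 1).
      by rewrite mulrBr -scalerAr mulr1 subKr.
    apply: (hwB HN'); last exact: ZN.
    by apply: (hwM HN') => //; exact: Yq_pe.
  have H2 := hwB HN' H1 (hwZ HN' c (pe_1 HN' p)).
  rewrite -scalerBr opprB addrC subrK scalerA in H2.
  have := hwZ HN' (c * p.[sig 0%N])^-1 H2.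
  by rewrite scalerA mulVf ?scale1r // mulf_neq0.
split=> //.
  split=> [x /JS[] //|S S0 _ _ //|x y Jx Jy S S0 SD SN|y x Yy Jx S S0 SD SN].
  - by apply: (SD); [exact: Jx | exact: Jy].
  apply: (Jx (fun x => S (y * x))); first by rewrite mulr0.
    by move=> u v; rewrite mulrDr; exact: SD.
  move=> N HN z Nz; apply: (SN N) => //.
  by have HN' := proper_sub_hw HN; apply: (hwM HN').
move=> /JS[_ [p [p0 H]]]; apply: Z1.
have H2 := hwB HZ H (pe_1 HZ p); rewrite mulr1 opprB addrC subrK in H2.
by have := hwZ HZ p.[sig 0%N]^-1 H2; rewrite scalerA mulVf // scale1r.
Qed.

Lemma sub_max_sub N : Defs.proper_sub q t tb ti tbi mu mub N -> forall x, N x -> J x.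
Proof. by move=> HN x Nx S S0 SD SN; exact: (SN N). Qed.

End Weights.

(** * Rationality of the highest weight *)

(** A matrix with n + 1 rows and n columns has a nonzero row vector in its left kernel. [m] is the
    largest index of a nonzero coefficient; the applications rely on [ga m] being the last term of
    the sum. *)
Lemma lin_dep (V : lmodType C) (L : V -> Prop) n (v : 'I_n -> V) (y : nat -> V) :
  linear_pred L ->
  (forall i, exists c : 'I_n -> C, L (y i - \sum_(k < n) c k *: v k)) ->
  exists (ga : nat -> C) (m : nat), ga m != 0 /\ L (\sum_(i < m.+1) ga i *: y i).
Proof.
move=> HL /choice [c Hc].
pose M : 'M[C]_(n.+1, n) := \matrix_(i, k) c i k.
have : kermx M != 0.
  by rewrite -mxrank_eq0 mxrank_ker -lt0n subn_gt0 ltnS rank_leq_col.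
case/rowV0Pn=> g gM g0.
have /sub_kermxP gM0 := gM.
pose ga i : C := if insub i is Some j then g 0 j else 0.
have gaE (i : 'I_n.+1) : ga i = g 0 i by rewrite /ga valK.
have [j gj] : exists j : 'I_n.+1, ga j != 0.
  apply/existsP; apply: contraNT g0 => /existsPn H; apply/eqP/rowP=> j.
  by rewrite mxE -gaE; have := H j; rewrite negbK => /eqP.
pose m := \max_(i < n.+1 | ga i != 0) i.
have Hm : exists2 i : 'I_n.+1, ga i != 0 & m = i :> nat.
  have [i Pi E] := @eq_bigmax_cond _ [pred i : 'I_n.+1 | ga i != 0] (fun i => i : nat) (ltac:
    (apply/card_gt0P; by exists j)).
  by exists i.
have [i gi Ei] := Hm; exists ga, m; split; first by rewrite Ei.
have -> : \sum_(k < m.+1) ga k *: y k = \sum_(k < n.+1) ga k *: y k.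
  have le : (m.+1 <= n.+1)%N by rewrite Ei.
  rewrite (big_ord_widen n.+1 (fun k => ga k *: y k) le).
  rewrite [RHS](bigID (fun k : 'I_n.+1 => (k < m.+1)%N)) /= [X in _ + X]big1 ?addr0 // => k.
  rewrite -leqNgt => lt; case: (eqVneq (ga k) 0) => [->|gk]; first exact: scale0r.
  have := @leq_bigmax_cond _ [pred i : 'I_n.+1 | ga i != 0] (fun i => i : nat) k gk.
  by rewrite leqNgt lt.
have -> : \sum_(k < n.+1) ga k *: y k
   = \sum_(k < n.+1) ga k *: (y k - \sum_(l < n) c k l *: v l).
  under [RHS]eq_bigr do rewrite scalerBr.
  rewrite sumrB [X in _ - X](_ : _ = 0) ?subr0 //.
  under eq_bigr do rewrite scaler_sumr; rewrite exchange_big big1 // => l _.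
  under eq_bigr do rewrite scalerA.
  rewrite -scaler_suml; move/rowP/(_ l): gM0; rewrite !mxE => gl.
  rewrite (eq_bigr (fun k => g 0 k * M k l)) ?gl ?scale0r // => k _.
  by rewrite gaE mxE.
by apply: linear_pred_sum => // k; have [_ _ LZ] := HL; exact: LZ.
Qed.

Section FiniteDimensional.
Variables (q : C) (q0 : q != 0).
Hypothesis hq : forall n : nat, (0 < n)%N -> q ^+ n != 1.
Variables (A : algType C) (t tb : 'I_2 -> 'I_2 -> nat -> A) (ti tbi : 'I_2 -> A).
Hypothesis HU : Uext_rels q t tb ti tbi.
Variables mu mub : nat -> C.

Local Notation s_ := (s_coef q t tb).
Local Notation Y := (Yq q t tb ti tbi).
Local Notation a_ := (s_ o2 o1).
Local Notation b_ := (s_ o2 o2).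
Local Notation c_ := (s_ o1 o1).
Local Notation e_ := (s_ o1 o2).
Local Notation h := (q^-1 - q).
Local Notation sig := (sig q mu mub).
Local Notation pe := (horner_alg (e_ 0%N)).

Section Quotient.
Variables (N : A -> Prop) (HN : hw_ideal q t tb ti tbi mu mub N) (N1 : ~ N 1).

Local Notation NB := (hwB HN).
Local Notation ND := (hwD HN).
Local Notation NZ := (hwZ HN).
Local Notation NM := (hwM HN).

Definition findim_quotient : Prop := exists (n : nat) (v : 'I_n -> A),
  forall y, Y y -> exists c : 'I_n -> C, N (y - \sum_(k < n) c k *: v k).

Lemma findim_dep (y : nat -> A) : findim_quotient -> (forall i, Y (y i)) ->
  exists (ga : nat -> C) (m : nat), ga m != 0 /\ N (\sum_(i < m.+1) ga i *: y i).
Proof.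
move=> [n [v Hv]] Yy; apply: (@lin_dep A N n v y) => [|i]; last exact: Hv.
exact: hw_lin HN.
Qed.

(** The polynomial in [e_ 0] with roots la 0, ..., la (m - 1) kills every term of a linear
    dependence except the last one. *)
Lemma eigen_not_findim (y : nat -> A) (la : nat -> C) :
  injective la -> (forall i, Y (y i)) -> (forall i, N (e_ 0%N * y i - la i *: y i)) ->
  (forall i, ~ N (y i)) -> ~ findim_quotient.
Proof.
move=> la_inj Yy ey Ny /findim_dep /(_ Yy) [ga [m [gm H]]]; apply: (Ny m).
pose p := \prod_(i < m) ('X - (la i)%:P).
have pE x : p.[x] = \prod_(i < m) (x - la i).
  by rewrite horner_prod; apply: eq_bigr => i _; rewrite !hornerE.
have Np i : N (ga i *: (p.[la i] *: y i) - pe p * (ga i *: y i)).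
  rewrite -scalerAr -scalerBr; apply: NZ; rewrite -opprB -scaleN1r; apply: NZ.
  by apply: (pe_eigen HN); exact: ey.
have H1 : N (pe p * \sum_(i < m.+1) ga i *: y i).
  by apply: NM => //; exact: Yq_pe.
have H2 : N (\sum_(i < m.+1) ga i *: (p.[la i] *: y i)).
  rewrite -[X in N X](subrK (pe p * \sum_(i < m.+1) ga i *: y i)); apply: ND => //.
  rewrite mulr_sumr -sumrB; apply: linear_pred_sum => [|i]; last exact: Np.
  exact: hw_lin HN.
rewrite big_ord_recr big1 /= ?add0r in H2; last first.
  move=> i _; rewrite pE (bigD1 i) //= subrr mul0r scale0r scaler0 //.
have nz : ga m * p.[la m] != 0.
  rewrite mulf_neq0 // pE; apply/prodf_neq0 => i _; rewrite subr_eq0.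
  have := ltn_ord i; rewrite ltn_neqAle => /andP[/eqP ne _].
  by apply/eqP=> /la_inj E; apply: ne.
by have := NZ (ga m * p.[la m])^-1 H2; rewrite !scalerA -mulrA mulVf // scale1r.
Qed.

Lemma wt_b0 k : wt q t tb N k (b_ 0%N ^+ k).
Proof.
elim: k => [|k IH]; first by exists 1; rewrite scale1r subrr; exact: hw0 HN.
by rewrite exprS; exact: wt_step_b.
Qed.

Lemma b0_not_findim : (forall k, ~ N (b_ 0%N ^+ k)) -> ~ findim_quotient.
Proof.
move=> H; apply: (@eigen_not_findim (fun k => b_ 0%N ^+ k) (fun k => sig 0%N * q ^- (2 * k))) => //.
- have s0 := sig0_neq0 q0 HU HN N1.
  have main i j : (i < j)%N -> sig 0%N * q ^- (2 * i) <> sig 0%N * q ^- (2 * j).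
    move=> lt /(mulfI s0) /invr_inj /eqP.
    rewrite -(subnK (ltnW lt)) mulnDr exprD -{1}(mul1r (q ^+ (2 * i))).
    rewrite (inj_eq (mulIf (expf_neq0 _ q0))) eq_sym; apply/negP/hq.
    by rewrite muln_gt0 subn_gt0.
  move=> i j E; case: (ltngtP i j) => // lt; first by case: (main _ _ lt).
  by case: (main _ _ lt).
- by move=> k; exact: (wtY HN (wt_b0 k)).
by move=> k; have [_ _ _] := wt_act q0 HU HN (wt_b0 k).
Qed.

Lemma e0_b0 k : N (e_ 0%N * b_ 0%N ^+ k - (sig 0%N * q ^- (2 * k)) *: b_ 0%N ^+ k).
Proof. by have [_ _ _] := wt_act q0 HU HN (wt_b0 k). Qed.

Let Ncong x y z : N (x - y) -> N (y - z) -> N (x - z).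
Proof. by move=> H1 H2; rewrite -(subrKA y); exact: ND. Qed.

(** Passing one [b_ 0] adds (q^(-1) - q) times the eigenvalue of [e_ 0] to that of [a_ 0];
    equivalently, a_0 - q e_0 keeps the eigenvalue mu_0 - q sig_0. *)
Lemma a0_b0 k : N (a_ 0%N * b_ 0%N ^+ k
   - (q * (sig 0%N * q ^- (2 * k)) + (mu 0%N - q * sig 0%N)) *: b_ 0%N ^+ k).
Proof.
elim: k => [|k IH].
  rewrite muln0 !expr0 invr1 !mulr1 (addrC (q * _)) subrK; exact: (hw_a HN).
rewrite exprS mulrA (comm_ab0 q0 HU) mulrDl -!mulrA -scalerAl -mulrA.
set B := b_ 0%N; set al := (X in N (_ - X *: _)) in IH; set ep := (sig 0%N * q ^- (2 * k)) in IH *.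
have -> : q * (sig 0%N * q ^- (2 * k.+1)) + (mu 0%N - q * sig 0%N) = al + h * ep.
  by rewrite /al /ep mulnS exprD invfM; field; rewrite q0 expf_neq0.
rewrite scalerDl opprD addrACA; apply: ND.
  by rewrite scalerAr -mulrBr; apply: NM; [exact: Yq_s | exact: IH].
rewrite -scalerA -scalerBr scalerAr -mulrBr; apply: NZ; apply: NM; [exact: Yq_s | exact: e0_b0].
Qed.

Lemma c0_b0 k : mu 0%N = 0 -> N (c_ 0%N * b_ 0%N ^+ k.+1
  - (- q ^+ 3 * sig 0%N ^+ 2 * ((1 - q ^- (2 * k.+1)) * q ^- (2 * k.+1))) *: b_ 0%N ^+ k).
Proof.
move=> mu0.
have cb v : c_ 0%N * (b_ 0%N * v) = b_ 0%N * (c_ 0%N * v)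
    + h *: (q *: (a_ 0%N * (e_ 0%N * v)) + e_ 0%N * (e_ 0%N * v)).
  have /eqP := comm_cb0 q0 HU 0; rewrite subr_eq => /eqP E.
  by rewrite mulrA E mulrDl -scalerAl mulrDl -scalerAl -!mulrA addrC.
have ae j : N (h *: (q *: (a_ 0%N * (e_ 0%N * b_ 0%N ^+ j)) + e_ 0%N * (e_ 0%N * b_ 0%N ^+ j))
   - (h * ((sig 0%N * q ^- (2 * j)) * ((q ^+ 2 + 1) * (sig 0%N * q ^- (2 * j)) - q ^+ 2 * sig
     0%N))) *: b_ 0%N ^+ j).
  have Ha := a0_b0 j; have He := e0_b0 j; rewrite mu0 in Ha.
  set ep := (sig 0%N * q ^- (2 * j)) in Ha He *; set B := b_ 0%N ^+ j in Ha He *.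
  rewrite -scalerA -scalerBr; apply: NZ.
  have -> : (ep * ((q ^+ 2 + 1) * ep - q ^+ 2 * sig 0%N)) *: B
     = q *: (ep *: ((q * ep + (0 - q * sig 0%N)) *: B)) + ep *: (ep *: B).
    by rewrite !scalerA -scalerDl; congr (_ *: _); ring.
  rewrite opprD addrACA -scalerBr; apply: ND.
    apply: NZ; apply: (@Ncong _ (ep *: (a_ 0%N * B))).
      by rewrite scalerAr -mulrBr; apply: NM => //; exact: Yq_s.
    by rewrite -scalerBr; exact: NZ.
  apply: (@Ncong _ (ep *: (e_ 0%N * B))).
    by rewrite scalerAr -mulrBr; apply: NM => //; exact: Yq_s.
  by rewrite -scalerBr; exact: NZ.
elim: k => [|k IH].
  rewrite exprS cb -addrA; apply: ND.
    by apply: NM; [exact: Yq_s | rewrite expr0 mulr1; exact: (hw_c HN)].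
  have := ae 0%N; set X := h *: _; set k1 := h * _; set k2 := _ * _.
  suff -> : k1 = k2 by [].
  by rewrite /k1 /k2 muln0 expr0 muln1; field.
rewrite exprS cb; have := ae k.+1.
set X := h *: _; set k1 := h * _ => H.
have -> : - q ^+ 3 * sig 0%N ^+ 2 * ((1 - q ^- (2 * k.+2)) * q ^- (2 * k.+2))
   = - q ^+ 3 * sig 0%N ^+ 2 * ((1 - q ^- (2 * k.+1)) * q ^- (2 * k.+1)) + k1.
  by rewrite /k1 (mulnS 2 k.+1) exprD; field; rewrite q0 expf_neq0.
rewrite scalerDl opprD addrACA; apply: ND => //.
by rewrite {2}exprS scalerAr -mulrBr; apply: NM; [exact: Yq_s | exact: IH].
Qed.

(** If mu_0 = 0, then by [c0_b0] the element c_0 sends b_0^(k+1) xi to a multiple of b_0^k xi that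
    is nonzero because q is not a root of unity. Hence no power of b_0 annihilates xi, and these
    vectors have pairwise different weights. *)
Lemma mu0_neq0 : findim_quotient -> mu 0%N != 0.
Proof.
move=> fd; apply/eqP=> mu0; apply: (b0_not_findim _ fd); elim=> [|k IH]; first by rewrite expr0.
move=> H; apply: IH; have H1 : N (c_ 0%N * b_ 0%N ^+ k.+1) by apply: NM => //; exact: Yq_s.
have {}H1 := NB H1 (c0_b0 k mu0); rewrite opprB addrC subrK in H1.
set ka := _ * _ in H1; have nz : ka != 0.
  apply: mulf_neq0; first apply: mulf_neq0.
  - by rewrite oppr_eq0 expf_neq0.
  - by rewrite expf_neq0 // (sig0_neq0 q0 HU HN N1).
  apply: mulf_neq0; last by rewrite invr_eq0 expf_neq0.
  by rewrite subr_eq0 eq_sym invr_eq1 hq.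
by have := NZ ka^-1 H1; rewrite scalerA mulVf // scale1r.
Qed.


Lemma algKE (g : K2) n m : (g%:A : ps2 A) n m = g n m *: 1.
Proof.
rewrite psZ big_ord_recr big1 /= ?add0r ?subnn => [|i _].
  rewrite psZ big_ord_recr big1 /= ?add0r ?subnn // => i _.
  by case E: (m - i)%N => [|j] /=; [move/eqP: E; rewrite subn_eq0 leqNgt ltn_ord | rewrite scaler0].
by case E: (n - i)%N => [|j] /=; [move/eqP: E; rewrite subn_eq0 leqNgt ltn_ord | rewrite scaler0].
Qed.

Definition congN (f : ps2 A) (g : K2) : Prop := coefs_in N (f - g%:A).

Lemma congN_Z k f g : congN f g -> congN (k *: f) (k * g).
Proof.
move=> H; rewrite /congN -scalerA -scalerBr; apply: coefs_inZ => //; exact: hw_lin HN.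
Qed.
Lemma congN_D f g f' g' : congN f g -> congN f' g' -> congN (f + f') (g + g').
Proof.
move=> H H'; rewrite /congN scalerDl opprD addrACA; apply: coefs_inD => //; exact: hw_lin HN.
Qed.
Lemma congN_B f g f' g' : congN f g -> congN f' g' -> congN (f - f') (g - g').
Proof.
move=> H H'; apply: congN_D => //.
by have := congN_Z (-1) H'; rewrite scaleN1r mulN1r.
Qed.
Lemma congN_uniq f g g' : congN f g -> congN f g' -> g = g'.
Proof.
move=> H H'; apply/psP=> n; apply/psP=> m; apply/eqP; apply: contra_notT N1 => ne.
have := NB (H' n m) (H n m); rewrite !psD !psN !algKE opprB addrC subrKA -scalerBl => H1.
by have := NZ (g n m - g' n m)^-1 H1; rewrite scalerA mulVf ?scale1r // subr_eq0.
Qed.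

Definition wi (f : ps C) : K2 := ps_const f.
Definition zi (f : ps C) : K2 := fun n => ps_const (f n).
Lemma wziE f g n m : (wi f * zi g) n m = f m * g n.
Proof. by rewrite psC_mul ps_mulC. Qed.

Let cong1 (x : ps A) (f : ps C) := forall n, N (x n - f n *: 1).
Let Ya (x : ps A) := forall n, Y (x n).

Lemma congN_wz x y f g : cong1 x f -> cong1 y g -> Ya x ->
  congN (inw x * inz y) (wi f * zi g).
Proof.
move=> Hx Hy Yx n m; rewrite psD psD psN psN algKE inwM_inz wziE.
rewrite -(subrKA (g n *: x m)); apply: ND.
  have -> : x m * y n - g n *: x m = x m * (y n - g n *: 1) by rewrite mulrBr -scalerAr mulr1.
  exact: NM.
by rewrite mulrC -scalerA -scalerBr; apply: NZ.
Qed.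
Lemma congN_zw x y f g : cong1 x f -> cong1 y g -> Ya y ->
  congN (inz y * inw x) (wi f * zi g).
Proof.
move=> Hx Hy Yy n m; rewrite psD psD psN psN algKE inzM_inw wziE.
rewrite -(subrKA (f m *: y n)); apply: ND.
  have -> : y n * x m - f m *: y n = y n * (x m - f m *: 1) by rewrite mulrBr -scalerAr mulr1.
  exact: NM.
by rewrite -scalerA -scalerBr; apply: NZ.
Qed.

Local Notation Qk := (cK q).
Local Notation Qi := (cK q^-1).
Local Notation hK := (Qi - Qk).

Lemma cb_scalar : exists H : K2,
  (forall n m, N (c_ m * b_ n - H n m *: 1)) /\
  (zK - wK) * (1 - zK * wK) * H =
    (zK * hK * (Qk - Qi * (zK * wK))) * (wi sig * zi mu)
    + (hK * (zK - wK)) * (wi sig * zi sig)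
    - (wK * hK * (Qk - Qi * (zK * wK))) * (wi mu * zi sig)
    - (hK * (zK * wK * (zK - wK))) * (wi mu * zi mu).
Proof.
have /choice [H HH] : forall n, exists f : ps C, forall m, N (c_ m * b_ n - f m *: 1).
  move=> n; suff /choice [f Hf] : forall m, exists c : C, N (c_ m * b_ n - c *: 1) by exists f.
  move=> m; have W1 : wt q t tb N 1 (b_ n * 1).
    by apply: wt_step_b; exists 1; rewrite scale1r subrr; exact: hw0 HN.
  by have [_ _ /(_ m)] := wt_act q0 HU HN W1; rewrite mulr1.
exists H; split=> //.
have Hcb : congN (mapw s_ o1 o1 * mapz s_ o2 o2 - mapz s_ o2 o2 * mapw s_ o1 o1) H.
  move=> n m; rewrite psD psD psN psN algKE psD psD psN psN inwM_inz inzM_inw addrAC.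
  by apply: NB => //; apply: NM; [exact: Yq_s | exact: (hw_c HN)].
apply: (congN_uniq (congN_Z _ Hcb)); rewrite (comm_cb q0 HU).
have Ys i j : Ya (s_ i j) by move=> n; exact: Yq_s.
have Ca : cong1 a_ mu by exact: (hw_a HN).
have Ce : cong1 e_ sig by exact: (hw_e q0 HU HN).
apply: congN_B; first apply: congN_B; first apply: congN_D; apply: congN_Z.
- exact: congN_zw.
- exact: congN_wz.
- exact: congN_wz.
exact: congN_zw.
Qed.

Definition evenq : ps C := fun n => (~~ odd n)%:R * q ^- n.
Lemma evenqE : (1 - ps_const (q ^- 2) * psX ^+ 2) * evenq = 1.
Proof.
apply/psP=> n; rewrite mulrBl mul1r expr2 -!mulrA psD psN psC_mul psXM.
case: n => [|[|n]]; rewrite ?psXM /evenq /= ?mul0r ?mulr0 ?subr0 ?mul1r ?expr0 ?invr1 //.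
by rewrite negbK -[n.+2]add2n exprD invfM mulrCA subrr.
Qed.
(** The factor (w^2 - 1)/(1 - q^(-2) w^2), chosen to clear denominators. Multiplying the eigenvalue
    H of [cb_scalar] by it in both variables turns (z - w)(1 - zw) H into a constant times [Yser],
    which is polynomial in z and w and quadratic in [mu] and [mub]. *)
Definition uinv : ps C := (psX ^+ 2 - 1) * evenq.
Definition Yser : K2 :=
  (1 - zK * wK) * (zK * zi mu * wi mub - wK * wi mu * zi mub)
  + (zK - wK) * (zK * wK * (wi mu * zi mu) - wi mub * zi mub).

Lemma ziM f g : zi (f * g) = zi f * zi g.
Proof. by apply/psP=> n; rewrite psM /zi rmorph_sum; apply: eq_bigr => i _; rewrite rmorphM. Qed.
Lemma ziB f g : zi (f - g) = zi f - zi g.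
Proof. by apply/psP=> n; rewrite psD psN /zi psD psN rmorphB. Qed.
Lemma ziD f g : zi (f + g) = zi f + zi g.
Proof. by apply/psP=> n; rewrite psD /zi psD rmorphD. Qed.
Lemma ziX : zi psX = zK. Proof. by apply/psP=> n; rewrite /zi /zK /psX; case: (n == 1%N);
  rewrite ?rmorph1 ?rmorph0. Qed.
Lemma ziC c : zi (ps_const c) = cK c.
Proof. by apply/psP=> -[|n] //; rewrite /zi rmorph0. Qed.
Lemma zi1 : zi 1 = 1. Proof. exact: (ziC 1). Qed.
Lemma wiM f g : wi (f * g) = wi f * wi g. Proof. exact: rmorphM. Qed.
Lemma wiB f g : wi (f - g) = wi f - wi g. Proof. exact: rmorphB. Qed.
Lemma wiD f g : wi (f + g) = wi f + wi g. Proof. exact: rmorphD. Qed.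
Lemma wi1 : wi 1 = 1. Proof. exact: rmorph1. Qed.
Lemma wiX : wi psX = wK. Proof. by []. Qed.
Lemma wiC c : wi (ps_const c) = cK c. Proof. by []. Qed.

Lemma abs_Yser (K : comNzRingType) (Q I z w mz mw bz bw sz sw vz vw H : K) :
  Q * I = 1 ->
  (1 - I ^+ 2 * (z * z)) * vz = 1 -> (1 - I ^+ 2 * (w * w)) * vw = 1 ->
  (z * z - 1) * sz = Q * (1 - I ^+ 2 * (z * z)) * bz + (I - Q) * (z * z) * mz ->
  (w * w - 1) * sw = Q * (1 - I ^+ 2 * (w * w)) * bw + (I - Q) * (w * w) * mw ->
  (z - w) * (1 - z * w) * H
  = (z * (I - Q) * (Q - I * (z * w))) * (sw * mz) + ((I - Q) * (z - w)) * (sw * sz)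
    - (w * (I - Q) * (Q - I * (z * w))) * (mw * sz) - ((I - Q) * (z * w * (z - w))) * (mw * mz) ->
  (z - w) * (1 - z * w) * (((w * w - 1) * vw) * (((z * z - 1) * vz) * H))
  = ((Q - I) * Q ^+ 2) * ((1 - z * w) * (z * mz * bw - w * mw * bz)
                          + (z - w) * (z * w * (mw * mz) - bw * bz)).
Proof.
move=> QI Vz Vw Sz Sw HH.
transitivity (vw * vz * ((w * w - 1) * (z * z - 1) * ((z - w) * (1 - z * w) * H))); first by ring.
rewrite HH.
transitivity (vw * vz * (
  (z * (I - Q) * (Q - I * (z * w))) * (((w * w - 1) * sw) * mz * (z * z - 1))
  + ((I - Q) * (z - w)) * (((w * w - 1) * sw) * ((z * z - 1) * sz))
  - (w * (I - Q) * (Q - I * (z * w))) * (mw * (w * w - 1) * ((z * z - 1) * sz))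
  - ((I - Q) * (z * w * (z - w))) * (mw * mz) * (w * w - 1) * (z * z - 1))); first by ring.
rewrite Sz Sw.
transitivity ((((1 - I ^+ 2 * (w * w)) * vw) * ((1 - I ^+ 2 * (z * z)) * vz)) *
  (((Q - I) * Q ^+ 2) * ((1 - z * w) * (z * mz * bw - w * mw * bz)
                          + (z - w) * (z * w * (mw * mz) - bw * bz)))); first by ring: QI.
by rewrite Vz Vw !mul1r.
Qed.

Lemma cKV2 : cK (q ^- 2) = Qi ^+ 2.
Proof. by rewrite -exprVn rmorphXn. Qed.

(* G xi = uinv(w) uinv(z) s11(w) s22(z) xi, and ga is a linear dependence between the vectors
   obtained by applying the coefficients of uinv(z) s22(z) to xi. *)
Lemma findim_series : findim_quotient ->
  exists (ga : nat -> C) (m : nat) (G : K2),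
  [/\ ga m != 0,
     (zK - wK) * (1 - zK * wK) * G = cK ((q - q^-1) * q ^+ 2) * Yser &
     \sum_(i < m.+1) ps_const (ga i) * G i = 0].
Proof.
move=> fd; have [H [HN1 HE]] := cb_scalar.
have Yb i : Y ((uinv *: (b_ : ps A)) i).
  by apply: linear_predZ_ps => [|n]; [exact: Yq_lin | exact: Yq_s].
have [ga [m [gm Nm]]] := findim_dep fd Yb.
exists ga, m, (wi uinv * (zi uinv * H)); split=> //.
  have ev : (1 - Qi ^+ 2 * (zK * zK)) * zi evenq = 1 /\ (1 - Qi ^+ 2 * (wK * wK)) * wi evenq = 1.
    have := (f_equal zi evenqE, f_equal wi evenqE).
    rewrite /= ziM ziB zi1 ziM ziC expr2 ziM ziX wiM wiB wi1 wiM wiC wiM wiX cKV2.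
    by case.
  have sg : (zK * zK - 1) * zi sig = Qk * (1 - Qi ^+ 2 * (zK * zK)) * zi mub + (Qi - Qk) * (zK *
    zK) * zi mu
     /\ (wK * wK - 1) * wi sig = Qk * (1 - Qi ^+ 2 * (wK * wK)) * wi mub + (Qi - Qk) * (wK * wK) *
       wi mu.
    have := (f_equal zi (sigE q mu mub), f_equal wi (sigE q mu mub)).
    rewrite /= expr2 ziM ziB zi1 ziM ziX ziD !ziM ziB zi1 !ziM !ziC ziX.
    by rewrite wiM wiB wi1 wiM wiX wiD !wiM wiB wi1 !wiM !wiC wiX cKV2 cKB; case.
  have := abs_Yser (QkV q0) ev.1 ev.2 sg.1 sg.2 HE.
  rewrite /uinv expr2 wiM wiB wiM wi1 wiX ziM ziB ziM zi1 ziX => ->.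
  have cKM a b : cK (a * b) = cK a * cK b by exact: rmorphM.
  by rewrite !expr2 !cKM cKB.
have Hm j : \sum_(i < m.+1) ga i * (zi uinv * H) i j = 0.
  apply/eqP; apply: contra_notT N1 => nz.
  set S := \sum_(i < _) _ in nz.
  suff NS : N (S *: 1) by have := NZ S^-1 NS; rewrite scalerA mulVf // scale1r.
  have H1 : N (c_ j * \sum_(i < m.+1) ga i *: (uinv *: (b_ : ps A)) i).
    by apply: NM => //; exact: Yq_s.
  rewrite -[X in N X](subKr (c_ j * \sum_(i < m.+1) ga i *: (uinv *: (b_ : ps A)) i)).
  apply: NB => //; rewrite mulr_sumr /S scaler_suml -sumrB.
  apply: linear_pred_sum => [|i]; first exact: hw_lin HN.
  rewrite -scalerAr -scalerA -scalerBr; apply: NZ.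
  rewrite psZ psM mulr_sumr ps_sum scaler_suml -sumrB.
  apply: linear_pred_sum => [|l]; first exact: hw_lin HN.
  by rewrite psC_mul -scalerAr -scalerA -scalerBr; apply: NZ.
apply/psP=> j; rewrite ps0 ps_sum.
have E i : (ps_const (ga i) * (wi uinv * (zi uinv * H)) i : ps C)
   = uinv * (ps_const (ga i) * (zi uinv * H) i).
  by rewrite psC_mul mulrCA.
transitivity ((uinv * \sum_(i < m.+1) ps_const (ga i) * (zi uinv * H) i : ps C) j).
  by rewrite mulr_sumr ps_sum; apply: eq_bigr => i _; rewrite E.
rewrite [X in uinv * X](_ : _ = 0) ?mulr0 ?ps0 //.
by apply/psP=> i; rewrite ps_sum ps0 -[RHS](Hm i); apply: eq_bigr => l _; rewrite psC_mul.
Qed.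

End Quotient.
End FiniteDimensional.

(** * Polynomials inside power series, and mutually reversed polynomials *)

Definition pser (p : {poly C}) : ps C := fun n => p`_n.
Fact pser_zmod : zmod_morphism pser.
Proof. by move=> p r; apply/psP=> n; rewrite /pser coefB. Qed.
HB.instance Definition _ := GRing.isZmodMorphism.Build {poly C} (ps C) pser pser_zmod.
Fact pser_monoid : monoid_morphism pser.
Proof.
split=> [|p r]; apply/psP=> n; first by rewrite /pser coef1; case: n.
by rewrite /pser coefM psM.
Qed.
HB.instance Definition _ := GRing.isMonoidMorphism.Build {poly C} (ps C) pser pser_monoid.
Lemma pserX : pser 'X = psX. Proof. by apply/psP=> n; rewrite /pser coefX. Qed.
Lemma pserC c : pser c%:P = ps_const c.
Proof. by apply/psP=> -[|n]; rewrite /pser coefC. Qed.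
Lemma pser_inj : injective pser.
Proof. by move=> p r E; apply/polyP=> i; exact: (f_equal (fun f : ps C => f i) E). Qed.

(* isrev n p r means r(X) = X^n p(1/X) with deg p <= n. *)
Inductive isrev (n : nat) : {poly C} -> {poly C} -> Prop :=
  | isrev_mon j : (j <= n)%N -> isrev n 'X^j 'X^(n - j)
  | isrev_add p p' r r' : isrev n p p' -> isrev n r r' -> isrev n (p + r) (p' + r')
  | isrev_scale c p p' : isrev n p p' -> isrev n (c%:P * p) (c%:P * p').

Lemma isrev_linear n m (F G : {poly C} -> {poly C}) :
  {morph F : x y / x + y} -> {morph G : x y / x + y} ->
  (forall c x, F (c%:P * x) = c%:P * F x) -> (forall c x, G (c%:P * x) = c%:P * G x) ->
  (forall j, (j <= n)%N -> isrev m (F 'X^j) (G 'X^(n - j))) ->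
  forall p r, isrev n p r -> isrev m (F p) (G r).
Proof.
move=> FD GD FZ GZ H p r; elim=> [j|p1 p1' p2 p2' _ H1 _ H2|c p1 p1' _ H1].
- exact: H.
- by rewrite FD GD; exact: isrev_add.
by rewrite FZ GZ; exact: isrev_scale.
Qed.

Lemma isrev_sub n p p' r r' : isrev n p p' -> isrev n r r' -> isrev n (p - r) (p' - r').
Proof.
move=> H1 H2; apply: isrev_add => //.
by have := isrev_scale (-1) H2; rewrite rmorphN rmorph1 !mulN1r.
Qed.

Lemma isrev0 n : isrev n 0 0.
Proof. by have := isrev_scale 0 (isrev_mon (leq0n n)); rewrite rmorph0 !mul0r. Qed.

Lemma isrev_sum n m (F G : nat -> {poly C}) :
  (forall i, (i < m)%N -> isrev n (F i) (G i)) ->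
  isrev n (\sum_(i < m) F i) (\sum_(i < m) G i).
Proof.
elim: m => [|m IH] H; first by rewrite !big_ord0; exact: isrev0.
rewrite !big_ord_recr; apply: isrev_add; last exact: H.
by apply: IH => i lt; apply: H; exact: ltnW.
Qed.

Lemma isrev_shift n j p r : isrev n p r -> isrev (n + j.*2) ('X^j * p) ('X^j * r).
Proof.
apply: isrev_linear => [x y|x y|c x|c x|i le]; rewrite ?mulrDr // 1?mulrCA //.
rewrite -!exprD (_ : j + (n - i) = n + j.*2 - (j + i))%N; last first.
  by rewrite -addnn addnA subnDA addnK -addnBAC // addnC.
by apply: isrev_mon; rewrite addnC -addnn addnA leq_add2r (leq_trans le) // leq_addr.
Qed.

Lemma isrev_widen n p r : isrev n p r -> isrev n.+2 ((1 + 'X^2) * p) ((1 + 'X^2) * r).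
Proof.
apply: isrev_linear => [x y|x y|c x|c x|i le]; rewrite ?mulrDr // 1?mulrCA //.
rewrite !mulrDl !mul1r -!exprD [X in isrev _ _ X]addrC; apply: isrev_add.
  by rewrite addnBA // add2n; apply: isrev_mon; rewrite (leq_trans le) // leqW // leqW.
by rewrite -[n.+2]add2n -(subnDl 2 n i); apply: isrev_mon; rewrite leq_add2l.
Qed.

Lemma isrev_factor n (x : C) p r : isrev n p r ->
  isrev n.+1 ((1 - x *: 'X) * p) (('X - x%:P) * r).
Proof.
apply: isrev_linear => [y z|y z|c y|c y|i le]; rewrite ?mulrDr // 1?mulrCA //.
rewrite !mulrBl mul1r -mul_polyC -mulrA -!exprS; apply: isrev_sub.
  by rewrite -subSn //; apply: isrev_mon; exact: leqW.
by apply: isrev_scale; rewrite -subSS; exact: isrev_mon.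
Qed.

Lemma isrev_prod (rs : seq C) :
  isrev (size rs) (\prod_(x <- rs) (1 - x *: 'X)) (\prod_(x <- rs) ('X - x%:P)).
Proof.
elim: rs => [|x rs IH]; first by rewrite !big_nil -(expr0 'X); exact: (@isrev_mon 0 0).
by rewrite !big_cons; exact: isrev_factor.
Qed.

Lemma isrev_coef n p r : isrev n p r ->
  forall i, (p`_i = if (i <= n)%N then r`_(n - i) else 0) /\
            (r`_i = if (i <= n)%N then p`_(n - i) else 0).
Proof.
elim=> [j le|p1 p1' p2 p2' _ H1 _ H2|c p1 p1' _ H1] i.
- rewrite !coefXn; have [lei|lt] := leqP i n.
    by split; congr (_%:R); [rewrite eqn_sub2lE // | rewrite -{1}(subKn lei) eqn_sub2lE // leq_subr].
  split; first by rewrite gtn_eqF // (leq_ltn_trans le).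
  by rewrite gtn_eqF // (leq_ltn_trans (leq_subr _ _) lt).
- rewrite !coefD; have [E1 E2] := H1 i; have [E3 E4] := H2 i.
  by rewrite E1 E2 E3 E4; case: leqP => _; rewrite ?addr0.
rewrite !coefCM; have [E1 E2] := H1 i.
by rewrite E1 E2; case: leqP => _; rewrite ?mulr0.
Qed.

Lemma isrev_unique n p p' r : isrev n p r -> isrev n p' r -> p = p'.
Proof.
move=> H H'; apply/polyP=> i; have [-> _] := isrev_coef H i.
by have [-> _] := isrev_coef H' i.
Qed.

Lemma isrev_roots n (p r : {poly C}) : isrev n p r -> p`_0 != 0 -> r`_0 != 0 ->
  exists rs : seq C, [/\ size rs = n, all (fun x => x != 0) rs,
    p = p`_0 *: \prod_(x <- rs) (1 - x *: 'X) & r = p`_0 *: \prod_(x <- rs) ('X - x%:P)].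
Proof.
move=> H p0 r0; have Hc := isrev_coef H.
have rn : r`_n = p`_0 by have [_ ->] := Hc n; rewrite leqnn subnn.
have sr : size r = n.+1.
  apply/eqP; rewrite eqn_leq; apply/andP; split.
    by apply/leq_sizeP => j lt; have [_ ->] := Hc j; rewrite leqNgt lt.
  by apply: contraR p0; rewrite -ltnNge ltnS -rn => le; rewrite nth_default.
have lr : lead_coef r = p`_0 by rewrite lead_coefE sr.
have [rs Er] := @closed_field_poly_normal (Rdefinitions.R[i] : closedFieldType) r.
rewrite lr in Er; exists rs.
have srs : size rs = n.
  by have := sr; rewrite {1}Er size_scale // size_prod_XsubC => -[].
split=> //.
  apply/allP=> x xin; apply: contraNneq r0 => x0.
  have /rootP R0 : root (\prod_(z <- rs) ('X - z%:P)) 0 by rewrite root_prod_XsubC -x0.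
  by rewrite -horner_coef0 Er hornerZ R0 mulr0.
apply: (isrev_unique H); rewrite [X in isrev _ _ X]Er -!mul_polyC.
by apply: isrev_scale; rewrite -srs; exact: isrev_prod.
Qed.

Section Rationality.
Variables (mu mub : nat -> C) (ka : C) (G : K2).
Hypotheses (ka0 : ka != 0) (mu0 : mu 0%N != 0) (mub0 : mub 0%N != 0).
Hypothesis HG : (zK - wK) * (1 - zK * wK) * G = cK ka * Yser mu mub.
Local Notation M := (mu : ps C).
Local Notation B := (mub : ps C).
(** Expanded in powers of w, [Yser] is B(w) (Pz + w Rz) - M(w) (w Rz + w^2 Pz) with Pz and Rz taken
    in z. For each power of z the two brackets are mutually reversed of order 2; up to the factor
    [ka] they are [yr] and [yp]. *)
Let Pz : ps C := psX * (M - B).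
Let Rz : ps C := B - psX * (psX * M).

Let yp i : {poly C} := (ka * Rz i)%:P * 'X + (ka * Pz i)%:P * 'X^2.
Let yr i : {poly C} := (ka * Rz i)%:P * 'X + (ka * Pz i)%:P.

Let yrev i : isrev 2 (yp i) (yr i).
Proof.
apply: isrev_add; first exact: isrev_scale (@isrev_mon 2 1 isT).
by rewrite -[X in isrev _ _ X]mulr1 -(expr0 'X); exact: isrev_scale (@isrev_mon 2 2 isT).
Qed.

Let Ycoef i : (cK ka * Yser mu mub : K2) i = B * pser (yr i) - M * pser (yp i).
Proof.
have -> : cK ka * Yser mu mub = cK ka * (wi B * zi Pz + wK * (wi B * zi Rz)
   - wK * (wi M * zi Rz) - wK * (wK * (wi M * zi Pz))).
  by rewrite /Yser /Pz /Rz !ziM !ziB !ziM ziX; ring.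
rewrite /yp /yr; generalize Pz Rz => P R.
rewrite psC_mul !psD !psN !psC_mul /zi !rmorphD !rmorphM /= !pserC !pserX.
ring.
Qed.

Let Gp i : ps C := G i.
(** The coefficient of z^i in (z - w)(1 - zw) G, where (z - w)(1 - zw) = -w + z (1 + w^2) - z^2 w: a
    recursion of three terms in i. *)
Let rec_gen i : - (psX * Gp i) + (if i is j.+1 then (1 + psX ^+ 2) * Gp j else 0)
    - (if i is j.+2 then psX * Gp j else 0) = B * pser (yr i) - M * pser (yp i).
Proof.
rewrite -Ycoef -HG.
have -> : (zK - wK) * (1 - zK * wK) * G
  = - (wK * G) + zK * ((1 + wK ^+ 2) * G) - zK * (zK * (wK * G)) by ring.
have EwG j : (wK * G) j = psX * Gp j by rewrite psC_mul.
have E2 j : ((1 + wK ^+ 2) * G) j = (1 + psX ^+ 2) * Gp j.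
  have -> : 1 + wK ^+ 2 = ps_const (1 + psX ^+ 2) :> K2.
    by rewrite rmorphD rmorph1 rmorphXn.
  by rewrite psC_mul.
rewrite psD psD psN psN EwG !psXM; case: i => [|[|i]]; rewrite ?psXM ?E2 ?EwG //.
Qed.

(** The recursion yields only w G_i at each step, so the invariant concerns w^i G_i. Multiplication
    by 1 + w^2 and by powers of w respects reversal, which keeps k and k' reversed of order 2i, and
    the constant term of k never changes. *)
Let good i : Prop := exists k k' : {poly C},
  [/\ isrev i.*2 k k', k`_0 = - (ka * mub 0%N) & psX ^+ i * Gp i = B * pser k' - M * pser k].

Let psX_inj (f g : ps C) : psX * f = psX * g -> f = g.
Proof. by move=> E; apply/psP=> n; have := f_equal (fun x : ps C => x n.+1) E; rewrite !psXM. Qed.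

Let good_all i : good i /\ good i.+1.
Proof.
have yp0 j : (yp j)`_0 = 0 by rewrite /yp coefD !coefCM coefX coefXn !mulr0 addr0.
elim: i => [|i [IH1 IH2]].
  have g0 : good 0%N.
    exists (- (ka * mub 0%N))%:P, (- (ka * mub 0%N))%:P; split; last 2 first.
    - by rewrite coefC.
    - rewrite expr0 mul1r; apply: psX_inj; apply/oppr_inj; have := rec_gen 0%N.
      rewrite addr0 subr0 => ->; rewrite /yr /yp.
      have -> : Pz 0%N = 0 by rewrite /Pz psXM.
      have -> : Rz 0%N = mub 0%N by rewrite /Rz psD psN psXM subr0.
      rewrite mulr0 rmorph0 mul0r !addr0 !rmorphM /= !rmorphN /= pserX !pserC; ring.
    by rewrite -[X in isrev _ X _]mulr1 -[X in isrev _ _ X]mulr1 -(expr0 'X);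
      exact: isrev_scale (@isrev_mon 0 0 isT).
  split=> //; have [k [k' [H1 H2 H3]]] := g0.
  exists ((1 + 'X^2) * k - yp 1), ((1 + 'X^2) * k' - yr 1); split.
  - by apply: isrev_sub; [exact: isrev_widen | exact: yrev].
  - by rewrite coefB yp0 subr0 coef0M coefD coef1 coefXn addr0 mul1r.
  have := rec_gen 1; rewrite subr0 expr1 => E.
  rewrite expr0 mul1r in H3.
  rewrite !rmorphB !rmorphM rmorphD rmorph1 rmorphXn /= pserX.
  transitivity ((1 + psX ^+ 2) * Gp 0 - (- (psX * Gp 1) + (1 + psX ^+ 2) * Gp 0)); first by ring.
  by rewrite E H3; ring.
split=> //; have [k1 [k1' [H1 H2 H3]]] := IH1; have [k2 [k2' [H4 H5 H6]]] := IH2.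
exists ((1 + 'X^2) * k2 - 'X^2 * k1 - 'X^(i.+1) * yp i.+2),
       ((1 + 'X^2) * k2' - 'X^2 * k1' - 'X^(i.+1) * yr i.+2); split.
- apply: isrev_sub; first apply: isrev_sub.
  + exact: isrev_widen.
  + by have := isrev_shift 2 H1; rewrite -doubleD addn2.
  by have := isrev_shift i.+1 (yrev i.+2); rewrite -(doubleD 1 i.+1) add1n.
- by rewrite 2!coefB (coef0M _ (yp _)) (coef0M (1 + 'X^2)) (coef0M 'X^2) yp0 mulr0 subr0 coefD
  coef1 !coefXn mul0r subr0 addr0 mul1r.
rewrite !rmorphB !rmorphM rmorphD rmorph1 !rmorphXn /= pserX.
have E := rec_gen i.+2.
transitivity ((1 + psX ^+ 2) * (psX ^+ i.+1 * Gp i.+1) - psX ^+ 2 * (psX ^+ i * Gp i)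
   - psX ^+ i.+1 * (- (psX * Gp i.+2) + (1 + psX ^+ 2) * Gp i.+1 - psX * Gp i)).
  by rewrite !exprS; ring.
by rewrite E H3 H6; ring.
Qed.

(** The dependence multiplied by w^m becomes B r = M p with p and r reversed of order 2m, whence the
    even number of roots. Only the term i = m contributes to p(0), since the others carry w^(m - i),
    so p(0) is nonzero; comparing constant terms gives the same for r. *)
Lemma series_roots (ga : nat -> C) (m : nat) : ga m != 0 ->
  \sum_(i < m.+1) ps_const (ga i) * G i = 0 ->
  exists rs : seq C, [/\ ~~ odd (size rs), all (fun x => x != 0) rs &
    B * pser (\prod_(x <- rs) ('X - x%:P)) = M * pser (\prod_(x <- rs) (1 - x *: 'X))].
Proof.
move=> gm HS.
have /choice [k Hk] : forall i, exists k : {poly C} * {poly C},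
  [/\ isrev i.*2 k.1 k.2, k.1`_0 = - (ka * mub 0%N) & psX ^+ i * Gp i = B * pser k.2 - M * pser k.1].
  by move=> i; have [[k [k' H]] _] := good_all i; exists (k, k').
pose p := \sum_(i < m.+1) (ga i)%:P * ('X^(m - i) * (k i).1).
pose r := \sum_(i < m.+1) (ga i)%:P * ('X^(m - i) * (k i).2).
have Hpr : isrev m.*2 p r.
  apply: (@isrev_sum _ m.+1 (fun i => (ga i)%:P * ('X^(m - i) * (k i).1)) (fun i => (ga i)%:P *
    ('X^(m - i) * (k i).2))) => i lt.
  apply: isrev_scale; have [H _ _] := Hk i.
  by have := isrev_shift (m - i) H; rewrite -doubleD subnKC.
have p0 : p`_0 = ga m * - (ka * mub 0%N).
  rewrite /p coef_sum big_ord_recr big1 /= ?add0r => [|i _].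
    by rewrite subnn expr0 mul1r coefCM; have [_ -> _] := Hk m.
  by rewrite coefCM coef0M coefXn eq_sym subn_eq0 leqNgt ltn_ord mul0r mulr0.
have pn0 : p`_0 != 0 by rewrite p0 mulf_neq0 // oppr_eq0 mulf_neq0.
have E : B * pser r = M * pser p.
  apply/eqP; rewrite -subr_eq0 /p /r !raddf_sum !mulr_sumr -sumrB; apply/eqP.
  transitivity (psX ^+ m * \sum_(i < m.+1) ps_const (ga i) * G i); last by rewrite HS mulr0.
  rewrite mulr_sumr; apply: eq_bigr => i _; have [_ _ H] := Hk i.
  rewrite /= !rmorphM !rmorphXn /= pserX pserC.
  transitivity (ps_const (ga i) * psX ^+ (m - i) * (B * pser (k i).2 - M * pser (k i).1));
    first by ring.
  by rewrite -H mulrA -(mulrA (ps_const _)) -exprD subnK -1?ltnS // mulrCA mulrA.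
have r0 : r`_0 != 0.
  have := f_equal (fun f : ps C => f 0%N) E; rewrite !psM0 => E0.
  by apply: contraNneq (mulf_neq0 mu0 pn0) => r0; rewrite /pser in E0; rewrite -E0 r0 mulr0.
have [rs [sz nz Ep Er]] := isrev_roots Hpr pn0 r0.
exists rs; split=> //; first by rewrite sz odd_double.
move: (p`_0) pn0 Ep Er => c c0 Ep Er; move: E; rewrite Er Ep -!mul_polyC !rmorphM /= pserC => E.
apply/psP=> n; have := f_equal (fun f : ps C => f n) E.
by rewrite /= [in LHS]mulrCA [in RHS]mulrCA !psC_mul => /(mulfI c0).
Qed.
End Rationality.

(** * Tensor products of evaluation modules *)

(** One space for any number of tensor factors: a vector is a coordinate function, and g i is the
    basis index in the i-th factor. Splitting off g 0 identifies [vec] with sequences in [vec], so a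
    factor is added without a change of type. With no factors left the constant functions serve as
    the one-dimensional module. *)
Definition vec : Type := (nat -> nat) -> C.
HB.instance Definition _ := GRing.Zmodule.on vec.

Section VectorModule.
Definition vec_scale (c : C) (m : vec) : vec := fun g => c * m g.
Fact vec_scaleA a b m : vec_scale a (vec_scale b m) = vec_scale (a * b) m.
Proof. by apply/funext=> g; rewrite /vec_scale mulrA. Qed.
Fact vec_scale1 : left_id 1 vec_scale.
Proof. by move=> m; apply/funext=> g; rewrite /vec_scale mul1r. Qed.
Fact vec_scaleDr : right_distributive vec_scale +%R.
Proof. by move=> a m m'; apply/funext=> g; rewrite /vec_scale mulrDr. Qed.
Fact vec_scaleDl m : {morph vec_scale^~ m : a b / a + b}.
Proof. by move=> a b; apply/funext=> g; rewrite /vec_scale mulrDl. Qed.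
HB.instance Definition _ := GRing.Zmodule_isLmodule.Build C vec
  vec_scaleA vec_scale1 vec_scaleDr vec_scaleDl.
End VectorModule.

Lemma vecD (m m' : vec) g : (m + m') g = m g + m' g. Proof. by []. Qed.
Lemma vecZ c (m : vec) g : (c *: m) g = c * m g. Proof. by []. Qed.

Record oper := Oper {
  oper_fun :> vec -> vec;
  _ : forall c m m', oper_fun (c *: m + m') = c *: oper_fun m + oper_fun m'
}.

Lemma operP (f g : oper) : (forall m, f m = g m) <-> f = g.
Proof.
split=> [H|->//]; case: f g H => f Hf [g Hg] /= /funext E.
by subst g; congr Oper; exact: Prop_irrelevance.
Qed.

Lemma oper_lin (f : oper) c m m' : f (c *: m + m') = c *: f m + f m'.
Proof. by case: f. Qed.
Lemma operD (f : oper) m m' : f (m + m') = f m + f m'.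
Proof. by have := oper_lin f 1 m m'; rewrite !scale1r. Qed.
Lemma oper0 (f : oper) : f 0 = 0.
Proof. by apply: (@addrI _ (f 0)); rewrite -operD !addr0. Qed.
Lemma operZ (f : oper) c m : f (c *: m) = c *: f m.
Proof. by have := oper_lin f c m 0; rewrite oper0 !addr0. Qed.

Program Definition oper_add (f g : oper) : oper := @Oper (fun m => f m + g m) _.
Next Obligation. by rewrite !oper_lin scalerDr addrACA. Qed.
Program Definition oper_opp (f : oper) : oper := @Oper (fun m => - f m) _.
Next Obligation. by rewrite oper_lin opprD scalerN. Qed.
Program Definition oper_zero : oper := @Oper (fun=> 0) _.
Next Obligation. by rewrite scaler0 addr0. Qed.
Program Definition oper_one : oper := @Oper id _.
Program Definition oper_mul (f g : oper) : oper := @Oper (fun m => f (g m)) _.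
Next Obligation. by rewrite !oper_lin. Qed.
Program Definition oper_scale (c : C) (f : oper) : oper := @Oper (fun m => c *: f m) _.
Next Obligation. by rewrite oper_lin scalerDr !scalerA mulrC. Qed.

HB.instance Definition _ := gen_eqMixin oper.
HB.instance Definition _ := gen_choiceMixin oper.

Fact oper_addA : associative oper_add.
Proof. by move=> f g h; apply/operP=> m /=; rewrite addrA. Qed.
Fact oper_addC : commutative oper_add.
Proof. by move=> f g; apply/operP=> m /=; rewrite addrC. Qed.
Fact oper_add0 : left_id oper_zero oper_add.
Proof. by move=> f; apply/operP=> m /=; rewrite add0r. Qed.
Fact oper_addN : left_inverse oper_zero oper_opp oper_add.
Proof. by move=> f; apply/operP=> m /=; rewrite addNr. Qed.
HB.instance Definition _ :=
  GRing.isZmodule.Build oper oper_addA oper_addC oper_add0 oper_addN.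

Fact oper_mulA : associative oper_mul.
Proof. by move=> f g h; apply/operP. Qed.
Fact oper_mul1 : left_id oper_one oper_mul.
Proof. by move=> f; apply/operP. Qed.
Fact oper_mulr1 : right_id oper_one oper_mul.
Proof. by move=> f; apply/operP. Qed.
Fact oper_mulDl : left_distributive oper_mul +%R.
Proof. by move=> f g h; apply/operP. Qed.
Fact oper_mulDr : right_distributive oper_mul +%R.
Proof. by move=> f g h; apply/operP=> m /=; rewrite operD. Qed.
Fact oper_1neq0 : oper_one != 0.
Proof.
apply/eqP=> /operP /(_ (fun=> 1)) /(f_equal (fun m : vec => m id)) /eqP.
by rewrite oner_eq0.
Qed.
HB.instance Definition _ := GRing.Zmodule_isNzRing.Build oper
  oper_mulA oper_mul1 oper_mulr1 oper_mulDl oper_mulDr oper_1neq0.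

Fact oper_scaleA a b f : oper_scale a (oper_scale b f) = oper_scale (a * b) f.
Proof. by apply/operP=> m /=; rewrite scalerA. Qed.
Fact oper_scale1 : left_id 1 oper_scale.
Proof. by move=> f; apply/operP=> m /=; rewrite scale1r. Qed.
Fact oper_scaleDr : right_distributive oper_scale +%R.
Proof. by move=> a f g; apply/operP=> m /=; rewrite scalerDr. Qed.
Fact oper_scaleDl f : {morph oper_scale^~ f : a b / a + b}.
Proof. by move=> a b; apply/operP=> m /=; rewrite scalerDl. Qed.
HB.instance Definition _ := GRing.Zmodule_isLmodule.Build C oper
  oper_scaleA oper_scale1 oper_scaleDr oper_scaleDl.
Fact oper_scaleAl (a : C) (f g : oper) : a *: (f * g) = (a *: f) * g.
Proof. by apply/operP. Qed.
HB.instance Definition _ := GRing.Lmodule_isLalgebra.Build C oper oper_scaleAl.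
Fact oper_scaleAr (a : C) (f g : oper) : a *: (f * g) = f * (a *: g).
Proof. by apply/operP=> m /=; rewrite operZ. Qed.
HB.instance Definition _ := GRing.Lalgebra_isAlgebra.Build C oper oper_scaleAr.

Lemma oper_addE (f g : oper) m : (f + g) m = f m + g m. Proof. by []. Qed.
Lemma oper_oppE (f : oper) m : (- f) m = - f m. Proof. by []. Qed.
Lemma oper_mulE (f g : oper) m : (f * g) m = f (g m). Proof. by []. Qed.
Lemma oper_scaleE c (f : oper) m : (c *: f) m = c *: f m. Proof. by []. Qed.
Lemma oper_1E m : (1 : oper) m = m. Proof. by []. Qed.
Lemma oper_0E m : (0 : oper) m = 0. Proof. by []. Qed.

(* vec is identified with the space of sequences of vectors: slice m j is the j-th one. *)
Definition ncons (j : nat) (g : nat -> nat) : nat -> nat := fun i => if i is i'.+1 then g i' else j.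
Definition slice (m : vec) (j : nat) : vec := fun g => m (ncons j g).
Definition glue (v : nat -> vec) : vec := fun g => v (g 0%N) (fun i => g i.+1).

Lemma sliceK v j : slice (glue v) j = v j. Proof. by []. Qed.
Lemma slice_inj m m' : (forall j, slice m j = slice m' j) -> m = m'.
Proof.
move=> H; apply/funext=> g; have := f_equal (fun x : vec => x (fun i => g i.+1)) (H (g 0%N)).
by rewrite /slice (_ : ncons _ _ = g) //; apply/funext=> -[].
Qed.
Lemma sliceD m m' j : slice (m + m') j = slice m j + slice m' j. Proof. by []. Qed.
Lemma sliceN m j : slice (- m) j = - slice m j. Proof. by []. Qed.
Lemma sliceZ c m j : slice (c *: m) j = c *: slice m j. Proof. by []. Qed.
Lemma slice0 j : slice 0 j = 0. Proof. by []. Qed.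

Program Definition lift_op (f : oper) : oper := @Oper (fun m => glue (fun j => f (slice m j))) _.
Next Obligation. by apply: slice_inj => j; rewrite !(sliceD, sliceZ) !sliceK !(sliceD, sliceZ)
  oper_lin. Qed.
Program Definition diag_op (f : nat -> C) : oper :=
  @Oper (fun m => glue (fun j => f j *: slice m j)) _.
Next Obligation.
apply: slice_inj => j; rewrite !(sliceD, sliceZ) !sliceK !(sliceD, sliceZ).
by rewrite scalerDr !scalerA mulrC.
Qed.
Program Definition down_op : oper := @Oper (fun m => glue (fun j => slice m j.+1)) _.
Program Definition up_op : oper :=
  @Oper (fun m => glue (fun j => if j is i.+1 then slice m i else 0)) _.
Next Obligation.
apply: slice_inj => j; rewrite !(sliceD, sliceZ) !sliceK.
by case: j => [|j]; rewrite ?scaler0 ?addr0.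
Qed.

Lemma slice_lift f m j : slice (lift_op f m) j = f (slice m j). Proof. by []. Qed.
Lemma slice_diag f m j : slice (diag_op f m) j = f j *: slice m j. Proof. by []. Qed.
Lemma slice_down m j : slice (down_op m) j = slice m j.+1. Proof. by []. Qed.
Lemma slice_up m j : slice (up_op m) j = if j is i.+1 then slice m i else 0. Proof. by case: j. Qed.

Fact lift_zmod : zmod_morphism lift_op.
Proof. by move=> f g; apply/operP=> m; apply: slice_inj. Qed.
HB.instance Definition _ := GRing.isZmodMorphism.Build oper oper lift_op lift_zmod.
Fact lift_monoid : monoid_morphism lift_op.
Proof. by split=> [|f g]; apply/operP=> m; apply: slice_inj. Qed.
HB.instance Definition _ := GRing.isMonoidMorphism.Build oper oper lift_op lift_monoid.
Lemma liftZ c f : lift_op (c *: f) = c *: lift_op f.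
Proof. by apply/operP=> m; apply: slice_inj. Qed.

Lemma lift_diag f g : lift_op f * diag_op g = diag_op g * lift_op f.
Proof.
by apply/operP=> m; apply: slice_inj => j; rewrite !oper_mulE slice_lift !slice_diag operZ.
Qed.
Lemma lift_down f : lift_op f * down_op = down_op * lift_op f.
Proof. by apply/operP=> m; apply: slice_inj. Qed.
Lemma lift_up f : lift_op f * up_op = up_op * lift_op f.
Proof.
apply/operP=> m; apply: slice_inj => j; rewrite !oper_mulE slice_lift !slice_up.
by case: j => //; rewrite oper0.
Qed.
Lemma diagM f g : diag_op f * diag_op g = diag_op (fun j => f j * g j).
Proof.
by apply/operP=> m; apply: slice_inj => j; rewrite oper_mulE !slice_diag scalerA.
Qed.
Lemma diag1 : diag_op (fun=> 1) = 1.
Proof. by apply/operP=> m; apply: slice_inj => j; rewrite slice_diag scale1r. Qed.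
Lemma down_diag f : down_op * diag_op f = diag_op (fun j => f j.+1) * down_op.
Proof. by apply/operP=> m; apply: slice_inj. Qed.
Lemma diag_up f : diag_op f * up_op = up_op * diag_op (fun j => f j.+1).
Proof.
apply/operP=> m; apply: slice_inj => j; rewrite !oper_mulE slice_diag !slice_up.
by case: j => [|j]; rewrite ?slice_diag // scaler0.
Qed.
Lemma down_up : down_op * up_op = 1.
Proof. by apply/operP=> m; apply: slice_inj. Qed.
Lemma diag_up_down f : f 0%N = 0 -> diag_op f * up_op * down_op = diag_op f.
Proof.
move=> f0; apply/operP=> m; apply: slice_inj => j; rewrite !oper_mulE !slice_diag slice_up.
by case: j => [|j]; rewrite ?slice_down // f0 !scale0r.
Qed.

Section LOperator.
Variables (K : comNzRingType) (E : algType K) (Q I x y : K) (QI : Q * I = 1).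
Variables (k ki D U : E).
Hypotheses (kki : k * ki = 1) (kik : ki * k = 1)
  (Dk : D * k = Q *: (k * D)) (Dki : D * ki = I *: (ki * D))
  (Uk : U * k = I *: (k * U)) (Uki : U * ki = Q *: (ki * U))
  (DU : D * U = I *: (ki * ki) - (Q + x * y * I) *: 1 + (x * y * Q) *: (k * k))
  (UD : U * D = Q *: (ki * ki) - (Q + x * y * I) *: 1 + (x * y * I) *: (k * k)).

(* The evaluation L-operator, homogeneous in its spectral parameter (al : be). *)
Definition lop (al be : K) (i j : 'I_2) : E :=
  if i == o1 then (if j == o1 then al *: ki - (be * x) *: k else - (be *: D))
  else (if j == o1 then al *: U else (al * y) *: k - be *: ki).

(** Homogeneous parameters let one computation cover all three RTT relations: [Lt] is the value at
    (1 : w) and [Lb] is minus the value at (w : 1). *)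
Lemma lop_rtt (a1 b1 a2 b2 : K) i k' j l :
  \sum_(a < 2) \sum_(b < 2) rmat Q I (a1 * b2) (b1 * a2) i k' a b *: (lop a1 b1 a j * lop a2 b2 b l)
  = \sum_(a < 2) \sum_(b < 2) rmat Q I (a1 * b2) (b1 * a2) a b j l *: (lop a2 b2 k' b * lop a1 b1 i
    a).
Proof.
rewrite 6!sum_ord2 /rmat /lop.
case: (ord2P i) => ->; case: (ord2P k') => ->; case: (ord2P j) => ->; case: (ord2P l) => ->;
  rewrite ?eqxx ?o_eqs /= !(mulrDl, mulrDr, mulrN, mulNr) -?scalerAl -?scalerAr ?(kki, kik, Dk,
    Dki, Uk, Uki, DU, UD);
  lin_split K E; ring: QI.
Qed.
End LOperator.

Section Comultiplication.
Variables (K : comNzRingType) (E : algType K) (R : 'I_2 * 'I_2 -> 'I_2 * 'I_2 -> K).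
Implicit Types X Y : 'I_2 -> 'I_2 -> E.

Definition rtt_mx X Y : Prop := forall i k j l,
  \sum_(a < 2) \sum_(b < 2) R (i, k) (a, b) *: (X a j * Y b l)
  = \sum_(a < 2) \sum_(b < 2) R (a, b) (j, l) *: (Y k b * X i a).

Lemma rtt_mxP X Y : rtt_mx X Y <->
  mm (emb E R) (mm (leg1 X) (leg2 Y)) = mm (mm (leg2 Y) (leg1 X)) (emb E R).
Proof.
have L i k j l : mm (emb E R) (mm (leg1 X) (leg2 Y)) (i, k) (j, l)
    = \sum_(a < 2) \sum_(b < 2) R (i, k) (a, b) *: (X a j * Y b l).
  by rewrite mm_embl; apply: eq_bigr => a _; apply: eq_bigr => b _; rewrite mm_leg12.
have L' i k j l : mm (mm (leg2 Y) (leg1 X)) (emb E R) (i, k) (j, l)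
    = \sum_(a < 2) \sum_(b < 2) R (a, b) (j, l) *: (Y k b * X i a).
  by rewrite mm_embr; apply: eq_bigr => a _; apply: eq_bigr => b _; rewrite mm_leg21.
split=> [H|H i k j l]; first by apply/mat_ext=> i k j l; rewrite L L'.
by rewrite -L -L' H.
Qed.

(** This is the coproduct: since the entries of different tensor factors commute, the inner two
    matrices can be exchanged and R moved through one factor after the other. *)
Lemma rtt_mx_mul X1 Y1 X2 Y2 : rtt_mx X1 Y1 -> rtt_mx X2 Y2 ->
  (forall i j k l, GRing.comm (X2 i j) (Y1 k l)) ->
  (forall i j k l, GRing.comm (X1 i j) (Y2 k l)) ->
  rtt_mx (fun i j => \sum_a X1 i a * X2 a j) (fun i j => \sum_a Y1 i a * Y2 a j).
Proof.
move=> /rtt_mxP H1 /rtt_mxP H2 C1 C2; apply/rtt_mxP; rewrite -!leg1M -!leg2M.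
have C1' := mm_legC C1; have C2' := mm_legC C2.
move: (emb E R) (leg1 X1) (leg2 Y1) (leg1 X2) (leg2 Y2) H1 H2 C1' C2' => r x1 y1 x2 y2 H1 H2 C1' C2'.
have -> : mm (mm x1 x2) (mm y1 y2) = mm (mm x1 y1) (mm x2 y2).
  by rewrite -mmA (mmA x2) C1' -(mmA y1) mmA.
rewrite mmA H1 -mmA H2 !mmA; congr (mm _ _).
by rewrite -(mmA y1) C2' !mmA.
Qed.

Lemma rtt_mx_oppl X Y : rtt_mx X Y -> rtt_mx (fun i j => - X i j) Y.
Proof.
move=> H i k j l; apply/oppr_inj; rewrite -!sumrN.
transitivity (\sum_(a < 2) \sum_(b < 2) R (i, k) (a, b) *: (X a j * Y b l)).
  by apply: eq_bigr => a _; rewrite -sumrN; apply: eq_bigr => b _; rewrite mulNr scalerN opprK.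
rewrite H; apply: eq_bigr => a _; rewrite -sumrN; apply: eq_bigr => b _.
by rewrite mulrN scalerN opprK.
Qed.
Lemma rtt_mx_oppr X Y : rtt_mx X Y -> rtt_mx X (fun i j => - Y i j).
Proof.
move=> H i k j l; apply/oppr_inj; rewrite -!sumrN.
transitivity (\sum_(a < 2) \sum_(b < 2) R (i, k) (a, b) *: (X a j * Y b l)).
  by apply: eq_bigr => a _; rewrite -sumrN; apply: eq_bigr => b _; rewrite mulrN scalerN opprK.
rewrite H; apply: eq_bigr => a _; rewrite -sumrN; apply: eq_bigr => b _.
by rewrite mulNr scalerN opprK.
Qed.
End Comultiplication.

Lemma Uext_rels_hom (q : C) (A B : algType C) (f : A -> B) t tb ti tbi :
  alg_hom f -> Uext_rels q t tb ti tbi ->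
  Uext_rels q (fun i j r => f (t i j r)) (fun i j r => f (tb i j r))
    (fun i => f (ti i)) (fun i => f (tbi i)).
Proof.
move=> [fD fZ fM f1] [H1 H2 H3 H4 H5].
have f0 : f 0 = 0 by rewrite -(scale0r (0 : A)) fZ scale0r.
have fpc (x : nat -> A) r : pc (fun r => f (x r)) r = f (pc x r) by case: r.
split=> [||i|i|r s i j k l]; rewrite ?H1 ?H2 ?f0 // -?fM ?H3 //.
  by have [-> -> -> ->] := H4 i.
have E Xa Ya Xb Yb : rtt_entry q Xa Ya Xb Yb i j k l ->
   rtt_entry q (fun a b => f (Xa a b)) (fun a b => f (Ya a b)) (fun a b => f (Xb a b)) (fun a b =>
     f (Yb a b)) i j k l.
  rewrite /rtt_entry !sum_ord2 => H.
  by have := f_equal f H; rewrite !(fD, fZ, fM).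
have [K1 K2 K3] := H5 r s i j k l; split; rewrite /rtt_entry.
- under eq_bigr do under eq_bigr do rewrite !fpc.
  under [RHS]eq_bigr do under eq_bigr do rewrite !fpc.
  exact: (E (fun a b => t a b r) (fun a b => pc (t a b) s) (fun a b => pc (t a b) r) (fun a b => t
    a b s)).
- under eq_bigr do under eq_bigr do rewrite !fpc.
  under [RHS]eq_bigr do under eq_bigr do rewrite !fpc.
  exact: (E (fun a b => pc (tb a b) r) (fun a b => tb a b s) (fun a b => tb a b r) (fun a b => pc
    (tb a b) s)).
under eq_bigr do under eq_bigr do rewrite !fpc.
under [RHS]eq_bigr do under eq_bigr do rewrite !fpc.
exact: (E (fun a b => pc (tb a b) r) (fun a b => pc (t a b) s) (fun a b => tb a b r) (fun a b => t
  a b s)).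
Qed.

Section EvaluationFactor.
Variables (q : C) (q0 : q != 0) (x y : C).

Definition kop : oper := diag_op (fun j => q ^+ j).
Definition kiop : oper := diag_op (fun j => q ^- j).
(** Forced by the relation for U D in [LOperator] once D is the shift. It vanishes at j = 0, and at
    j = k + 1 if x y q^(2k) = 1; the second zero makes the span of the first k + 1 basis vectors
    invariant. *)
Definition kap (j : nat) : C := (q ^- j - q ^+ j) * (q * q ^- j - x * y * q^-1 * q ^+ j).
Definition dop : oper := down_op.
Definition uop : oper := diag_op kap * up_op.

Lemma kkiop : kop * kiop = 1.
Proof. by rewrite diagM -diag1; congr diag_op; apply/funext=> j; rewrite mulfV ?expf_neq0. Qed.
Lemma kikop : kiop * kop = 1.
Proof. by rewrite diagM -diag1; congr diag_op; apply/funext=> j; rewrite mulVf ?expf_neq0. Qed.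

Lemma diagZ c f : c *: diag_op f = diag_op (fun j => c * f j).
Proof. by apply/operP=> m; apply: slice_inj => j; rewrite oper_scaleE sliceZ !slice_diag scalerA. Qed.
Lemma diagD f g : diag_op f + diag_op g = diag_op (fun j => f j + g j).
Proof. by apply/operP=> m; apply: slice_inj => j; rewrite oper_addE sliceD !slice_diag scalerDl. Qed.
Lemma diagN f : - diag_op f = diag_op (fun j => - f j).
Proof. by apply/operP=> m; apply: slice_inj => j; rewrite oper_oppE sliceN !slice_diag scaleNr. Qed.

Lemma dkop : dop * kop = q *: (kop * dop).
Proof. by rewrite down_diag scalerAl diagZ; congr (diag_op _ * _); apply/funext=> j;
  rewrite exprS. Qed.
Lemma dkiop : dop * kiop = q^-1 *: (kiop * dop).
Proof. by rewrite down_diag scalerAl diagZ; congr (diag_op _ * _); apply/funext=> j;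
  rewrite exprS invfM. Qed.
Lemma ukop : uop * kop = q^-1 *: (kop * uop).
Proof.
rewrite /uop; have -> : kop * (diag_op kap * up_op) = diag_op kap * (kop * up_op).
  by rewrite !mulrA !diagM; congr (diag_op _ * _); apply/funext=> j; rewrite mulrC.
rewrite -mulrA scalerAr; congr (_ * _); rewrite diag_up scalerAr diagZ.
by congr (_ * diag_op _); apply/funext=> j; rewrite exprS mulKf.
Qed.
Lemma ukiop : uop * kiop = q *: (kiop * uop).
Proof.
rewrite /uop; have -> : kiop * (diag_op kap * up_op) = diag_op kap * (kiop * up_op).
  by rewrite !mulrA !diagM; congr (diag_op _ * _); apply/funext=> j; rewrite mulrC.
rewrite -mulrA scalerAr; congr (_ * _); rewrite diag_up scalerAr diagZ.
by congr (_ * diag_op _); apply/funext=> j; rewrite exprS invfM mulVKf.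
Qed.
Lemma duop : dop * uop = q^-1 *: (kiop * kiop) - (q + x * y * q^-1) *: 1 + (x * y * q) *: (kop * kop).
Proof.
rewrite /uop mulrA down_diag -mulrA down_up mulr1 !diagM -diag1 !diagZ diagN !diagD.
by congr diag_op; apply/funext=> j; rewrite /kap !exprS; field; rewrite q0 expf_neq0.
Qed.
Lemma udop : uop * dop = q *: (kiop * kiop) - (q + x * y * q^-1) *: 1 + (x * y * q^-1) *: (kop * kop).
Proof.
rewrite /uop diag_up_down; last by rewrite /kap expr0 invr1 subrr mul0r.
rewrite !diagM -diag1 !diagZ diagN !diagD.
by congr diag_op; apply/funext=> j; rewrite /kap; field; rewrite q0 expf_neq0.
Qed.

Definition Lt (i j : 'I_2) : ps oper :=
  if i == o1 then (if j == o1 then ps_const kiop - psX *: ps_const (x *: kop)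
                   else - (psX *: ps_const dop))
  else (if j == o1 then ps_const uop else ps_const (y *: kop) - psX *: ps_const kiop).
Definition Lb (i j : 'I_2) : ps oper :=
  if i == o1 then (if j == o1 then ps_const (x *: kop) - psX *: ps_const kiop
                   else ps_const dop)
  else (if j == o1 then - (psX *: ps_const uop) else ps_const kiop - psX *: ps_const (y *: kop)).

Definition cop (f : oper) : ps2 oper := inw (ps_const f).
Lemma copM f g : cop f * cop g = cop (f * g).
Proof. by rewrite /cop -inwM -rmorphM. Qed.
Lemma copZ c f : cop (c *: f) = cK c *: cop f.
Proof. by rewrite /cop -inwZC; congr inw; apply/psP=> n; rewrite psZC; case: n => //=;
  rewrite scaler0. Qed.
Lemma copD f g : cop (f + g) = cop f + cop g.
Proof. by rewrite /cop !rmorphD. Qed.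
Lemma copN f : cop (- f) = - cop f.
Proof. by rewrite /cop !rmorphN. Qed.
Lemma cop1 : cop 1 = 1.
Proof. by rewrite /cop !rmorph1. Qed.
Lemma inwX (f : ps oper) : inw (psX *: f) = wK *: inw f.
Proof.
apply/psP=> -[|n]; apply/psP=> m; rewrite wKE /inw /= ?psZX ?ps0 //.
by case: m => // m; rewrite ps0.
Qed.
Lemma inzX (f : ps oper) : inz (psX *: f) = zK *: inz f.
Proof. by apply/psP=> n; rewrite /inz !psZX; case: n => //; rewrite rmorph0. Qed.
Lemma inzC (f : oper) : inz (ps_const f) = cop f.
Proof. by apply/psP=> -[|n] //; rewrite /inz rmorph0. Qed.

Local Notation lh := (lop (cK x) (cK y) (cop kop) (cop kiop) (cop dop) (cop uop)).

Lemma inwN (f : ps oper) : inw (- f) = - inw f. Proof. exact: raddfN. Qed.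
Lemma inzN (f : ps oper) : inz (- f) = - inz f. Proof. exact: raddfN. Qed.
Lemma inwC (f : oper) : inw (ps_const f) = cop f. Proof. by []. Qed.
Lemma mapw_Lt i j : mapw Lt i j = lh 1 wK i j.
Proof.
rewrite /mapw /Lt /lop; case: (i == o1); case: (j == o1).
- by rewrite inwB inwX !inwC copZ scale1r scalerA.
- by rewrite inwN inwX inwC.
- by rewrite inwC scale1r.
by rewrite inwB inwX !inwC copZ mul1r.
Qed.
Lemma mapz_Lt i j : mapz Lt i j = lh 1 zK i j.
Proof.
rewrite /mapz /Lt /lop; case: (i == o1); case: (j == o1).
- by rewrite inzB inzX !inzC copZ scale1r scalerA.
- by rewrite inzN inzX inzC.
- by rewrite inzC scale1r.
by rewrite inzB inzX !inzC copZ mul1r.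
Qed.
Lemma mapw_Lb i j : mapw Lb i j = - lh wK 1 i j.
Proof.
rewrite /mapw /Lb /lop; case: (i == o1); case: (j == o1).
- by rewrite inwB inwX !inwC copZ mul1r opprB.
- by rewrite inwC scale1r opprK.
- by rewrite inwN inwX inwC.
by rewrite inwB inwX !inwC copZ scale1r scalerA opprB.
Qed.
Lemma mapz_Lb i j : mapz Lb i j = - lh zK 1 i j.
Proof.
rewrite /mapz /Lb /lop; case: (i == o1); case: (j == o1).
- by rewrite inzB inzX !inzC copZ mul1r opprB.
- by rewrite inzC scale1r opprK.
- by rewrite inzN inzX inzC.
by rewrite inzB inzX !inzC copZ scale1r scalerA opprB.
Qed.

Let lh_rtt (a1 b1 a2 b2 : K2) :
  rtt_mx (Rk q (a1 * b2) (b1 * a2)) (lh a1 b1) (lh a2 b2).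
Proof.
have -> : Rk q (a1 * b2) (b1 * a2)
  = fun p r => rmat (cK q) (cK q^-1) (a1 * b2) (b1 * a2) p.1 p.2 r.1 r.2.
  by apply/funext=> -[p1 p2]; apply/funext=> -[r1 r2]; rewrite RkE.
move=> i k j l.
apply: (lop_rtt (QkV q0)); rewrite ?copM.
- by rewrite kkiop cop1.
- by rewrite kikop cop1.
- by rewrite dkop copZ.
- by rewrite dkiop copZ.
- by rewrite ukop copZ.
- by rewrite ukiop copZ.
- have cKM a b : cK (a * b) = cK a * cK b by exact: rmorphM.
  have cKD a b : cK (a + b) = cK a + cK b by exact: rmorphD.
  by rewrite duop !copD copN !copZ cop1 cKD !cKM.
have cKM a b : cK (a * b) = cK a * cK b by exact: rmorphM.
have cKD a b : cK (a + b) = cK a + cK b by exact: rmorphD.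
by rewrite udop !copD copN !copZ cop1 cKD !cKM.
Qed.

Let fun2 (X Y : 'I_2 -> 'I_2 -> ps2 oper) : (forall i j, X i j = Y i j) -> X = Y.
Proof. by move=> H; apply/funext=> i; apply/funext=> j. Qed.

Lemma Lt_rtt : rtt_mx (Rk q zK wK) (mapw Lt) (mapz Lt).
Proof.
rewrite (fun2 mapw_Lt) (fun2 mapz_Lt).
by have := lh_rtt 1 wK 1 zK; rewrite mul1r mulr1.
Qed.
Lemma Lb_rtt : rtt_mx (Rk q wK zK) (mapw Lb) (mapz Lb).
Proof.
rewrite (fun2 mapw_Lb) (fun2 mapz_Lb); apply: rtt_mx_oppl; apply: rtt_mx_oppr.
by have := lh_rtt wK 1 zK 1; rewrite mul1r mulr1.
Qed.
Lemma Lbt_rtt : rtt_mx (Rk q (zK * wK) 1) (mapw Lb) (mapz Lt).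
Proof.
rewrite (fun2 mapw_Lb) (fun2 mapz_Lt); apply: rtt_mx_oppl.
by have := lh_rtt wK 1 1 zK; rewrite mulr1 (mulrC wK).
Qed.
End EvaluationFactor.

Section SeriesRelations.
Variables (q : C) (A : algType C).

Lemma Uext_rels_series (t tb : 'I_2 -> 'I_2 -> nat -> A) (ti tbi : 'I_2 -> A) :
  t o1 o2 0%N = 0 -> tb o2 o1 0%N = 0 ->
  (forall i, t i i 0%N * tb i i 0%N = tb i i 0%N * t i i 0%N) ->
  (forall i, [/\ t i i 0%N * ti i = 1, ti i * t i i 0%N = 1,
                 tb i i 0%N * tbi i = 1 & tbi i * tb i i 0%N = 1]) ->
  rtt_mx (Rk q zK wK) (mapw t) (mapz t) ->
  rtt_mx (Rk q wK zK) (mapw tb) (mapz tb) ->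
  rtt_mx (Rk q (zK * wK) 1) (mapw tb) (mapz t) ->
  Uext_rels q t tb ti tbi.
Proof.
move=> H1 H2 H3 H4 T1 T2 T3; split=> // r s i j k l.
have mz : mon true false = zK by rewrite /mon expr1 expr0 mulr1.
have mw : mon false true = wK by rewrite /mon expr1 expr0 mul1r.
have mzw : mon true true = zK * wK by rewrite /mon !expr1.
have m1 : mon false false = 1 by rewrite /mon !expr0 mulr1.
rewrite -mz -mw in T1 T2; rewrite -mzw -m1 in T3.
have [H5 _] := @rtt_coefP q A true false false true t t.
have [H6 _] := @rtt_coefP q A false true true false tb tb.
have [H7 _] := @rtt_coefP q A true true false false tb t.
split.
- exact: (H5 T1 r s i j k l).
- exact: (H6 T2 r s i j k l).
exact: (H7 T3 r s i j k l).
Qed.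

Section Twist.
Variables (t tb : 'I_2 -> 'I_2 -> nat -> A) (ti tbi : 'I_2 -> A).
Hypothesis HU : Uext_rels q t tb ti tbi.
Variables (phi : ps C) (phi0 : phi 0%N != 0).

(** The RTT relations are homogeneous in T, so T may be multiplied by an invertible scalar series.
    The series of s and of sb are multiplied by the same factor, and the ratio of the highest
    weights is unchanged. *)
Definition twist_t i j : nat -> A := phi *: (t i j : ps A).
Definition twist_ti i : A := (phi 0%N)^-1 *: ti i.

Lemma rtt_mx_scale (K : comNzRingType) (E : algType K) R (X Y : 'I_2 -> 'I_2 -> E) k k' :
  rtt_mx R X Y -> rtt_mx R (fun i j => k *: X i j) (fun i j => k' *: Y i j).
Proof.
move=> H i k0 j l.
transitivity ((k * k') *: \sum_(a < 2) \sum_(b < 2) R (i, k0) (a, b) *: (X a j * Y b l)).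
  rewrite scaler_sumr; apply: eq_bigr => a _; rewrite scaler_sumr; apply: eq_bigr => b _.
  by rewrite -scalerAl -scalerAr !scalerA; congr (_ *: _); ring.
rewrite H scaler_sumr; apply: eq_bigr => a _; rewrite scaler_sumr; apply: eq_bigr => b _.
by rewrite -scalerAl -scalerAr !scalerA; congr (_ *: _); ring.
Qed.

Let inw_phi (f : ps A) : inw (phi *: f) = wi phi *: inw f.
Proof.
apply/psP=> n; rewrite psZC.
case: n => //= n; apply/psP=> m; rewrite psZ big1 ?ps0 // => i _; rewrite ps0 scaler0 //.
Qed.
Let inz_phi (f : ps A) : inz (phi *: f) = zi phi *: inz f.
Proof.
apply/psP=> n; apply/psP=> m.
have E i : ((zi phi i *: ps_const (f (n - i)%N) : ps A) m) = ps_const (phi i *: f (n - i)%N) m.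
  by rewrite /zi psZC; case: m => //= m; rewrite scaler0.
transitivity ((\sum_(i < n.+1) (zi phi i *: ps_const (f (n - i)%N) : ps A)) m); last by rewrite psZ.
rewrite ps_sum; under eq_bigr do rewrite E.
by rewrite /inz psZ rmorph_sum ps_sum.
Qed.

Lemma Uext_rels_twist : Uext_rels q twist_t tb twist_ti tbi.
Proof.
have [H1 H2 H3 H4 _] := HU.
have t0 i j : twist_t i j 0%N = phi 0%N *: t i j 0%N by rewrite /twist_t psZ big_ord1.
have Ew : mapw twist_t = fun i j => wi phi *: mapw t i j.
  by apply/funext=> i; apply/funext=> j; exact: inw_phi.
have Ez : mapz twist_t = fun i j => zi phi *: mapz t i j.
  by apply/funext=> i; apply/funext=> j; exact: inz_phi.
apply: Uext_rels_series => //.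
- by rewrite t0 H1 scaler0.
- by move=> i; rewrite t0 -scalerAl -scalerAr H3.
- move=> i; have [H5 H6 H7 H8] := H4 i; rewrite t0 /twist_ti; split=> //.
    by rewrite -scalerAl -scalerAr scalerA mulfV // scale1r.
  by rewrite -scalerAl -scalerAr scalerA mulVf // scale1r.
- by rewrite Ew Ez; apply: rtt_mx_scale; exact: (rtt_TT HU).
- exact: (rtt_BB HU).
rewrite Ez -[mapw tb](_ : (fun i j => 1 *: mapw tb i j) = _).
  by apply: rtt_mx_scale; exact: (rtt_BT HU).
by apply/funext=> i; apply/funext=> j; rewrite scale1r.
Qed.

Lemma s_coef_twist i j :
  (s_coef q twist_t tb i j : ps A) = phi *: (s_coef q t tb i j : ps A).
Proof.
rewrite !s_coefE /twist_t scalerBr -!scalerAl scalerA mulrC -scalerA //.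
Qed.
Lemma sb_coef_twist i j :
  (sb_coef q twist_t tb i j : ps A) = phi *: (sb_coef q t tb i j : ps A).
Proof.
rewrite !sb_coefE /twist_t scalerBr -!scalerAr scalerA mulrC -scalerA //.
Qed.
End Twist.

Section Diagonal.
Variables (x : C) (x0 : x != 0).
(** The constant solution T = Tb = diag(x, 1). With x = 1 it starts the induction over tensor
    factors; other values of x give representations in which s12^(0) is the scalar q x. *)
Definition diag_val (i : 'I_2) : C := if i == o1 then x else 1.
Let dg (u : C) (i j : 'I_2) : A := (if i == j then u * diag_val i else 0) *: 1.
Definition diag_t (i j : 'I_2) (r : nat) : A := dg (r == 0%N)%:R i j.
Definition diag_ti (i : 'I_2) : A := (diag_val i)^-1 *: 1.

Let dg_rtt u v u' v' i j k l : rtt_entry q (dg u) (dg v) (dg u') (dg v') i j k l.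
Proof.
have S (F : 'I_2 -> 'I_2 -> A) c d : (forall a b, (a, b) != (c, d) -> F a b = 0) ->
    \sum_(a < 2) \sum_(b < 2) F a b = F c d.
  move=> F0; rewrite (bigD1 c) //= [X in _ + X]big1 ?addr0 => [|a ne].
    by rewrite (bigD1 d) //= big1 ?addr0 // => b ne; apply: F0; rewrite xpair_eqE eqxx.
  by rewrite big1 // => b _; apply: F0; rewrite xpair_eqE (negPf ne).
have dg0 w a b : a != b -> dg w a b = 0 by rewrite /dg => /negPf ->; rewrite scale0r.
have dgM w w' a b : dg w a a * dg w' b b = dg w' b b * dg w a a.
  by rewrite /dg !eqxx -!scalerAl -!scalerAr !mulr1 !scalerA mulrC.
have dgS w w' a b : dg w a a * dg w' b b = dg w b b * dg w' a a.
  rewrite /dg !eqxx -!scalerAl -!scalerAr !mulr1 !scalerA.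
  by congr (_ *: _); rewrite mulrACA (mulrC (diag_val a)) mulrACA.
(* The entries of R vanish unless the two indices are kept or exchanged. *)
have RP a b c d : (a == c) && (b == d) || (a == d) && (b == c) \/ Ral q a b c d = 0 /\ Rbe q a b c
  d = 0.
  rewrite /Ral /Rbe; case: ((a == c) && (b == d)); first by left.
  by rewrite /= (eq_sym b) andbA andbC; case: (a == d); case: (c == b); rewrite ?andbF /=; auto.
rewrite /rtt_entry (S _ j l) => [|a b ne]; last first.
  move: ne; rewrite xpair_eqE negb_and => /orP[] ne;
    rewrite !(dg0 _ _ _ ne) ?mulr0 ?mul0r !scaler0 addr0 //.
rewrite (S _ i k) => [|a b ne]; last first.
  move: ne; rewrite xpair_eqE negb_and eq_sym (eq_sym b) => /orP[] ne;
    by rewrite !(dg0 _ _ _ ne) ?mulr0 ?mul0r !scaler0 addr0.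
case: (RP i k j l) => [/orP[/andP[/eqP -> /eqP ->]|/andP[/eqP -> /eqP ->]]|[-> ->]].
- by rewrite !(dgM _ _ j l).
- by rewrite (dgS u v j l) (dgM u v l j) (dgS u' v' j l) (dgM u' v' l j).
by rewrite !scale0r.
Qed.

Lemma Uext_rels_diag : Uext_rels q diag_t diag_t diag_ti diag_ti.
Proof.
have v0 i : diag_val i != 0 by rewrite /diag_val; case: ifP => //; rewrite oner_eq0.
have pcE i j r : pc (diag_t i j) r = dg (r == 1%N)%:R i j.
  by case: r => [|r] //=; rewrite /dg mul0r; case: ifP => _; rewrite scale0r.
split=> [||//|i|r s i j k l].
- by rewrite /diag_t /dg o_eqs scale0r.
- by rewrite /diag_t /dg o_eqs scale0r.
- rewrite /diag_t /dg /diag_ti !eqxx mul1r.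
  by rewrite -!scalerAl -!scalerAr mul1r !scalerA mulfV // mulVf // scale1r.
split; rewrite /rtt_entry.
- under eq_bigr do under eq_bigr do rewrite !pcE.
  under [RHS]eq_bigr do under eq_bigr do rewrite !pcE.
  exact: dg_rtt.
- under eq_bigr do under eq_bigr do rewrite !pcE.
  under [RHS]eq_bigr do under eq_bigr do rewrite !pcE.
  exact: dg_rtt.
under eq_bigr do under eq_bigr do rewrite !pcE.
under [RHS]eq_bigr do under eq_bigr do rewrite !pcE.
exact: dg_rtt.
Qed.
End Diagonal.
End SeriesRelations.

Lemma comm_wz (A : algType C) (f g : ps A) : (forall n m, f n * g m = g m * f n) ->
  GRing.comm (inw f) (inz g) /\ GRing.comm (inz f) (inw g).
Proof.
move=> H; split; apply/psP=> n; apply/psP=> m; first by rewrite inwM_inz inzM_inw.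
by rewrite inwM_inz inzM_inw.
Qed.
Lemma comm_ps (A : algType C) (f g : ps A) : (forall n m, f n * g m = g m * f n) ->
  f * g = g * f.
Proof.
move=> H; apply/psP=> n; rewrite !psM (reindex_inj rev_ord_inj) /=.
by apply: eq_bigr => i _; rewrite subSS subKn -1?ltnS.
Qed.

Section TensorFactor.
Variables (q : C) (q0 : q != 0) (x y : C) (x0 : x != 0) (y0 : y != 0).
Variables (t tb : 'I_2 -> 'I_2 -> nat -> oper) (ti tbi : 'I_2 -> oper).
Hypothesis HU : Uext_rels q t tb ti tbi.

Local Notation Lt := (Lt q x y).
Local Notation Lb := (Lb q x y).
Local Notation kop := (kop q).
Local Notation kiop := (kiop q).

Definition lps (f : nat -> oper) : ps oper := fun n => lift_op (f n).
Definition tensor_t i j : nat -> oper := \sum_(a < 2) Lt i a * lps (t a j).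
Definition tensor_tb i j : nat -> oper := \sum_(a < 2) Lb i a * lps (tb a j).
Definition tensor_ti (i : 'I_2) : oper :=
  if i == o1 then lift_op (ti i) * kop else y^-1 *: (lift_op (ti i) * kiop).
Definition tensor_tbi (i : 'I_2) : oper :=
  if i == o1 then x^-1 *: (lift_op (tbi i) * kiop) else lift_op (tbi i) * kop.

Lemma lpsM f g : lps ((f : ps oper) * g) = lps f * lps g.
Proof.
apply/psP=> n; rewrite psM /lps psM rmorph_sum; apply: eq_bigr => i _; exact: rmorphM.
Qed.
Lemma lpsB f g : lps ((f : ps oper) - g) = lps f - lps g.
Proof. by apply/psP=> n; rewrite /lps !psD !psN rmorphB. Qed.
Lemma lpsZC c f : lps (ps_const c *: (f : ps oper)) = ps_const c *: lps f.
Proof. by apply/psP=> n; rewrite /lps !psZC liftZ. Qed.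

Let comm_lift (g : oper) : Prop := forall f, lift_op f * g = g * lift_op f.
Let comm_kop : comm_lift kop. Proof. by move=> f; exact: lift_diag. Qed.
Let comm_kiop : comm_lift kiop. Proof. by move=> f; exact: lift_diag. Qed.
Let comm_dop : comm_lift dop. Proof. by move=> f; exact: lift_down. Qed.
Let comm_uop : comm_lift (uop q x y).
Proof. by move=> f; rewrite /uop mulrA lift_diag -!mulrA lift_up. Qed.
Let comm_Z c g : comm_lift g -> comm_lift (c *: g).
Proof. by move=> H f; rewrite -scalerAr H scalerAl. Qed.
Let comm_0 : comm_lift 0. Proof. by move=> f; rewrite mulr0 mul0r. Qed.
Let comm_B g g' : comm_lift g -> comm_lift g' -> comm_lift (g - g').
Proof. by move=> H H' f; rewrite mulrBr mulrBl H H'. Qed.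
Let comm_C g n : comm_lift g -> comm_lift (ps_const g n).
Proof. by move=> H; case: n => [|n] //=; exact: comm_0. Qed.
Let comm_X (f : ps oper) n : (forall m, comm_lift (f m)) -> comm_lift ((psX *: f) n).
Proof. by move=> H; rewrite psZX; case: n => // ; exact: comm_0. Qed.
Let comm_Lt i j n : comm_lift (Lt i j n).
Proof.
rewrite /Lt; case: ifP => _; case: ifP => _.
- rewrite psD psN; apply: comm_B; first exact: comm_C.
  by apply: comm_X => m; apply/comm_C/comm_Z.
- rewrite psN -[- _]sub0r; apply: comm_B; first exact: comm_0.
  by apply: comm_X => m; exact: comm_C.
- exact: comm_C.
rewrite psD psN; apply: comm_B; first exact/comm_C/comm_Z.
by apply: comm_X => m; exact: comm_C.
Qed.
Let comm_Lb i j n : comm_lift (Lb i j n).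
Proof.
rewrite /Lb; case: ifP => _; case: ifP => _.
- rewrite psD psN; apply: comm_B; first exact/comm_C/comm_Z.
  by apply: comm_X => m; apply/comm_C.
- exact: comm_C.
- rewrite psN -[- _]sub0r; apply: comm_B; first exact: comm_0.
  by apply: comm_X => m; exact: comm_C.
rewrite psD psN; apply: comm_B; first exact/comm_C.
by apply: comm_X => m; exact/comm_C/comm_Z.
Qed.

Let lift_rels := Uext_rels_hom (f := lift_op) (And4 (@raddfD _ _ lift_op) liftZ (@rmorphM _ _
  lift_op) (rmorph1 lift_op)) HU.

Lemma tensor_t0 : [/\ tensor_t o1 o2 0%N = 0, tensor_tb o2 o1 0%N = 0,
   tensor_t o1 o1 0%N = kiop * lift_op (t o1 o1 0%N) /\
   tensor_t o2 o2 0%N = y *: (kop * lift_op (t o2 o2 0%N)),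
   tensor_tb o1 o1 0%N = x *: (kop * lift_op (tb o1 o1 0%N)) &
   tensor_tb o2 o2 0%N = kiop * lift_op (tb o2 o2 0%N)].
Proof.
have [H1 H2 _ _ _] := HU.
rewrite /tensor_t /tensor_tb !ps_sum !sum_ord2 !psM0 /lps /Lt /Lb /=.
rewrite !(psD, psN) !psZX /= H1 H2 rmorph0 !oppr0 !addr0 !mulr0 !mul0r !addr0 !add0r -!scalerAl.
by split.
Qed.

Let maps_t (phi : {rmorphism ps oper -> ps2 oper}) i j :
  phi (tensor_t i j) = \sum_a phi (Lt i a) * phi (lps (t a j)).
Proof. by rewrite /tensor_t rmorph_sum; apply: eq_bigr => a _; rewrite rmorphM. Qed.
Let maps_tb (phi : {rmorphism ps oper -> ps2 oper}) i j :
  phi (tensor_tb i j) = \sum_a phi (Lb i a) * phi (lps (tb a j)).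
Proof. by rewrite /tensor_tb rmorph_sum; apply: eq_bigr => a _; rewrite rmorphM. Qed.

Let fun2 (X Y : 'I_2 -> 'I_2 -> ps2 oper) : (forall i j, X i j = Y i j) -> X = Y.
Proof. by move=> H; apply/funext=> i; apply/funext=> j. Qed.

Lemma Uext_rels_tensor : Uext_rels q tensor_t tensor_tb tensor_ti tensor_tbi.
Proof.
have [_ _ H3 H4 _] := HU; have [Z1 Z2 [Z3 Z4] Z5 Z6] := tensor_t0.
have kk := kkiop q0; have kik := kikop q0.
have c1 (f g : oper) : kiop * lift_op f * (kop * lift_op g) = lift_op f * lift_op g.
  by rewrite -mulrA (mulrA (lift_op f)) comm_kop -mulrA mulrA kik mul1r.
have c2 (f g : oper) : kop * lift_op f * (kiop * lift_op g) = lift_op f * lift_op g.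
  by rewrite -mulrA (mulrA (lift_op f)) comm_kiop -mulrA mulrA kk mul1r.
have c3 (f g : oper) : f * g = 1 -> kiop * lift_op f * (lift_op g * kop) = 1.
  by move=> fg; rewrite -mulrA (mulrA (lift_op f)) -rmorphM fg rmorph1 mul1r.
have c4 (f g : oper) : f * g = 1 -> kop * lift_op f * (lift_op g * kiop) = 1.
  by move=> fg; rewrite -mulrA (mulrA (lift_op f)) -rmorphM fg rmorph1 mul1r.
have c5 (f g : oper) : g * f = 1 -> lift_op g * kop * (kiop * lift_op f) = 1.
  by move=> fg; rewrite -mulrA (mulrA kop) kk mul1r -rmorphM fg rmorph1.
have c6 (f g : oper) : g * f = 1 -> lift_op g * kiop * (kop * lift_op f) = 1.
  by move=> fg; rewrite -mulrA (mulrA kiop) kik mul1r -rmorphM fg rmorph1.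
pose lt i j := lps (t i j); pose lb i j := lps (tb i j).
have Etw : mapw tensor_t = fun i j => \sum_a mapw Lt i a * mapw lt a j.
  by apply: fun2 => i j; exact: (maps_t (@inw oper)).
have Etz : mapz tensor_t = fun i j => \sum_a mapz Lt i a * mapz lt a j.
  by apply: fun2 => i j; exact: (maps_t (@inz oper)).
have Ebw : mapw tensor_tb = fun i j => \sum_a mapw Lb i a * mapw lb a j.
  by apply: fun2 => i j; exact: (maps_tb (@inw oper)).
have Ebz : mapz tensor_tb = fun i j => \sum_a mapz Lb i a * mapz lb a j.
  by apply: fun2 => i j; exact: (maps_tb (@inz oper)).
apply: Uext_rels_series => //.
- move=> i; case: (ord2P i) => ->.
    by rewrite Z3 Z5 -scalerAr -scalerAl c1 c2 -!rmorphM H3.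
  by rewrite Z4 Z6 -scalerAr -scalerAl c1 c2 -!rmorphM H3.
- move=> i; have [K1 K2' K3 K4] := H4 i; move: K1 K2' K3 K4; rewrite /tensor_ti /tensor_tbi.
  case: (ord2P i) => -> K1 K2' K3 K4; rewrite ?eqxx ?o_eqs.
    rewrite Z3 Z5 -!scalerAr -!scalerAl !scalerA mulfV // mulVf // !scale1r; split; auto.
  rewrite Z4 Z6 -!scalerAr -!scalerAl !scalerA mulfV // mulVf // !scale1r; split; auto.
- rewrite Etw Etz.
  apply: rtt_mx_mul; [exact: Lt_rtt | exact: (rtt_TT lift_rels) | |] => i j k l.
    by have [] := @comm_wz _ (lps (t i j)) (Lt k l) (fun n m => comm_Lt k l m _).
  by have [_ /commr_sym] := @comm_wz _ (lps (t k l)) (Lt i j) (fun n m => comm_Lt i j m _).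
- rewrite Ebw Ebz.
  apply: rtt_mx_mul; [exact: Lb_rtt | exact: (rtt_BB lift_rels) | |] => i j k l.
    by have [] := @comm_wz _ (lps (tb i j)) (Lb k l) (fun n m => comm_Lb k l m _).
  by have [_ /commr_sym] := @comm_wz _ (lps (tb k l)) (Lb i j) (fun n m => comm_Lb i j m _).
rewrite Ebw Etz.
apply: rtt_mx_mul; [exact: Lbt_rtt | exact: (rtt_BT lift_rels) | |] => i j k l.
  by have [] := @comm_wz _ (lps (tb i j)) (Lt k l) (fun n m => comm_Lt k l m _).
by have [_ /commr_sym] := @comm_wz _ (lps (t k l)) (Lb i j) (fun n m => comm_Lb i j m _).
Qed.

(** The coideal property S = L S' Lb^t: T and Tb acquire L and Lb on the left, and the entries of Lb
    commute with the lifted operators, so they can be collected in front. *)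
Lemma s_coef_tensor i j : s_coef q tensor_t tensor_tb i j
  = \sum_(a < 2) \sum_(b < 2) Lt i a * Lb j b * lps (s_coef q t tb a b) :> ps oper.
Proof.
have E (f g : 'I_2 -> nat -> oper) :
   (\sum_(a < 2) Lt i a * lps (f a)) * (\sum_(b < 2) Lb j b * lps (g b))
   = \sum_(a < 2) \sum_(b < 2) Lt i a * Lb j b * lps ((f a : ps oper) * g b).
  rewrite big_distrlr; apply: eq_bigr => a _; apply: eq_bigr => b _ /=.
  rewrite lpsM -!mulrA; congr (_ * _); rewrite !mulrA; congr (_ * _).
  by apply: comm_ps => n m; exact: comm_Lb.
rewrite s_coefE /tensor_t /tensor_tb !E scaler_sumr -sumrB; apply: eq_bigr => a _.
rewrite scaler_sumr -sumrB; apply: eq_bigr => b _.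
by rewrite s_coefE lpsB lpsZC mulrBr scalerAr.
Qed.
Lemma sb_coef_tensor i j : sb_coef q tensor_t tensor_tb i j
  = \sum_(a < 2) \sum_(b < 2) Lb i a * Lt j b * lps (sb_coef q t tb a b) :> ps oper.
Proof.
have E (f g : 'I_2 -> nat -> oper) :
   (\sum_(a < 2) Lb i a * lps (f a)) * (\sum_(b < 2) Lt j b * lps (g b))
   = \sum_(a < 2) \sum_(b < 2) Lb i a * Lt j b * lps ((f a : ps oper) * g b).
  rewrite big_distrlr; apply: eq_bigr => a _; apply: eq_bigr => b _ /=.
  rewrite lpsM -!mulrA; congr (_ * _); rewrite !mulrA; congr (_ * _).
  by apply: comm_ps => n m; exact: comm_Lt.
rewrite sb_coefE /tensor_t /tensor_tb !E scaler_sumr -sumrB; apply: eq_bigr => a _.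
rewrite scaler_sumr -sumrB; apply: eq_bigr => b _.
by rewrite sb_coefE lpsB lpsZC mulrBr scalerAr.
Qed.

Lemma s12inv_tensor : s12inv q tensor_ti tensor_tbi
  = diag_op (fun j => q ^+ (2 * j)) * lift_op (s12inv q ti tbi).
Proof.
have E (f g : oper) : lift_op f * kop * (lift_op g * kop) = kop * kop * lift_op (f * g).
  by rewrite rmorphM /= !comm_kop -mulrA (mulrA (lift_op f)) comm_kop !mulrA.
rewrite /s12inv /tensor_ti /tensor_tbi o_eqs eqxx liftZ -scalerAr E diagM.
by congr (_ *: (diag_op _ * _)); apply/funext=> j; rewrite mul2n -addnn exprD.
Qed.
End TensorFactor.

(** * The action on tensor products in coordinates *)

Section Representations.
Variables (q : C) (q0 : q != 0).
Hypothesis hq : forall n : nat, (0 < n)%N -> q ^+ n != 1.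

(* A factor (x, y, m): the string of m + 1 weights (infinite when m = None). *)
Definition factor : Type := (C * C * option nat)%type.
Implicit Types (fs : seq factor) (v : vec) (g : nat -> nat) (f h : ps oper).

Fixpoint rep_t fs : 'I_2 -> 'I_2 -> nat -> oper :=
  if fs is f :: fs' then tensor_t q f.1.1 f.1.2 (rep_t fs') else diag_t oper 1.
Fixpoint rep_tb fs : 'I_2 -> 'I_2 -> nat -> oper :=
  if fs is f :: fs' then tensor_tb q f.1.1 f.1.2 (rep_tb fs') else diag_t oper 1.
Fixpoint rep_ti fs : 'I_2 -> oper :=
  if fs is f :: fs' then tensor_ti q f.1.2 (rep_ti fs') else diag_ti oper 1.
Fixpoint rep_tbi fs : 'I_2 -> oper :=
  if fs is f :: fs' then tensor_tbi q f.1.1 (rep_tbi fs') else diag_ti oper 1.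

(** [None] puts no condition on the product x y; that the string never closes is expressed
    separately by [free_factor]. *)
Fixpoint valid fs : Prop :=
  if fs is f :: fs' then
    [/\ f.1.1 != 0, f.1.2 != 0,
        (forall k, f.2 = Some k -> f.1.1 * f.1.2 * q ^+ (2 * k) = 1) & valid fs']
  else True.

Lemma rep_rels fs : valid fs -> Uext_rels q (rep_t fs) (rep_tb fs) (rep_ti fs) (rep_tbi fs).
Proof.
elim: fs => [|[[x y] m] fs IH] /=; first by move=> _; apply: Uext_rels_diag; exact: oner_neq0.
by move=> [x0 y0 _ /IH]; exact: Uext_rels_tensor.
Qed.

Definition rs fs := s_coef q (rep_t fs) (rep_tb fs).
Definition rsb fs := sb_coef q (rep_t fs) (rep_tb fs).

Fixpoint hwv fs : vec :=
  if fs is _ :: fs' then glue (fun j => if j is 0%N then hwv fs' else 0) else fun=> 1.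
(** With [mubP], the eigenvalues of s21 and sb21 on [hwv]. In the trivial representation both are
    -1, as s21 = q t21 tb12 - t22 tb11. A factor contributes the values at j = 0 of the diagonal
    entries of L and Lb. *)
Fixpoint muP fs : {poly C} :=
  if fs is f :: fs' then (f.1.2%:P - 'X) * (f.1.1%:P - 'X) * muP fs' else - 1.
Fixpoint mubP fs : {poly C} :=
  if fs is f :: fs' then (1 - f.1.2 *: 'X) * (1 - f.1.1 *: 'X) * mubP fs' else - 1.

(** Taking one coordinate of the image moves identities between operator series into the commutative
    ring [ps C]. *)
Definition evl f v g : ps C := fun r => f r v g.

Lemma evlD f h v g : evl (f + h) v g = evl f v g + evl h v g. Proof. by []. Qed.
Lemma evlN f v g : evl (- f) v g = - evl f v g. Proof. by []. Qed.
Lemma evlZ (k : ps C) f v g : evl (k *: f) v g = k * evl f v g.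
Proof.
apply/psP=> r; rewrite /evl psZ psM.
by elim/big_rec2: _ => //= i z w _ <-.
Qed.
Lemma evl0 f g : evl f 0 g = 0.
Proof. by apply/psP=> r; rewrite /evl oper0 ps0. Qed.
Lemma evl_scale f c v g : evl f (c *: v) g = ps_const c * evl f v g.
Proof. by apply/psP=> r; rewrite /evl operZ psC_mul. Qed.
Lemma evl_const (a : oper) h v g : evl (ps_const a * h) v g = fun r => a (h r v) g.
Proof. by apply/psP=> r; rewrite /evl psC_mul. Qed.
Lemma evl_diag (a : nat -> C) h v j g :
  evl (ps_const (diag_op a) * h) v (ncons j g) = ps_const (a j) * evl h v (ncons j g).
Proof. by rewrite evl_const; apply/psP=> r; rewrite psC_mul. Qed.
Lemma evl_down h v j g :
  evl (ps_const dop * h) v (ncons j g) = evl h v (ncons j.+1 g).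
Proof. by rewrite evl_const; apply/psP. Qed.
Lemma evl_uop x y h v j g : evl (ps_const (uop q x y) * h) v (ncons j g)
  = ps_const (kap q x y j) * (if j is i.+1 then evl h v (ncons i g) else 0).
Proof.
rewrite evl_const; apply/psP=> r; rewrite psC_mul /uop oper_mulE.
by case: j => [|j] /=; rewrite ?ps0.
Qed.
Lemma evl_lps (s : nat -> oper) v j g : evl (lps s) v (ncons j g) = evl s (slice v j) g.
Proof. by []. Qed.

Section OneFactor.
Variables (x y : C).
Definition la j : ps C := ps_const (q ^- j) - psX * ps_const (x * q ^+ j).
Definition ld j : ps C := ps_const (y * q ^+ j) - psX * ps_const (q ^- j).
Definition lba j : ps C := ps_const (x * q ^+ j) - psX * ps_const (q ^- j).
Definition lbd j : ps C := ps_const (q ^- j) - psX * ps_const (y * q ^+ j).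
Local Notation lu j F := (ps_const (kap q x y j) * (if j is i.+1 then F i else 0)).

Lemma evl_L h v j g :
  [/\ evl (Lt q x y o1 o1 * h) v (ncons j g) = la j * evl h v (ncons j g),
      evl (Lt q x y o1 o2 * h) v (ncons j g) = - (psX * evl h v (ncons j.+1 g)),
      evl (Lt q x y o2 o1 * h) v (ncons j g) = lu j (fun i => evl h v (ncons i g)) &
      evl (Lt q x y o2 o2 * h) v (ncons j g) = ld j * evl h v (ncons j g)].
Proof.
rewrite /Lt eqxx o_eqs; split.
- rewrite mulrBl -scalerAl evlD evlN evlZ diagZ !evl_diag /la; ring.
- by rewrite mulNr -scalerAl evlN evlZ evl_down.
- by rewrite evl_uop.
rewrite mulrBl -scalerAl evlD evlN evlZ diagZ !evl_diag /ld; ring.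
Qed.
Lemma evl_Lb h v j g :
  [/\ evl (Lb q x y o1 o1 * h) v (ncons j g) = lba j * evl h v (ncons j g),
      evl (Lb q x y o1 o2 * h) v (ncons j g) = evl h v (ncons j.+1 g),
      evl (Lb q x y o2 o1 * h) v (ncons j g) = - (psX * lu j (fun i => evl h v (ncons i g))) &
      evl (Lb q x y o2 o2 * h) v (ncons j g) = lbd j * evl h v (ncons j g)].
Proof.
rewrite /Lb eqxx o_eqs; split.
- rewrite mulrBl -scalerAl evlD evlN evlZ diagZ !evl_diag /lba; ring.
- by rewrite evl_down.
- by rewrite mulNr -scalerAl evlN evlZ evl_uop.
rewrite mulrBl -scalerAl evlD evlN evlZ diagZ !evl_diag /lbd; ring.
Qed.
End OneFactor.

Section Cons.
Variables (x y : C) (m : option nat) (fs : seq factor).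
Let F : factor := (x, y, m).
Hypothesis V : valid (F :: fs).
Let x0 : x != 0. Proof. by case: V. Qed.
Let y0 : y != 0. Proof. by case: V. Qed.
Let V' : valid fs. Proof. by case: V. Qed.

Let rsE i j : rs (F :: fs) i j =
  \sum_(a < 2) \sum_(b < 2) Lt q x y i a * Lb q x y j b * lps (rs fs a b) :> ps oper.
Proof. exact: s_coef_tensor. Qed.
Let rsbE i j : rsb (F :: fs) i j =
  \sum_(a < 2) \sum_(b < 2) Lb q x y i a * Lt q x y j b * lps (rsb fs a b) :> ps oper.
Proof. exact: sb_coef_tensor. Qed.

Local Notation e i j v g := (evl (rs fs i j) v g).
Local Notation eb i j v g := (evl (rsb fs i j) v g).

(** Entry (1,1) of L S' Lb^t. Coordinate j sees only the slices j, j + 1 and j + 2, which is why a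
    vector killed by s11 can be analysed from its last nonzero slice. *)
Lemma evl_s11 v j g : evl (rs (F :: fs) o1 o1) v (ncons j g)
  = la x j * lba x j * e o1 o1 (slice v j) g + la x j * e o1 o2 (slice v j.+1) g
    - psX * lba x j.+1 * e o2 o1 (slice v j.+1) g - psX * e o2 o2 (slice v j.+2) g.
Proof.
rewrite rsE 3!sum_ord2 !evlD -!mulrA.
have [-> _ _ _] := evl_L x y (Lb q x y o1 o1 * lps (rs fs o1 o1)) v j g.
have [-> _ _ _] := evl_L x y (Lb q x y o1 o2 * lps (rs fs o1 o2)) v j g.
have [_ -> _ _] := evl_L x y (Lb q x y o1 o1 * lps (rs fs o2 o1)) v j g.
have [_ -> _ _] := evl_L x y (Lb q x y o1 o2 * lps (rs fs o2 o2)) v j g.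
have [-> _ _ _] := evl_Lb x y (lps (rs fs o1 o1)) v j g.
have [_ -> _ _] := evl_Lb x y (lps (rs fs o1 o2)) v j g.
have [-> _ _ _] := evl_Lb x y (lps (rs fs o2 o1)) v j.+1 g.
have [_ -> _ _] := evl_Lb x y (lps (rs fs o2 o2)) v j.+1 g.
rewrite !evl_lps; ring.
Qed.

Lemma evl_s21 v j g : evl (rs (F :: fs) o2 o1) v (ncons j g)
  = ps_const (kap q x y j) * (if j is i.+1 then lba x i * e o1 o1 (slice v i) g
                                                + e o1 o2 (slice v j) g else 0)
    + ld y j * lba x j * e o2 o1 (slice v j) g + ld y j * e o2 o2 (slice v j.+1) g.
Proof.
rewrite rsE 3!sum_ord2 !evlD -!mulrA.
have [_ _ -> _] := evl_L x y (Lb q x y o1 o1 * lps (rs fs o1 o1)) v j g.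
have [_ _ -> _] := evl_L x y (Lb q x y o1 o2 * lps (rs fs o1 o2)) v j g.
have [_ _ _ ->] := evl_L x y (Lb q x y o1 o1 * lps (rs fs o2 o1)) v j g.
have [_ _ _ ->] := evl_L x y (Lb q x y o1 o2 * lps (rs fs o2 o2)) v j g.
have [-> _ _ _] := evl_Lb x y (lps (rs fs o2 o1)) v j g.
have [_ -> _ _] := evl_Lb x y (lps (rs fs o2 o2)) v j g.
case: j => [|j]; rewrite !evl_lps; first by ring.
have [-> _ _ _] := evl_Lb x y (lps (rs fs o1 o1)) v j g.
have [_ -> _ _] := evl_Lb x y (lps (rs fs o1 o2)) v j g.
rewrite !evl_lps; ring.
Qed.

Lemma evl_s22 v j g : evl (rs (F :: fs) o2 o2) v (ncons j g)
  = ps_const (kap q x y j) * (if j is i.+1 then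
       lbd y i * e o1 o2 (slice v i) g
       - psX * (ps_const (kap q x y i) * (if i is l.+1 then e o1 o1 (slice v l) g else 0)) else 0)
    - psX * (ld y j * (ps_const (kap q x y j) * (if j is i.+1 then e o2 o1 (slice v i) g else 0)))
    + ld y j * lbd y j * e o2 o2 (slice v j) g.
Proof.
rewrite rsE 3!sum_ord2 !evlD -!mulrA.
have [_ _ -> _] := evl_L x y (Lb q x y o2 o1 * lps (rs fs o1 o1)) v j g.
have [_ _ -> _] := evl_L x y (Lb q x y o2 o2 * lps (rs fs o1 o2)) v j g.
have [_ _ _ ->] := evl_L x y (Lb q x y o2 o1 * lps (rs fs o2 o1)) v j g.
have [_ _ _ ->] := evl_L x y (Lb q x y o2 o2 * lps (rs fs o2 o2)) v j g.
have [_ _ -> _] := evl_Lb x y (lps (rs fs o2 o1)) v j g.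
have [_ _ _ ->] := evl_Lb x y (lps (rs fs o2 o2)) v j g.
case: j => [|j]; rewrite !evl_lps; first by ring.
have [_ _ -> _] := evl_Lb x y (lps (rs fs o1 o1)) v j g.
have [_ _ _ ->] := evl_Lb x y (lps (rs fs o1 o2)) v j g.
case: j => [|j]; rewrite !evl_lps; ring.
Qed.

Lemma evl_sb11 v j g : evl (rsb (F :: fs) o1 o1) v (ncons j g)
  = lba x j * la x j * eb o1 o1 (slice v j) g - psX * lba x j * eb o1 o2 (slice v j.+1) g
    + la x j.+1 * eb o2 o1 (slice v j.+1) g - psX * eb o2 o2 (slice v j.+2) g.
Proof.
rewrite rsbE 3!sum_ord2 !evlD -!mulrA.
have [-> _ _ _] := evl_Lb x y (Lt q x y o1 o1 * lps (rsb fs o1 o1)) v j g.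
have [-> _ _ _] := evl_Lb x y (Lt q x y o1 o2 * lps (rsb fs o1 o2)) v j g.
have [_ -> _ _] := evl_Lb x y (Lt q x y o1 o1 * lps (rsb fs o2 o1)) v j g.
have [_ -> _ _] := evl_Lb x y (Lt q x y o1 o2 * lps (rsb fs o2 o2)) v j g.
have [-> _ _ _] := evl_L x y (lps (rsb fs o1 o1)) v j g.
have [_ -> _ _] := evl_L x y (lps (rsb fs o1 o2)) v j g.
have [-> _ _ _] := evl_L x y (lps (rsb fs o2 o1)) v j.+1 g.
have [_ -> _ _] := evl_L x y (lps (rsb fs o2 o2)) v j.+1 g.
rewrite !evl_lps; ring.
Qed.

Lemma evl_sb21 v j g : evl (rsb (F :: fs) o2 o1) v (ncons j g)
  = - (psX * (ps_const (kap q x y j) * (if j is i.+1 then la x i * eb o1 o1 (slice v i) g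
                                          - psX * eb o1 o2 (slice v j) g else 0)))
    + lbd y j * la x j * eb o2 o1 (slice v j) g - psX * lbd y j * eb o2 o2 (slice v j.+1) g.
Proof.
rewrite rsbE 3!sum_ord2 !evlD -!mulrA.
have [_ _ -> _] := evl_Lb x y (Lt q x y o1 o1 * lps (rsb fs o1 o1)) v j g.
have [_ _ -> _] := evl_Lb x y (Lt q x y o1 o2 * lps (rsb fs o1 o2)) v j g.
have [_ _ _ ->] := evl_Lb x y (Lt q x y o1 o1 * lps (rsb fs o2 o1)) v j g.
have [_ _ _ ->] := evl_Lb x y (Lt q x y o1 o2 * lps (rsb fs o2 o2)) v j g.
have [-> _ _ _] := evl_L x y (lps (rsb fs o2 o1)) v j g.
have [_ -> _ _] := evl_L x y (lps (rsb fs o2 o2)) v j g.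
case: j => [|j]; rewrite !evl_lps; first by ring.
have [-> _ _ _] := evl_L x y (lps (rsb fs o1 o1)) v j g.
have [_ -> _ _] := evl_L x y (lps (rsb fs o1 o2)) v j g.
rewrite !evl_lps; ring.
Qed.
End Cons.
End Representations.

(** * Singular vectors *)

Lemma ps_unit_cancel (f g : ps C) : f 0%N != 0 -> f * g = 0 -> g = 0.
Proof.
move=> f0 E; apply/psP=> n; rewrite ps0; elim/ltn_ind: n => n IH.
have := f_equal (fun h : ps C => h n) E; rewrite /= psM big_ord_recl subn0 ps0 big1 ?addr0.
  by move/eqP; rewrite mulf_eq0 (negPf f0) => /eqP.
move=> i _; rewrite IH ?mulr0 // lift0 ltn_subrL /= (leq_ltn_trans (leq0n i)) //.
Qed.


Section Filtration.
Variables (q : C) (q0 : q != 0).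
Hypothesis hq : forall n : nat, (0 < n)%N -> q ^+ n != 1.
Implicit Types (fs : seq factor) (v : vec) (g : nat -> nat).


Lemma slice_hwv f fs j : slice (hwv (f :: fs)) j = if j is 0%N then hwv fs else 0.
Proof. by case: j. Qed.

Lemma hwv1 fs : hwv fs (fun=> 0%N) = 1.
Proof. by elim: fs => [|f fs IH] //=. Qed.

Lemma evl_hw fs : valid q fs -> forall g,
  [/\ evl (rs q fs o1 o1) (hwv fs) g = 0,
      evl (rs q fs o2 o1) (hwv fs) g = ps_const (hwv fs g) * pser (muP fs),
      evl (rsb q fs o1 o1) (hwv fs) g = 0 &
      evl (rsb q fs o2 o1) (hwv fs) g = ps_const (hwv fs g) * pser (mubP fs)].
Proof.
elim: fs => [|[[x y] m] fs IH] V g.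
  have tE i j : (diag_t oper 1 i j : ps oper) = ps_const ((i == j)%:R *: 1).
    apply/psP=> -[|r]; rewrite /diag_t /diag_val /=; case: (i == j) => //=;
      rewrite ?mul1r ?mul0r ?scale0r //; by case: ifP.
  have E : (psX : ps oper) * 0 = 0 by rewrite mulr0.
  rewrite /rs /rsb /= !s_coefE !sb_coefE !tE !eqxx !o_eqs !scale0r !scale1r rmorph0 rmorph1.
  rewrite !(mulr0, mul0r, mulr1, mul1r) scaler0 !sub0r oppr0 !rmorphN !rmorph1.
  split; apply/psP=> -[|r]; rewrite /evl ?ps0 ?psN //=;
    rewrite ?oper_oppE ?oper_1E ?oper_0E ?oppr0 //.
have [x0 y0 _ V'] := V.
have eg : g = ncons (g 0%N) (fun i => g i.+1) by apply/funext=> -[].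
rewrite eg; move: (g 0%N) (fun i => g i.+1) => j {eg}g.
have [H1 H2 H3 H4] := IH V' g.
have kap0 : kap q x y 0 = 0 by rewrite /kap expr0 invr1 subrr mul0r.
have hj : hwv ((x, y, m) :: fs) (ncons j g) = if j is 0%N then hwv fs g else 0 by case: j.
rewrite hj evl_s11 // evl_s21 // evl_sb11 // evl_sb21 //=.
rewrite !rmorphM !rmorphB /= !rmorph1 -!mul_polyC !rmorphM /= !pserC pserX.
have l0 : [/\ la q x 0 = 1 - psX * ps_const x, ld q y 0 = ps_const y - psX,
    lba q x 0 = ps_const x - psX & lbd q y 0 = 1 - psX * ps_const y].
  by rewrite /la /ld /lba /lbd !expr0 invr1 !mulr1 !rmorph1.
have [l1 l2 l3 l4] := l0.
case: j {hj} => [|[|j]]; rewrite ?sliceK ?slice_hwv ?evl0 ?H1 ?H2 ?H3 ?H4 ?kap0 ?rmorph0 ?l1 ?l2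
  ?l3 ?l4; split; ring.
Qed.


(* The span of the weight vectors of depth less than s. *)
Fixpoint filt fs (s : nat) (v : vec) : Prop :=
  if fs is (_, m) :: fs' then
    (forall j, filt fs' (s - j) (slice v j)) /\
    (forall k j, m = Some k -> (k < j)%N -> slice v j = 0)
  else exists c : C, v = c *: (fun=> 1) /\ (s = 0%N -> c = 0).

Lemma filt_lin fs s : linear_pred (filt fs s).
Proof.
elim: fs s => [|[xy m] fs IH] s.
  split; first by exists 0; rewrite scale0r.
    move=> u v [c [-> Hc]] [d [-> Hd]]; exists (c + d); rewrite scalerDl; split=> // s0.
    by rewrite Hc // Hd // addr0.
  by move=> a v [c [-> Hc]]; exists (a * c); rewrite scalerA; split=> // s0; rewrite Hc // mulr0.
split=> [|u v [Hu Bu] [Hv Bv]|a v [Hv Bv]]; split=> [j|k j Em lt]; rewrite ?sliceD ?sliceZ ?slice0 //.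
- by have [] := IH (s - j)%N.
- by have [_ H _] := IH (s - j)%N; apply: H; [exact: Hu|exact: Hv].
- by rewrite (Bu k) // (Bv k) // addr0.
- by have [_ _ H] := IH (s - j)%N; apply: H; exact: Hv.
by rewrite (Bv k) // scaler0.
Qed.
Lemma filt0 fs s : filt fs s 0. Proof. by have [] := filt_lin fs s. Qed.

Lemma filt_zero fs v : filt fs 0 v -> v = 0.
Proof.
elim: fs v => [|[xy m] fs IH] v; first by move=> [c [-> ->]] //; rewrite scale0r.
by move=> [H _]; apply: slice_inj => j; rewrite slice0; apply: IH; have := H j; rewrite sub0n.
Qed.

Lemma filt_le fs s s' v : (s <= s')%N -> filt fs s v -> filt fs s' v.
Proof.
elim: fs s s' v => [|[xy m] fs IH] s s' v le.
  move=> [c [-> Hc]]; exists c; split=> // s0; apply: Hc; apply/eqP.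
  by rewrite -leqn0 -s0.
by move=> [H B]; split=> // j; apply: (IH (s - j)%N); [exact: leq_sub2r | exact: H].
Qed.

Lemma filt_hwv fs : filt fs 1 (hwv fs).
Proof.
elim: fs => [|[xy m] fs IH]; first by exists 1; rewrite scale1r.
split=> [[|j]|k [|j] _ //]; rewrite slice_hwv //; exact: filt0.
Qed.


(** Two numbers in place of the integer degree a - b. Truncating the subtraction is harmless because
    level 0 of the filtration is zero. *)
Definition shifts fs (a b : nat) (f : oper) : Prop :=
  forall s v, filt fs s v -> filt fs (s + a - b) (f v).

Lemma shifts_lin fs a b : linear_pred (shifts fs a b).
Proof.
split=> [s v _|f h Hf Hh s v Hv|c f Hf s v Hv]; first exact: filt0.
  by have [_ H _] := filt_lin fs (s + a - b); apply: H; [exact: Hf | exact: Hh].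
by have [_ _ H] := filt_lin fs (s + a - b); apply: H; exact: Hf.
Qed.

Lemma shifts_mul fs a b c d f h :
  shifts fs a b f -> shifts fs c d h -> shifts fs (a + c) (b + d) (f * h).
Proof.
move=> Hf Hh s v Hv; rewrite oper_mulE; have {Hh Hv} := Hh _ _ Hv.
have [le|lt] := leqP d (s + c); move=> /[dup] Hv /Hf.
  by rewrite addnC addnBA // -subnDA addnCA (addnC d).
suff -> : h v = 0 by rewrite oper0 => _; exact: filt0.
by apply: (@filt_zero fs); apply: filt_le Hv; rewrite leqn0 subn_eq0 ltnW.
Qed.

Lemma shiftsS fs a b f : shifts fs a.+1 b.+1 f <-> shifts fs a b f.
Proof. by split=> H s v /H; rewrite addnS subSS. Qed.

Definition sshifts fs a b (f : ps oper) : Prop := forall r, shifts fs a b (f r).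

Lemma sshiftsD fs a b f h : sshifts fs a b f -> sshifts fs a b h -> sshifts fs a b (f + h).
Proof. by move=> Hf Hh r; have [_ H _] := shifts_lin fs a b; apply: H; [exact: Hf|exact: Hh]. Qed.
Lemma sshiftsZ fs a b (k : ps C) f : sshifts fs a b f -> sshifts fs a b (k *: f).
Proof. by apply: linear_predZ_ps; exact: shifts_lin. Qed.
Lemma sshiftsN fs a b f : sshifts fs a b f -> sshifts fs a b (- f).
Proof. by move=> Hf r; have [_ _ H] := shifts_lin fs a b; rewrite psN -scaleN1r; apply: H;
  exact: Hf. Qed.
Lemma sshifts_sum fs a b I (r : seq I) (F : I -> ps oper) :
  (forall i, sshifts fs a b (F i)) -> sshifts fs a b (\sum_(i <- r) F i).
Proof.
move=> HF; elim/big_rec: _ => [|i z _ Hz]; last exact: sshiftsD.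
by move=> n; rewrite ps0; have [] := shifts_lin fs a b.
Qed.
Lemma sshifts_mul fs a b c d f h :
  sshifts fs a b f -> sshifts fs c d h -> sshifts fs (a + c) (b + d) (f * h).
Proof.
move=> Hf Hh r; rewrite psM; apply: linear_pred_sum; first exact: shifts_lin.
by move=> i; apply: shifts_mul; [exact: Hf | exact: Hh].
Qed.
Lemma sshifts_const fs a b f : shifts fs a b f -> sshifts fs a b (ps_const f).
Proof. by move=> Hf [|r] //=; have [] := shifts_lin fs a b. Qed.

Section ConsShifts.
Variables (x y : C) (m : option nat) (fs : seq factor).
Let F : factor := (x, y, m).
Hypothesis V : valid q (F :: fs).

Lemma shifts_diag a : shifts (F :: fs) 0 0 (diag_op a).
Proof.
move=> s v [H B]; split=> [j|k j Em lt]; rewrite slice_diag.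
  rewrite addn0 subn0.
  by have [_ _ HZ] := filt_lin fs (s - j); apply: HZ; exact: H.
by rewrite (B k) // scaler0.
Qed.
Lemma shifts_dop : shifts (F :: fs) 0 1 dop.
Proof.
move=> s v [H B]; split=> [j|k j Em lt]; rewrite slice_down.
  by rewrite addn0 -subnDA; exact: H.
by apply: (B k) => //; exact: ltnW.
Qed.
Lemma shifts_uop : shifts (F :: fs) 1 0 (uop q x y).
Proof.
move=> s v [H B]; split=> [[|j]|k [|j] Em lt] //; rewrite slice_diag slice_up.
- by rewrite scaler0; exact: filt0.
- rewrite subn0 addn1 subSS; have [_ _ HZ] := filt_lin fs (s - j); apply: HZ; exact: H.
(* The string could be left only through slice k + 1, and there [kap] vanishes because x y q^(2k) =
   1. *)
move: lt; rewrite ltnS leq_eqVlt => /orP[/eqP <-|lt]; last by rewrite (B k) // scaler0.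
have E : x * y * q ^+ (2 * k) = 1 by have [_ _ VH _] := V; exact: VH.
suff -> : kap q x y k.+1 = 0 by rewrite scale0r.
rewrite /kap.
have -> : q * q ^- k.+1 - x * y * q^-1 * q ^+ k.+1 = q ^- k * (1 - x * y * q ^+ (2 * k)).
  by rewrite mul2n -addnn exprD !exprS; field; rewrite q0 expf_neq0.
by rewrite E subrr !mulr0.
Qed.
Lemma shifts_lift a b f : shifts fs a b f -> shifts (F :: fs) a b (lift_op f).
Proof.
move=> Hf s v [H B]; split=> [j|k j Em lt]; rewrite slice_lift; last by rewrite (B k) // oper0.
have [le|lt] := leqP j s.
  by rewrite subnAC -addnBAC //; apply: (Hf); exact: H.
suff -> : slice v j = 0 by rewrite oper0; exact: filt0.
by apply: (@filt_zero fs); apply: filt_le (H j); rewrite leqn0 subn_eq0 ltnW.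
Qed.

Lemma sshifts_Lt i j : sshifts (F :: fs) (i == o2) (j == o2) (Lt q x y i j).
Proof.
rewrite /Lt; case: (ord2P i) => ->; case: (ord2P j) => ->; rewrite ?eqxx ?o_eqs.
- apply: sshiftsD; last apply/sshiftsN/sshiftsZ; apply: sshifts_const;
  by rewrite ?diagZ; exact: shifts_diag.
- by apply/sshiftsN/sshiftsZ/sshifts_const; exact: shifts_dop.
- by apply: sshifts_const; exact: shifts_uop.
move=> r; apply/shiftsS; move: r; apply: sshiftsD; last apply/sshiftsN/sshiftsZ; apply: sshifts_const;
  by rewrite ?diagZ; exact: shifts_diag.
Qed.
Lemma sshifts_Lb i j : sshifts (F :: fs) (i == o2) (j == o2) (Lb q x y i j).
Proof.
rewrite /Lb; case: (ord2P i) => ->; case: (ord2P j) => ->; rewrite ?eqxx ?o_eqs.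
- apply: sshiftsD; last apply/sshiftsN/sshiftsZ; apply: sshifts_const;
  by rewrite ?diagZ; exact: shifts_diag.
- by apply: sshifts_const; exact: shifts_dop.
- by apply/sshiftsN/sshiftsZ/sshifts_const; exact: shifts_uop.
move=> r; apply/shiftsS; move: r; apply: sshiftsD; last apply/sshiftsN/sshiftsZ.
  by apply: sshifts_const; exact: shifts_diag.
by rewrite diagZ; apply: sshifts_const; exact: shifts_diag.
Qed.
Lemma sshifts_LM a b c (L f : ps oper) : sshifts (F :: fs) a b L -> sshifts fs b c f ->
  sshifts (F :: fs) a c (L * lps f).
Proof.
move=> HL Hf r; suff: shifts (F :: fs) (a + b) (b + c) ((L * lps f) r).
  by elim: b {HL Hf} => [|b IH]; rewrite ?addn0 // addnS addSn => /shiftsS.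
by apply: sshifts_mul => // n; apply: shifts_lift; exact: Hf.
Qed.
End ConsShifts.

Lemma sshifts_rep fs : valid q fs -> forall i j,
  sshifts fs (i == o2) (j == o2) (rep_t q fs i j) /\ sshifts fs (i == o2) (j == o2) (rep_tb q fs i j).
Proof.
elim: fs => [|[[x y] m] fs IH] V i j.
  suff H : sshifts [::] (i == o2) (j == o2) (rep_t q [::] i j) by [].
  move=> r; rewrite /= /diag_t /diag_val; case: (i =P j) => [->|_]; last first.
    by rewrite scale0r; have [] := shifts_lin [::] (i == o2) (j == o2).
  have [_ _ HZ] := shifts_lin [::] (j == o2) (j == o2); apply: (HZ) => s v.
  by rewrite addnK.
have [_ _ _ V'] := V; split; rewrite /= /tensor_t /tensor_tb; apply: sshifts_sum => a;
 have [H1 H2] := IH V' a j.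
  by apply: (@sshifts_LM x y m fs _ (a == o2)); [exact: sshifts_Lt | exact: H1].
by apply: (@sshifts_LM x y m fs _ (a == o2)); [exact: sshifts_Lb | exact: H2].
Qed.

(** In T and Tb a row index 2 raises the depth and a column index 2 lowers it. Both indices of S are
    row indices, and each term of S contains exactly one column index 2. So s11 lowers the depth by
    one. *)
Lemma sshifts_rs fs : valid q fs -> forall i j, sshifts fs ((i == o2) + (j == o2)) 1 (rs q fs i j).
Proof.
move=> V i j; rewrite /rs s_coefE; have R := sshifts_rep V.
apply: sshiftsD; first apply: sshiftsZ; last apply: sshiftsN.
  by apply: (@sshifts_mul _ _ 0 _ 1); [have [] := R i o1 | have [] := R j o2].
by apply: (@sshifts_mul _ _ 1 _ 0); [have [] := R i o2 | have [] := R j o1].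
Qed.

Lemma shifts_s12inv fs : valid q fs -> shifts fs 0 0 (s12inv q (rep_ti q fs) (rep_tbi q fs)).
Proof.
elim: fs => [|[[x y] m] fs IH] V.
  rewrite /s12inv /= /diag_ti -scalerAl -scalerAr !scalerA mul1r.
  have [_ _ HZ] := shifts_lin [::] 0 0; apply: (HZ) => s v.
  by rewrite addn0 subn0.
have [_ _ _ V'] := V; rewrite /= s12inv_tensor.
apply: (@shifts_mul _ 0 0 0 0); first exact: shifts_diag.
by apply: (shifts_lift); exact: IH.
Qed.

Definition in_filt fs v : Prop := exists s, filt fs s v.

Lemma Yq_filt fs f : valid q fs -> Yq q (rep_t q fs) (rep_tb q fs) (rep_ti q fs) (rep_tbi q fs) f ->
  forall v, in_filt fs v -> in_filt fs (f v).
Proof.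
move=> V Hf; apply: (Hf (fun f => forall v, in_filt fs v -> in_filt fs (f v))) => {f Hf}.
- split=> [//|f1 f2 H1 H2 v Hv|c f1 H1 v Hv|f1 f2 H1 H2 v Hv]; last by apply: H1; exact: H2.
    have [s1 {}H1] := H1 v Hv; have [s2 {}H2] := H2 v Hv; exists (s1 + s2)%N.
    have [_ HD _] := filt_lin fs (s1 + s2); apply: HD.
      exact: filt_le (leq_addr _ _) H1.
    exact: filt_le (leq_addl _ _) H2.
  have [s {}H1] := H1 v Hv; exists s; have [_ _ HZ] := filt_lin fs s; exact: HZ.
- by move=> i j r v [s Hv]; eexists; exact: (sshifts_rs V i j r Hv).
by move=> v [s Hv]; eexists; exact: (shifts_s12inv V Hv).
Qed.
End Filtration.

Section Polynomial.
Variable R : nzRingType.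
Implicit Types f g : ps R.
(** Needed because [no_lowering_poly] evaluates at nonzero complex numbers, which has a meaning for
    polynomials but not for formal series. *)
Definition pol f : Prop := exists N, forall n, (N <= n)%N -> f n = 0.

Lemma pol_const a : pol (ps_const a). Proof. by exists 1%N => -[]. Qed.
Lemma polX : pol (psX : ps R).
Proof. by exists 2 => -[|[|n]] //. Qed.
Lemma polD f g : pol f -> pol g -> pol (f + g).
Proof.
move=> [N HN] [M HM]; exists (N + M)%N => n le; rewrite psD HN ?HM ?addr0 //.
  exact: leq_trans (leq_addl _ _) le.
exact: leq_trans (leq_addr _ _) le.
Qed.
Lemma polN f : pol f -> pol (- f).
Proof. by move=> [N HN]; exists N => n le; rewrite psN HN ?oppr0. Qed.
Lemma polM f g : pol f -> pol g -> pol (f * g).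
Proof.
move=> [N HN] [M HM]; exists (N + M)%N => n le; rewrite psM big1 // => i _.
have [lt|/HN ->] := ltnP i N; last by rewrite mul0r.
rewrite HM ?mulr0 // leq_subRL -1?ltnS //; apply: leq_trans le.
by rewrite leq_add2r ltnW.
Qed.
Lemma pol_sum I (r : seq I) (F : I -> ps R) : (forall i, pol (F i)) -> pol (\sum_(i <- r) F i).
Proof.
move=> HF; elim/big_rec: _ => [|i x _ Hx]; last exact: polD.
by exists 0%N => n _; rewrite ps0.
Qed.
End Polynomial.

Lemma polZ (A : algType C) (k : ps C) (f : ps A) : pol k -> pol f -> pol (k *: f).
Proof.
move=> [N HN] Hf; rewrite -mulr_algl; apply: polM => //; exists N => n le.
rewrite psZ big1 // => i _; case E: (n - i)%N => [|j]; last by rewrite /= scaler0.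
by rewrite HN ?scale0r // (leq_trans le) // -subn_eq0 E.
Qed.

Section NoSingular.
Variables (q : C) (q0 : q != 0).
Hypothesis hq : forall n : nat, (0 < n)%N -> q ^+ n != 1.
Implicit Types (fs : seq factor) (v : vec) (g : nat -> nat).

Lemma pol_Lt x y i j : pol (Lt q x y i j) /\ pol (Lb q x y i j).
Proof.
have L := @polX C; have K := @pol_const oper.
by rewrite /Lt /Lb; case: ifP => _; case: ifP => _; split;
   do ?[apply: polD | apply: polN | apply: polZ].
Qed.

Lemma pol_rep fs i j : pol (rep_t q fs i j : ps oper) /\ pol (rep_tb q fs i j : ps oper).
Proof.
elim: fs i j => [|[[x y] m] fs IH] i j.
  by split; exists 1%N => -[|n] // _; rewrite /= /diag_t /diag_val mul0r; case: ifP; rewrite scale0r.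
by split; rewrite /= /tensor_t /tensor_tb; apply: pol_sum => a;
  have [H1 H2] := pol_Lt x y i a; have [[N HN] [M HM]] := IH a j; apply: polM => //;
  [exists N => n le; rewrite /lps HN // raddf0 | exists M => n le; rewrite /lps HM // raddf0].
Qed.

Lemma pol_evl (f : ps oper) v g : pol f -> exists p, evl f v g = pser p.
Proof.
move=> [N HN]; exists (\poly_(i < N) f i v g); apply/psP=> n; rewrite /pser coef_poly.
by case: ltnP => [//|/HN E]; rewrite /evl E.
Qed.

Lemma pol_rs fs i j : pol (rs q fs i j : ps oper).
Proof.
rewrite /rs s_coefE; have R := pol_rep fs.
apply: polD; first apply: polZ; first exact: pol_const; last apply: polN.
  by apply: polM; [have [] := R i o1 | have [] := R j o2].
by apply: polM; [have [] := R i o2 | have [] := R j o1].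
Qed.

(* The top of the string of each factor must be reached before it meets a parameter of a later one. *)
Fixpoint ns fs : Prop :=
  if fs is f :: fs' then
    (forall f', f' \in fs' -> forall j, (forall k, f.2 = Some k -> (j < k)%N) ->
       f'.1.1 * f.1.1 * q ^+ (2 * j) != 1 /\ f'.1.2 * f.1.1 * q ^+ (2 * j) != 1) /\ ns fs'
  else True.

Lemma muP_root fs (w : C) : (forall f, f \in fs -> f.1.1 != w /\ f.1.2 != w) -> (muP fs).[w] != 0.
Proof.
elim: fs => [|[[x y] m] fs IH] H; first by rewrite !hornerE oppr_eq0 oner_eq0.
have [/= Hx Hy] := H _ (mem_head _ _).
rewrite /= !hornerE !mulf_neq0 ?subr_eq0 //; apply: IH => f Hf; apply: H.
by rewrite inE Hf orbT.
Qed.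

Lemma mubP_inv fs (w : C) : w != 0 -> (mubP fs).[w^-1] * w ^+ (2 * size fs) = (muP fs).[w].
Proof.
move=> w0; elim: fs => [|[[x y] m] fs IH] /=; first by rewrite muln0 !hornerE.
by rewrite !hornerE -IH mulnS exprD; field.
Qed.

Lemma evl_s12_hw fs : valid q fs -> (psX ^+ 2 - 1) * evl (rs q fs o1 o2) (hwv fs) (fun=> 0%N)
  = ps_const q * (1 - ps_const (q ^- 2) * psX ^+ 2) * pser (mubP fs)
    + ps_const (q^-1 - q) * psX ^+ 2 * pser (muP fs).
Proof.
move=> V; have := f_equal (fun f => evl f (hwv fs) (fun=> 0%N)) (smat_bar q0 (rep_rels q0 V)).
rewrite !evlZ; have [_ E2 _ E4] := evl_hw V (fun=> 0%N).
rewrite (evlD _ (- _)) evlN !evlZ.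
rewrite -/(rs q fs o2 o1) -/(rsb q fs o2 o1) -/(rs q fs o1 o2) E2 E4 hwv1 rmorph1 !mul1r.
have QI : ps_const q * ps_const q^-1 = 1 by rewrite -rmorphM mulfV ?rmorph1.
move: (evl _ _ _) => S E.
have -> : (psX ^+ 2 - 1) * S = ps_const q * (ps_const q^-1 * ((psX ^+ 2 - 1) * S
   - ps_const (q^-1 - q) * psX ^+ 2 * pser (muP fs))) + ps_const (q^-1 - q) * psX ^+ 2 * pser (muP
     fs).
  by rewrite mulrA QI mul1r subrK.
by rewrite -E mulrA.
Qed.

(* Evaluate at w = a / b, the common zero of the left side and of one term on the right; if
   w ^+ 2 = q ^+ 2 use the zero w^-1 of the other factor, and if w ^+ 2 = 1 the two linear factors
   are proportional and can be cancelled first. *)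
Lemma no_lowering_poly (a b c : C) (F M Mb : {poly C}) (n : nat) : a != 0 -> b != 0 -> c != 0 ->
  ('X^2 - 1) * (a%:P - b *: 'X) * (b%:P - a *: 'X) * F
    = c *: ((q%:P - q^-1 *: 'X^2) * ((a%:P - b *: 'X) * Mb + 'X * (b%:P - a *: 'X) * M)) ->
  M.[a / b] != 0 -> Mb.[(a / b)^-1] * (a / b) ^+ (2 * n) = M.[a / b] -> False.
Proof.
move=> a0 b0 c0; set w := a / b => E M0 HM.
have w0 : w != 0 by rewrite mulf_neq0 ?invr_eq0.
have wb : w * b = a by rewrite /w divfK.
clearbody w.
have q2 : q ^+ 2 != 1 by exact: hq.
have q4 : q ^+ 4 != 1 by exact: hq.
have Mb0 : Mb.[w^-1] != 0 by apply: contra_neq M0 => M0; rewrite -HM M0 mul0r.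
have Ew z : (z ^+ 2 - 1) * (a - b * z) * (b - a * z) * F.[z]
   = c * ((q - q^-1 * z ^+ 2) * ((a - b * z) * Mb.[z] + z * (b - a * z) * M.[z])).
  by have := f_equal (horner^~ z) E; rewrite !hornerE.
have [w1|w1] := eqVneq (w ^+ 2) 1; last first.
  have [wq|wq] := eqVneq (w ^+ 2) (q ^+ 2).
    have := Ew w^-1; rewrite -wb (_ : b - w * b * w^-1 = 0); last by field.
    rewrite mulr0 !mul0r mulr0 mul0r addr0 => /esym/eqP.
    have -> : q - q^-1 * w^-1 ^+ 2 = (q ^+ 4 - 1) / q ^+ 3 by rewrite exprVn wq; field.
    have -> : w * b - b * w^-1 = b * (w ^+ 2 - 1) / w by field.
    rewrite !mulf_eq0 !invr_eq0 !subr_eq0 (negPf c0) (negPf q4) (negPf b0) (negPf w0) (negPf w1).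
    by rewrite (negPf Mb0) expf_eq0 (negPf q0).
  have := Ew w; rewrite -wb (_ : w * b - b * w = 0); last by ring.
  rewrite mulr0 !mul0r add0r => /esym/eqP.
  have -> : b - w * b * w = b * (1 - w ^+ 2) by ring.
  have -> : q - q^-1 * w ^+ 2 = (q ^+ 2 - w ^+ 2) / q by field.
  rewrite !mulf_eq0 !invr_eq0 !subr_eq0 (negPf c0) eq_sym (negPf wq) (negPf b0) (negPf w0).
  by rewrite (negPf q0) eq_sym (negPf w1) (negPf M0).
have wV : w^-1 = w by apply: (mulfI w0); rewrite divff // -expr2.
have {}E : ('X^2 - 1) * (b%:P - a *: 'X) * F
    = c *: ((q%:P - q^-1 *: 'X^2) * (Mb + w *: ('X * M))).
  apply: (@mulfI _ (a%:P - b *: 'X)).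
    by apply/eqP=> /(f_equal (horner^~ 0)); rewrite !hornerE subr0 => /eqP; rewrite (negPf a0).
  have E2 : b%:P - a *: 'X = w *: (a%:P - b *: 'X).
    rewrite -wb scalerBr scalerA scale_polyC mulrA -expr2 w1 mul1r; congr (_ - _).
  transitivity (('X^2 - 1) * (a%:P - b *: 'X) * (b%:P - a *: 'X) * F); first by ring.
  by rewrite E E2 -!mul_polyC; ring.
have {}E : (w ^+ 2 - 1) * (b - a * w) * F.[w] = c * ((q - q^-1 * w ^+ 2) * (Mb.[w] + w * (w *
  M.[w]))).
  by have := f_equal (horner^~ w) E; rewrite !hornerE.
move: E; rewrite -HM wV exprM w1 expr1n !mulr1 (mulrA w w) -expr2 w1 mul1r subrr !mul0r => /esym/eqP.
have -> : q - q^-1 = (q ^+ 2 - 1) / q by field.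
rewrite -mulr2n -mulr_natr !mulf_eq0 invr_eq0 subr_eq0 (negPf c0) (negPf q2) (negPf q0).
by move: Mb0; rewrite wV pnatr_eq0 => /negPf ->.
Qed.

Lemma filt_slice0 f fs s v : filt (f :: fs) s v -> forall j, (s <= j)%N -> slice v j = 0.
Proof.
case: f => [[x y] m] [H _] j le; apply: (@filt_zero fs); have := H j.
by have /eqP -> : (s - j)%N == 0%N by rewrite subn_eq0.
Qed.

Lemma abs_lowering (K : comNzRingType) (X a b c Q I F S M Mb : K) : Q * I = 1 ->
  (X ^+ 2 - 1) * S = Q * (1 - I ^+ 2 * X ^+ 2) * Mb + (I - Q) * X ^+ 2 * M ->
  (a - X * b) * (b - X * a) * F + (a - X * b) * (c * S) - X * (Q * b - X * (I * a)) * (c * M) = 0 ->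
  (X * X - 1) * (a - b * X) * (b - a * X) * F
    = - c * ((Q - I * (X * X)) * ((a - b * X) * Mb + X * (b - a * X) * M)).
Proof.
move=> QI HS H.
transitivity ((X ^+ 2 - 1) * ((a - X * b) * (b - X * a) * F + (a - X * b) * (c * S)
    - X * (Q * b - X * (I * a)) * (c * M)) - c * (a - X * b) * ((X ^+ 2 - 1) * S)
    + X * (X ^+ 2 - 1) * (Q * b - X * (I * a)) * (c * M)); first by ring.
have -> : (X ^+ 2 - 1) * S = (Q - Q * I * I * X ^+ 2) * Mb + (I - Q) * X ^+ 2 * M by rewrite HS; ring.
by rewrite H QI; ring.
Qed.

(** Let p be the index of the last nonzero slice of v. Coordinate p of s11 v = 0 says that this
    slice is killed by s11 of the remaining factors, so by induction it is a multiple of their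
    highest vector. If p > 0, coordinate p - 1 gives an identity excluded by [no_lowering_poly],
    where [ns] ensures that [muP] does not vanish at 1/(x q^(2(p - 1))). *)
Lemma no_singular fs : valid q fs -> ns fs -> forall s v, filt fs s v ->
  (forall r, rs q fs o1 o1 r v = 0) -> exists c : C, v = c *: hwv fs.
Proof.
elim: fs => [|[[x y] m] fs IH] V NS s v Fv sv; first by case: Fv => c [-> _]; exists c.
have [x0 y0 _ V'] := V; have [NS1 NS'] := NS.
have [Fv1 Fv2] := Fv.
have slice_s := filt_slice0 Fv.
have [v0|nz] := eqVneq v 0; first by exists 0; rewrite scale0r.
have [p [vp vgt]] : exists p, slice v p != 0 /\ forall j, (p < j)%N -> slice v j = 0.
  have ex : exists p, slice v p != 0.
    apply: contrapT => /forallNP H; move/eqP: nz; apply; apply: slice_inj => j; rewrite slice0.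
    by apply/eqP; apply: contrapT => /negP; exact: H.
  have bd p : slice v p != 0 -> (p <= s)%N.
    by move=> nzp; rewrite leqNgt; apply: contra nzp => /ltnW /slice_s ->.
  have [p nzp max] := ex_maxnP ex bd; exists p; split=> // j lt.
  by apply/eqP; apply: contraTT lt => /max; rewrite -leqNgt.
have E j g : evl (rs q ((x, y, m) :: fs) o1 o1) v (ncons j g) = 0.
  by apply/psP=> r; rewrite /evl sv ps0.
have la0 j : la q x j 0%N != 0.
  by rewrite /la psD psN psM0 [psX _]/= mul0r subr0 invr_eq0 expf_neq0.
have lba0 j : lba q x j 0%N != 0.
  by rewrite /lba psD psN psM0 [psX _]/= mul0r subr0 mulf_neq0 ?expf_neq0.
have [c Hc] : exists c : C, slice v p = c *: hwv fs.
  apply: (IH V' NS' (s - p)%N _ (Fv1 p)) => r; apply/funext=> g.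
  have := E p g; rewrite evl_s11 // !(vgt p.+1) // (vgt p.+2) ?ltnS ?leqnSn //.
  rewrite !evl0 !mulr0 addr0 !subr0 -mulrA => /(ps_unit_cancel (la0 p)) /(ps_unit_cancel (lba0 p)).
  by move/(f_equal (fun f : ps C => f r)); rewrite ps0.
have c0 : c != 0 by apply: contraNneq vp => c0; rewrite Hc c0 scale0r.
case: p vp vgt Hc => [|p] vp vgt Hc.
  exists c; apply: slice_inj => -[|j]; first by rewrite Hc.
  by rewrite vgt // sliceZ slice_hwv scaler0.
exfalso.
(* From here on the last nonzero slice is p + 1; it lies inside the string, so p is one of the
   indices about which [ns] speaks. *)
have lt k : m = Some k -> (p < k)%N.
  by move=> Em; rewrite ltnNge; apply: contra vp => le; rewrite (Fv2 k).
have := E p (fun=> 0%N); rewrite evl_s11 // (vgt p.+2) // Hc evl0 !evl_scale.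
have [F ->] := pol_evl (slice v p) (fun=> 0%N) (pol_rs fs o1 o1).
have [_ -> _ _] := evl_hw V' (fun=> 0%N); rewrite hwv1 rmorph1 mul1r.
have := evl_s12_hw V'; move: (evl _ _ _) => S HS HE.
set A := ps_const (q ^- p); set B := ps_const (x * q ^+ p).
have lE : [/\ la q x p = A - psX * B, lba q x p = B - psX * A
  & lba q x p.+1 = ps_const q * B - psX * (ps_const q^-1 * A)].
  by split=> //; rewrite /A /B -!rmorphM /lba !exprS; congr (ps_const _ - psX * ps_const _); field;
    rewrite ?q0 ?expf_neq0.
have [E1 E2 E3] := lE; rewrite E1 E2 E3 mulr0 subr0 in HE.
have aE : ps_const (q ^- p) = A by []; have bE : ps_const (x * q ^+ p) = B by [].
clearbody A B.
have a0 : q ^- p != 0 by rewrite invr_eq0 expf_neq0.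
have b0 : x * q ^+ p != 0 by rewrite mulf_neq0 ?expf_neq0.
have wE : q ^- p / (x * q ^+ p) * x * q ^+ (2 * p) = 1.
  by rewrite mul2n -addnn exprD; field; rewrite x0 expf_neq0.
move: (q ^- p) (x * q ^+ p) aE bE a0 b0 wE => a b aE bE a0 b0 wE.
apply: (@no_lowering_poly a b (- c) F (muP fs) (mubP fs) (size fs)) => //.
- by rewrite oppr_eq0.
- apply: pser_inj; rewrite -!mul_polyC !(rmorphM, rmorphB, rmorphD, rmorph1, rmorphN) /= !pserC
  pserX aE bE.
  have QI : ps_const q * ps_const q^-1 = 1 by rewrite -rmorphM mulfV ?rmorph1.
  apply: (@abs_lowering _ psX A B (ps_const c) _ _ (pser F) S _ _ QI).
    by rewrite HS -exprVn rmorphXn rmorphB.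
  by rewrite -HE.
- apply: muP_root => f' Hf'; have [/= N1 N2] := NS1 _ Hf' p lt.
  by split; [apply: contra_neq N1 => -> | apply: contra_neq N2 => ->].
by rewrite mubP_inv // mulf_neq0 // invr_eq0.
Qed.
End NoSingular.

Section Generation.
Variables (q : C) (q0 : q != 0).
Hypothesis hq : forall n : nat, (0 < n)%N -> q ^+ n != 1.
Implicit Types (fs : seq factor) (v : vec).
Local Notation Yr fs := (Yq q (rep_t q fs) (rep_tb q fs) (rep_ti q fs) (rep_tbi q fs)).

Lemma hwv_neq0 fs : hwv fs != 0.
Proof. by apply/eqP=> /(f_equal (fun v : vec => v (fun=> 0%N))) /eqP; rewrite hwv1 oner_eq0. Qed.

(** Induction on the depth: unless v is already a multiple of the highest vector, some coefficient
    of s11 sends it to a nonzero vector of smaller depth. *)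
Lemma generates_hwv fs : valid q fs -> ns q fs -> forall v, in_filt fs v -> v != 0 ->
  exists f, Yr fs f /\ f v = hwv fs.
Proof.
move=> V NS v [s]; elim/ltn_ind: s v => s IH v Fv nz.
have [/(no_singular q0 hq V NS Fv) [c Ec]|/existsNP [r /eqP nzr]] := EM (forall r, rs q fs o1 o1 r
  v = 0).
  have c0 : c != 0 by apply: contra_neq nz => c0; rewrite Ec c0 scale0r.
  exists (c^-1 *: 1); split; first by apply: YqZ; exact: Yq1.
  by rewrite oper_scaleE Ec scalerA mulVf // scale1r.
have s0 : (0 < s)%N.
  rewrite lt0n; apply: contraNneq nz => s0; apply/eqP; apply: (@filt_zero fs); by rewrite -s0.
have H : filt fs (s + 0 - 1) (rs q fs o1 o1 r v) by exact: (sshifts_rs q0 V o1 o1 r).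
have [|f [Yf E]] := IH _ _ _ H nzr; first by rewrite addn0 subn1 ltn_predL.
by exists (f * rs q fs o1 o1 r); split=> //; apply: YqM => //; exact: Yq_s.
Qed.

Lemma mubP0 fs : (mubP fs)`_0 = -1.
Proof.
rewrite -horner_coef0; elim: fs => [|f fs IH] /=; first by rewrite !hornerE.
by rewrite !hornerE IH ?subr0 ?mulr1 ?mul1r.
Qed.

Lemma s12_hwv fs : valid q fs -> rs q fs o1 o2 0%N (hwv fs) = q *: hwv fs.
Proof.
move=> V; apply/funext=> g.
have := f_equal (fun f => evl f (hwv fs) g 0%N) (smat_bar q0 (rep_rels q0 V)).
have [_ _ _ E] := evl_hw V g.
rewrite !evlZ (evlD _ (- _)) evlN !evlZ -/(rs q fs o2 o1) -/(rsb q fs o2 o1) -/(rs q fs o1 o2) E.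
rewrite psM0 psD psN (expr2 psX) 2!psM0 [psX _]/= !mulr0 subr0 !mul1r psM0.
rewrite psC_mul psD psN psM0 psD psN !psM0 [psX _]/= !(mulr0, mul0r) subr0 sub0r mulN1r.
rewrite /pser mubP0 [ps_const _ _]/= mulrN1 mulrN => /oppr_inj E1.
by rewrite vecZ E1 mulVKf.
Qed.

Lemma b0_slice x y m fs v j :
  slice (rs q ((x, y, m) :: fs) o2 o2 0%N v) j =
    (if j is i.+1 then (kap q x y j * q ^- i) *: rs q fs o1 o2 0%N (slice v i) else 0)
    + y *: rs q fs o2 o2 0%N (slice v j).
Proof.
apply/funext=> g; have := f_equal (fun f : ps C => f 0%N) (@evl_s22 q x y m fs v j g).
have ld0 i : ld q y i 0%N = y * q ^+ i by rewrite /ld psD psN psM0 [psX _]/= mul0r subr0.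
have lbd0 i : lbd q y i 0%N = q ^- i by rewrite /lbd psD psN psM0 [psX _]/= mul0r subr0.
rewrite psD psD psN psM0 psM0 !psM0 ld0 lbd0 [psX _]/= mul0r subr0 mulfK ?expf_neq0 // => E;
  apply: (etrans E) => {E}.
case: j => [|i]; first by rewrite mulr0.
by rewrite vecD !vecZ psD psN !psM0 lbd0 [psX _]/= mul0r subr0 mulrA.
Qed.

Definition free_factor (f : factor) : Prop := forall j, f.1.1 * f.1.2 * q ^+ (2 * j) != 1.

(** If the first factor is free, slice k of the k-th power is the highest vector of the other
    factors times nonzero scalars, among them values of [kap]. Otherwise slice 0 is y^k times the
    corresponding vector for the other factors. *)
Lemma b0_pow_hwv fs : valid q fs -> (exists2 f, f \in fs & free_factor f) ->
  forall k, (rs q fs o2 o2 0%N ^+ k) (hwv fs) != 0.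
Proof.
elim: fs => [|[[x y] m] fs IH] V [f] //; have [x0 y0 _ V'] := V.
rewrite inE => /orP[/eqP -> {f} /= fr|Hf frf] k; last first.
  suff E : slice ((rs q ((x, y, m) :: fs) o2 o2 0%N ^+ k) (hwv ((x, y, m) :: fs))) 0
      = y ^+ k *: (rs q fs o2 o2 0%N ^+ k) (hwv fs).
    apply/eqP=> E0; move: E; rewrite E0 slice0 => /esym/eqP;
      rewrite scaler_eq0 expf_eq0 (negPf y0) andbF /=.
    by apply/negP; apply: IH => //; exists f.
  elim: k => [|k IHk]; first by rewrite !expr0 scale1r.
  by rewrite !exprS !oper_mulE b0_slice IHk add0r operZ !scalerA.
suff [_ [c [c0 E]]] : (forall j, (k < j)%N ->
    slice ((rs q ((x, y, m) :: fs) o2 o2 0%N ^+ k) (hwv ((x, y, m) :: fs))) j = 0) /\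
    exists c : C, c != 0 /\
    slice ((rs q ((x, y, m) :: fs) o2 o2 0%N ^+ k) (hwv ((x, y, m) :: fs))) k = c *: hwv fs.
  apply/eqP=> E0; move: E; rewrite E0 slice0 => /esym/eqP.
  by rewrite scaler_eq0 (negPf c0) (negPf (hwv_neq0 fs)).
elim: k => [|k [IH1 [c [c0 IH2]]]].
  rewrite expr0 oper_1E; split=> [[|j] //|].
  by exists 1; split; [exact: oner_neq0 | rewrite slice_hwv scale1r].
rewrite exprS oper_mulE; split=> [[|j] // lt|].
  by rewrite b0_slice !IH1 ?oper0 ?scaler0 ?addr0 // ltnW.
exists (kap q x y k.+1 * q ^- k * (c * q)); split; last first.
  by rewrite b0_slice IH2 IH1 // oper0 scaler0 addr0 operZ s12_hwv // !scalerA !mulrA.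
have -> : kap q x y k.+1 = (1 - q ^+ (2 * k.+1)) / q ^+ k.+1 * (1 - x * y * q ^+ (2 * k)) / q ^+ k.
  rewrite /kap !mul2n -!addnn !exprD !exprS; field; rewrite ?q0 ?expf_neq0 //.
rewrite !mulf_neq0 ?invr_eq0 ?expf_neq0 // subr_eq0 eq_sym //; exact: hq.
Qed.
End Generation.

(** * Finite spanning sets modulo a subspace *)

Section Span.
Fixpoint spanmod (V : lmodType C) (L : V -> Prop) (l : seq V) (v : V) : Prop :=
  if l is w :: l' then exists c : C, spanmod L l' (v - c *: w) else L v.

Lemma spanmod_coef (V : lmodType C) (L : V -> Prop) l v : spanmod L l v ->
  exists c : 'I_(size l) -> C, L (v - \sum_(k < size l) c k *: l`_k).
Proof.
elim: l v => [|w l IH] v /=; first by move=> Lv; exists (fun=> 0); rewrite big_ord0 subr0.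
move=> [c /IH [d Hd]]; exists (fun k => if unlift ord0 k is Some i then d i else c).
rewrite big_ord_recl unlift_none opprD addrA.
by under eq_bigr => i _ do rewrite liftK.
Qed.

Lemma spanmod_lin (V : lmodType C) (L : V -> Prop) l : linear_pred L -> linear_pred (spanmod L l).
Proof.
elim: l => [//|w l IH] /IH {IH} [S0 SD SZ]; split=> /=.
- by exists 0; rewrite scale0r subr0.
- by move=> u v [c Hc] [d Hd]; exists (c + d); rewrite scalerDl opprD addrACA; exact: SD.
by move=> a v [c Hc]; exists (a * c); rewrite -scalerA -scalerBr; exact: SZ.
Qed.

Lemma spanmod_weaken (V : lmodType C) (L L' : V -> Prop) l v :
  (forall x, L x -> L' x) -> spanmod L l v -> spanmod L' l v.
Proof. by move=> H; elim: l v => [|w l IH] v /=; [exact: H | move=> [c /IH]; exists c]. Qed.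


(** The spanning vectors of the target need not be images, so preimages are chosen inside P by
    elimination: an element of P whose image is outside the span of the tail of l is added to the
    list and used to remove the component along the head. *)
Lemma span_lift (U V : lmodType C) (f : U -> V) l (P : U -> Prop) :
  (forall a x y, f (x - a *: y) = f x - a *: f y) -> linear_pred P ->
  (forall y, P y -> spanmod (eq^~ 0) l (f y)) ->
  exists l', (forall y, y \in l' -> P y) /\ forall y, P y -> spanmod (fun y => P y /\ f y = 0) l' y.
Proof.
move=> flin; elim: l P => [|w l IH] P HP Hl.
  by exists [::]; split=> // y Py; split=> //; exact: Hl.
have L0 : linear_pred (eq^~ (0 : V)).
  by split=> [//|u v -> ->|a v ->]; rewrite ?addr0 ?scaler0.
have [S0 SD SZ] := spanmod_lin l L0; have [P0 PD PZ] := HP.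
have SB x y : spanmod (eq^~ 0) l x -> spanmod (eq^~ 0) l y -> spanmod (eq^~ 0) l (x - y).
  by move=> Hx Hy; apply: SD => //; rewrite -scaleN1r; exact: SZ.
have fD x y : f (x + y) = f x + f y by have := flin (-1) x y; rewrite !scaleN1r !opprK.
have f0 : f 0 = 0 by apply: (@addrI _ (f 0)); rewrite -fD !addr0.
have fZ a x : f (a *: x) = a *: f x.
  by have := flin (- a) 0 x; rewrite f0 !sub0r !scaleNr !opprK.
pose P' y := P y /\ spanmod (eq^~ 0) l (f y).
have HP' : linear_pred P'.
  split; first by split=> //; rewrite f0.
    by move=> x y [Px Sx] [Py Sy]; split; [exact: PD | rewrite fD; exact: SD].
  by move=> a x [Px Sx]; split; [exact: PZ | rewrite fZ; exact: SZ].
have [l' [Pl' Sl']] := IH P' HP' (fun y => @proj2 _ _).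
have [all_in|/existsNP [y0 /not_implyP [Py0 ny0]]] := EM (forall y, P y -> spanmod (eq^~ 0) l (f y)).
  exists l'; split=> [y /Pl' []//|y Py].
  by apply: spanmod_weaken (Sl' y (conj Py (all_in y Py))) => x [[]].
have [c0 Hc0] := Hl y0 Py0.
have c00 : c0 != 0 by apply/eqP=> E; apply: ny0; rewrite E scale0r subr0 in Hc0.
exists (y0 :: l'); split=> [y|y Py] /=.
  by rewrite inE => /orP[/eqP -> //|/Pl' []].
have [c Hc] := Hl y Py; exists (c / c0).
apply: spanmod_weaken (Sl' (y - (c / c0) *: y0) _) => [x [[]]//|]; split.
  by apply: PD => //; rewrite -scaleNr; exact: PZ.
have := SB _ _ Hc (SZ (c / c0) _ Hc0); rewrite flin scalerBr scalerA divfK //.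
by rewrite opprB addrA subrK.
Qed.

Lemma spanmod_cat (V : lmodType C) (L : V -> Prop) l l' v :
  spanmod (spanmod L l') l v -> spanmod L (l ++ l') v.
Proof. by elim: l v => [|w l IH] v //= [c /IH]; exists c. Qed.

Lemma spanmod_map (U V : lmodType C) (f : U -> V) l x v : (forall c y z, f (y - c *: z) = f y - c
  *: f z) ->
  f 0 = 0 -> spanmod (eq^~ 0) l x -> spanmod (eq^~ (v - f x)) [seq f w | w <- l] v.
Proof.
move=> flin f0; elim: l x v => [|w l IH] x v /=; first by move=> ->; rewrite f0 subr0.
move=> [c /(IH _ (v - c *: f w)) H]; exists c; move: H; rewrite flin.
by rewrite opprB addrA subrK.
Qed.

Lemma zero_lin (V : lmodType C) : linear_pred (eq^~ (0 : V)).
Proof. by split=> [//|u v -> ->|a v ->]; rewrite ?addr0 ?scaler0. Qed.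

Lemma slices_span l n : exists ll, forall v : vec, (forall j, spanmod (eq^~ 0) l (slice v j)) ->
  (forall j, (n <= j)%N -> slice v j = 0) -> spanmod (eq^~ 0) ll v.
Proof.
have [S0 SD SZ] := spanmod_lin l (@zero_lin vec).
elim: n => [|n [ll Hll]]; first by exists [::] => v _ Hv; apply: slice_inj => j; rewrite Hv.
pose f (w : vec) : vec := glue (fun j => if j == n then w else 0).
exists ([seq f w | w <- l] ++ ll) => v Hv Hn; apply: spanmod_cat.
have flin c y z : f (y - c *: z) = f y - c *: f z.
  apply: slice_inj => j; rewrite sliceD sliceN sliceZ !sliceK.
  by case: ifP => // _; rewrite scaler0 subr0.
have f0 : f 0 = 0 by apply: slice_inj => j; rewrite sliceK slice0; case: ifP.
apply: spanmod_weaken (spanmod_map v flin f0 (Hv n)) => u ->; apply: Hll => j;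
  rewrite sliceD sliceN sliceK; case: eqP => [->|ne]; rewrite ?subrr ?subr0 //.
by move=> le; apply: Hn; rewrite ltn_neqAle le andbT; apply/eqP => E; apply: ne.
Qed.

Lemma filt_span fs : all (fun f => f.2 != None) fs ->
  exists l, forall s v, filt fs s v -> spanmod (eq^~ 0) l v.
Proof.
elim: fs => [|[[x y] [k|]] fs IH] //= H.
  by exists [:: (fun=> 1) : vec] => s v [c [-> _]]; exists c; rewrite subrr.
have [l Hl] := IH H; have [ll Hll] := slices_span l k.+1.
exists ll => s v [Fv Bv]; apply: Hll => [j|j lt]; first exact: Hl (Fv j).
exact: (Bv k).
Qed.
End Span.

Lemma ps_invX (a : C) : a != 0 -> exists g : ps C, (ps_const a - psX) * g = 1.
Proof.
move=> a0; exists (fun n => a ^- n.+1); apply/psP=> n.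
rewrite mulrBl psD psN psC_mul psXM; case: n => [|n]; first by rewrite subr0 expr1 mulfV.
by rewrite exprS invfM mulVKf // subrr.
Qed.

Section TwistedRepresentation.
Variables (q : C) (q0 : q != 0).
Hypothesis hq : forall n : nat, (0 < n)%N -> q ^+ n != 1.
Variables (A : algType C) (t tb : 'I_2 -> 'I_2 -> nat -> A) (ti tbi : 'I_2 -> A).
Hypothesis HE : is_Uext q t tb ti tbi.
Variables (mu mub : nat -> C) (fs : seq factor) (V : valid q fs) (mu0 : mu 0%N != 0).
Hypothesis Hmu : (mub : ps C) * pser (muP fs) = (mu : ps C) * pser (mubP fs).
Local Notation Y := (Yq q t tb ti tbi).
Local Notation Yr := (Yq q (rep_t q fs) (rep_tb q fs) (rep_ti q fs) (rep_tbi q fs)).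
Local Notation s_ := (s_coef q t tb).
Local Notation xi := (hwv fs).

Lemma muP_inv : exists psi : ps C, pser (muP fs) * psi = 1.
Proof.
elim: (fs) V => [|[[x y] m] gs IH] V'; first by exists (-1); rewrite /= rmorphN rmorph1 mulrNN mulr1.
have [x0 y0 _ /IH [psi E]] := V'; have [a Ea] := ps_invX x0; have [b Eb] := ps_invX y0.
exists (b * a * psi); rewrite /= !rmorphM !rmorphB /= !pserC pserX.
rewrite -[RHS](mulr1 1) -{1}Ea -[1 in RHS](mulr1 1) -{1}Eb -E; ring.
Qed.

(* The highest weight (muP, mubP) is corrected to (mu, mub) by multiplying T(u) with a scalar series. *)
Lemma twisted_hom : exists (rho : A -> oper) (phi0 : C),
  [/\ alg_hom rho, phi0 != 0,
      (forall r, [/\ rho (s_ o1 o1 r) xi = 0, rho (s_ o2 o1 r) xi = mu r *: xi &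
                 rho (sb_coef q t tb o2 o1 r) xi = mub r *: xi]),
      rho (s_ o2 o2 0%N) = phi0 *: rs q fs o2 o2 0%N &
      (forall y, Y y -> Yr (rho y)) /\ (forall f, Yr f -> exists2 y, Y y & rho y = f)].
Proof.
have [psi Epsi] := muP_inv; pose phi : ps C := (mu : ps C) * psi.
have Ephi : phi * pser (muP fs) = mu by rewrite /phi -mulrA (mulrC psi) Epsi mulr1.
have Ephib : phi * pser (mubP fs) = mub.
  by rewrite -(mulr1 (mub : ps C)) -Epsi mulrA Hmu /phi; ring.
have psi0 : psi 0%N != 0.
  apply/eqP=> E0; have := f_equal (fun f : ps C => f 0%N) Epsi.
  by rewrite psM0 E0 mulr0 => /esym/eqP; rewrite oner_eq0.
have phi0 : phi 0%N != 0 by rewrite /phi psM0 mulf_neq0.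
have [HU univ] := HE; have HR := rep_rels q0 V.
have [rho [rho_hom rho_t rho_ti _]] := univ _ _ _ _ _ (Uext_rels_twist HR phi0).
have [rhoD rhoZ rhoM rho1] := rho_hom.
have rho0 : rho 0 = 0 by rewrite -(scale0r 0) rhoZ scale0r.
have rhoN x : rho (- x) = - rho x by rewrite -scaleN1r rhoZ scaleN1r.
have rho_sum n (F : 'I_n -> A) : rho (\sum_(i < n) F i) = \sum_(i < n) rho (F i).
  by elim/big_rec2: _ => // i x y _ <-.
have rho_s i j r : rho (s_ i j r) = (phi *: (rs q fs i j : ps oper)) r.
  rewrite /rs -s_coef_twist /s_coef rho_sum; apply: eq_bigr => a _.
  by rewrite rhoD rhoN rhoZ !rhoM !(proj1 (rho_t _ _ _)) !(proj2 (rho_t _ _ _)).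
have rho_sb i j r : rho (sb_coef q t tb i j r) = (phi *: (rsb q fs i j : ps oper)) r.
  rewrite /rsb -sb_coef_twist /sb_coef rho_sum; apply: eq_bigr => a _.
  by rewrite rhoD rhoN rhoZ !rhoM !(proj1 (rho_t _ _ _)) !(proj2 (rho_t _ _ _)).
have rho_inv : rho (s12inv q ti tbi) = (phi 0%N)^-1 *: s12inv q (rep_ti q fs) (rep_tbi q fs).
  rewrite /s12inv rhoZ rhoM (proj1 (rho_ti _)) (proj2 (rho_ti _)) /twist_ti.
  by rewrite -scalerAr !scalerA mulrC.
have act (k : ps C) (f : ps oper) r : (k *: f) r xi = fun g => (k * evl f xi g) r.
  by apply/funext=> g; rewrite -evlZ.
exists rho, (phi 0%N); split=> //.
- move=> r; rewrite !rho_s rho_sb !act; split; apply/funext=> g; have [E1 E2 _ E4] := evl_hw V g.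
  + by rewrite E1 mulr0 ps0.
  + by rewrite E2 mulrCA psC_mul Ephi mulrC.
  by rewrite E4 mulrCA psC_mul Ephib mulrC.
- by rewrite rho_s psZ big_ord1.
split=> [y Yy|f Yf].
  apply: (Yy (fun y => Yr (rho y))).
  - split=> [|x z|c x|x z]; rewrite ?rho1 ?rhoD ?rhoZ ?rhoM;
      [exact: Yq1 | exact: YqD | exact: YqZ | exact: YqM].
  - move=> i j r; rewrite rho_s; apply: linear_predZ_ps; first exact: Yq_lin.
    by move=> n; exact: Yq_s.
  by rewrite rho_inv; apply: YqZ; exact: Yq_inv.
pose im f := exists2 y, Y y & rho y = f.
have im_lin : linear_pred im.
  split; first by exists 0; [exact: Yq0|].
    by move=> _ _ [x Yx <-] [z Yz <-]; exists (x + z); [exact: YqD|].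
  by move=> c _ [x Yx <-]; exists (c *: x); [exact: YqZ|].
apply: (Yf im).
- have [_ imD imZ] := im_lin; split=> //; first by exists 1; [exact: Yq1|].
  by move=> _ _ [x Yx <-] [z Yz <-]; exists (x * z); [exact: YqM|].
- move=> i j r.
  (* The image contains the coefficients of phi S; dividing by phi, whose constant term is nonzero,
     recovers those of S. *)
  apply: (@ps_divide oper im phi (rs q fs i j) im_lin phi0 _ r) => n.
  by exists (s_ i j n); [exact: Yq_s | exact: rho_s].
have [_ _ imZ] := im_lin.
have -> : s12inv q (rep_ti q fs) (rep_tbi q fs) = phi 0%N *: rho (s12inv q ti tbi).
  by rewrite rho_inv scalerA mulfV // scale1r.
by apply: imZ; exists (s12inv q ti tbi); [exact: Yq_inv|].
Qed.
End TwistedRepresentation.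

Section Dichotomy.
Variables (q : C) (q0 : q != 0).
Hypothesis hq : forall n : nat, (0 < n)%N -> q ^+ n != 1.
Variables (A : algType C) (t tb : 'I_2 -> 'I_2 -> nat -> A) (ti tbi : 'I_2 -> A).
Hypothesis HE : is_Uext q t tb ti tbi.
Local Notation Y := (Yq q t tb ti tbi).
Local Notation s_ := (s_coef q t tb).

Let HU : Uext_rels q t tb ti tbi. Proof. by case: HE. Qed.

Section Weight.
Variables (mu mub : nat -> C) (fs : seq factor) (V : valid q fs) (mu0 : mu 0%N != 0).
Hypothesis Hmu : (mub : ps C) * pser (muP fs) = (mu : ps C) * pser (mubP fs).
Local Notation xi := (hwv fs).
Local Notation J := (max_sub q t tb ti tbi mu mub).

Lemma annihilator_proper (rho : A -> oper) : alg_hom rho ->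
  (forall r, [/\ rho (s_ o1 o1 r) xi = 0, rho (s_ o2 o1 r) xi = mu r *: xi &
                 rho (sb_coef q t tb o2 o1 r) xi = mub r *: xi]) ->
  Defs.proper_sub q t tb ti tbi mu mub (fun y => Y y /\ rho y xi = 0).
Proof.
move=> [rhoD rhoZ rhoM rho1] rho_xi.
have rho0 : rho 0 = 0 by rewrite -(scale0r 0) rhoZ scale0r.
have rhoB x c : rho (x - c *: 1) xi = rho x xi - c *: xi.
  by rewrite -scaleNr rhoD rhoZ rho1 oper_addE oper_scaleE scaleNr.
have YB x c : Y x -> Y (x - c *: 1) by move=> Yx; rewrite -scaleNr; apply: YqD => //; apply: YqZ;
  exact: Yq1.
have HL : left_ideal Y (fun y => Y y /\ rho y xi = 0).
  split=> [x []//||x y [Yx Ex] [Yy Ey]|y x Yy [Yx Ex]].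
  - by split; [exact: Yq0 | rewrite rho0].
  - by split; [exact: YqD | rewrite rhoD oper_addE Ex Ey addr0].
  by split; [exact: YqM | rewrite rhoM oper_mulE Ex oper0].
split=> // [x Zx|[_ /eqP]]; last by rewrite rho1 oper_1E (negPf (hwv_neq0 fs)).
apply: (Zx (fun y => Y y /\ rho y xi = 0)) => // r; have [E1 E2 E3] := rho_xi r.
- by split; [exact: Yq_s|].
- by split; [apply: YB; exact: Yq_s | rewrite rhoB E2 subrr].
by split; [apply: YB; exact: Yq_sb | rewrite rhoB E3 subrr].
Qed.

(** The annihilator of xi is a proper submodule, hence contained in J, so V is a quotient of the
    cyclic module generated by xi. That module lies in the span of the products of finitely many
    finite strings. *)
Lemma findim_of_bounded : all (fun f => f.2 != None) fs -> V_findim q t tb ti tbi mu mub.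
Proof.
move=> /filt_span [l Hl].
have [rho [phi0 [rho_hom _ rho_xi _ [YYr _]]]] := twisted_hom q0 HE V mu0 Hmu.
have HN := annihilator_proper rho_hom rho_xi.
have [rhoD rhoZ _ _] := rho_hom.
have [|y /(YYr y) Yry|l' [Yl' Hl']] := @span_lift A vec (fun y => rho y xi) l Y _ (@Yq_lin q A t tb
  ti tbi).
- by move=> a x y; rewrite -!scaleNr rhoD rhoZ oper_addE oper_scaleE.
- have [s Fs] : in_filt fs (rho y xi) by apply: (Yq_filt q0 V Yry); exists 1%N; exact: filt_hwv.
  exact: Hl Fs.
exists (size l'), (fun k => l'`_k); split=> [k|y Yy]; first by apply: Yl'; exact: mem_nth.
have [c Hc] := spanmod_coef (Hl' y Yy); exists c.
exact: sub_max_sub HN _ Hc.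
Qed.

(** By [generates_hwv], if y in J had y xi <> 0, then z y would be 1 modulo the annihilator of xi
    for some z in Y', and J would not be proper. So J annihilates xi, and b_0^k xi <> 0 shows that
    no power of b_0 lies in J. *)
Lemma not_findim_of_free : ns q fs -> (exists2 f, f \in fs & free_factor q f) ->
  ~ V_findim q t tb ti tbi mu mub.
Proof.
move=> NS fr [n [v [_ Hv]]].
have [rho [phi0 [rho_hom phi00 rho_xi rho_b [YYr im]]]] := twisted_hom q0 HE V mu0 Hmu.
have [rhoD rhoZ rhoM rho1] := rho_hom.
have HN := annihilator_proper rho_hom rho_xi; have [_ ZN N1] := HN.
have HJ := max_sub_proper q0 hq HU (fun Z1 => N1 (ZN _ Z1)); have [_ _ J1] := HJ.
have HJ' := proper_sub_hw q0 HU HJ.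
have NJ y : Y y -> J y -> rho y xi = 0.
  move=> Yy Jy; apply/eqP; apply: contraT => nz.
  have Fy : in_filt fs (rho y xi) by apply: (Yq_filt q0 V (YYr _ Yy)); exists 1%N; exact: filt_hwv.
  have [f [Yf E]] := generates_hwv q0 hq V NS Fy nz; have [z Yz Ez] := im f Yf.
  exfalso; apply: J1; rewrite -(subrK (z * y) 1); apply: (hwD HJ'); last exact: hwM HJ' _ _ Yz Jy.
  apply: (sub_max_sub HN); split.
    by apply: YqD; [exact: Yq1 | rewrite -scaleN1r; apply: YqZ; exact: YqM].
  by rewrite -scaleN1r rhoD rhoZ rhoM rho1 Ez oper_addE oper_scaleE oper_mulE E scaleN1r subrr.
apply: (b0_not_findim q0 hq HU HJ' J1); last by exists n, v.
move=> k; have Yb : Y (s_ o2 o2 0%N ^+ k).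
  by elim: k => [|k IH]; [exact: Yq1 | rewrite exprS; apply: YqM => //; exact: Yq_s].
move=> /(NJ _ Yb) /eqP; apply/negP.
have -> : rho (s_ o2 o2 0%N ^+ k) = phi0 ^+ k *: rs q fs o2 o2 0%N ^+ k.
  elim: k {Yb} => [|k IH]; first by rewrite !expr0 rho1 scale1r.
  by rewrite !exprS rhoM IH rho_b -scalerAl -scalerAr scalerA.
by rewrite oper_scaleE scaler_eq0 expf_eq0 (negPf phi00) andbF b0_pow_hwv.
Qed.
End Weight.
End Dichotomy.

(** * The polynomial P *)

Section RootLists.
Variables (q : C) (q0 : q != 0).
Hypothesis hq : forall n : nat, (0 < n)%N -> q ^+ n != 1.
Implicit Types (rs L : seq C).

Definition Pl rs : {poly C} := \prod_(x <- rs) (1 - x *: 'X).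
Definition Rl rs : {poly C} := \prod_(x <- rs) ('X - x%:P).
(** The involution that the symmetry u^d P(1/u) = q^(-d) P(u q^2) induces on the numbers rho in P =
    prod (1 - rho u). *)
Definition hat (x : C) : C := (q ^+ 2 * x)^-1.
Definition pairs L : seq C := flatten [seq [:: x; hat x] | x <- L].

Lemma hatK : involutive hat.
Proof. by move=> x; rewrite /hat invfM invrK mulKf // expf_neq0. Qed.

Lemma Pl_cons x rs : Pl (x :: rs) = (1 - x *: 'X) * Pl rs. Proof. exact: big_cons. Qed.
Lemma Rl_cons x rs : Rl (x :: rs) = ('X - x%:P) * Rl rs. Proof. exact: big_cons. Qed.
Lemma Pl_perm rs rs' : perm_eq rs rs' -> Pl rs = Pl rs'. Proof. exact: perm_big. Qed.
Lemma Rl_perm rs rs' : perm_eq rs rs' -> Rl rs = Rl rs'. Proof. exact: perm_big. Qed.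

Lemma Pl0 rs : (Pl rs)`_0 = 1.
Proof.
rewrite -horner_coef0; elim: rs => [|x rs IH]; first by rewrite /Pl big_nil hornerE.
by rewrite Pl_cons !hornerE IH ?mulr0 ?subr0 ?mulr1.
Qed.
Lemma Rl0_neq0 rs : all (fun x => x != 0) rs -> (Rl rs)`_0 != 0.
Proof.
rewrite -horner_coef0; elim: rs => [|x rs IH]; first by rewrite /Rl big_nil hornerE oner_eq0.
by move=> /= /andP[x0 /IH H]; rewrite Rl_cons !hornerE ?sub0r mulf_neq0 ?oppr_eq0.
Qed.

Lemma Pl_size rs : all (fun x => x != 0) rs -> size (Pl rs) = (size rs).+1.
Proof.
move=> /Rl0_neq0 H; have Hc := isrev_coef (isrev_prod rs).
apply/eqP; rewrite eqn_leq; apply/andP; split.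
  by apply/leq_sizeP => j lt; have [-> _] := Hc j; rewrite leqNgt lt.
apply: contraR H; rewrite -ltnNge ltnS => le; have [_ E] := Hc 0%N.
by rewrite /Rl E subn0 nth_default.
Qed.

Lemma Pl_revp rs : all (fun x => x != 0) rs -> revp (Pl rs) = Rl rs.
Proof.
move=> nz; apply/polyP=> i; rewrite coef_poly Pl_size //= ltnS.
by have [_ E] := isrev_coef (isrev_prod rs) i; rewrite /Rl E.
Qed.

Lemma Pl_comp rs : Pl rs \Po (q ^+ 2 *: 'X) = Pl [seq q ^+ 2 * x | x <- rs].
Proof.
rewrite /Pl rmorph_prod big_map; apply: eq_bigr => x _.
by rewrite /= comp_polyB comp_polyZ comp_polyX comp_polyC scalerA (mulrC x).
Qed.

Lemma pairs_size L : size (pairs L) = (2 * size L)%N.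
Proof. by elim: L => [//|x L IH] /=; rewrite IH mulnS. Qed.
Lemma pairs_neq0 L : all (fun x => x != 0) L -> all (fun x => x != 0) (pairs L).
Proof.
by elim: L => [//|x L IH] /= /andP[x0 /IH ->]; rewrite x0 invr_eq0 mulf_neq0 ?expf_neq0.
Qed.

Lemma abs_pair (K : comNzRingType) (X Q a b : K) : Q * a * b = 1 ->
  (1 - Q * a * X) * (1 - Q * b * X) = Q * ((X - a) * (X - b)) /\
  (X - Q * a) * (X - Q * b) = Q * ((1 - a * X) * (1 - b * X)).
Proof.
move=> E; split.
  transitivity (1 - Q * (a + b) * X + Q * (Q * a * b) * X ^+ 2); first by ring.
  transitivity (Q * a * b - Q * (a + b) * X + Q * X ^+ 2); last by ring.
  by rewrite E mulr1.
transitivity (Q * (Q * a * b) - Q * (a + b) * X + X ^+ 2); first by ring.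
transitivity (Q * 1 - Q * (a + b) * X + Q * a * b * X ^+ 2); last by ring.
by rewrite E mul1r.
Qed.

Lemma pairs_shift L : all (fun x => x != 0) L ->
  Pl [seq q ^+ 2 * x | x <- pairs L] = q ^+ (2 * size L) *: Rl (pairs L) /\
  Rl [seq q ^+ 2 * x | x <- pairs L] = q ^+ (2 * size L) *: Pl (pairs L).
Proof.
elim: L => [_|x L IH /= /andP[x0 /IH [E1 E2]]].
  by rewrite /Pl /Rl !big_nil expr0 scale1r.
rewrite !Pl_cons !Rl_cons E1 E2 mulnS exprD.
have h1 : (q ^+ 2)%:P * x%:P * (hat x)%:P = 1 :> {poly C}.
  by rewrite -!polyCM mulfV // mulf_neq0 ?expf_neq0.
rewrite -!mul_polyC !(polyCM (q ^+ 2)); move: (q ^+ 2)%:P h1 => Q2 h1.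
have [F1 F2] := abs_pair 'X h1.
by split; rewrite mulrA ?F1 ?F2; ring.
Qed.

Lemma good_pairs mu mub L : all (fun x => x != 0) L -> mu 0%N != 0 ->
  (mub : ps C) * pser (Rl (pairs L)) = (mu : ps C) * pser (Pl (pairs L)) ->
  good_P q mu mub (Pl (pairs L)).
Proof.
move=> L0 mu0 E; have nz := pairs_neq0 L0; have [S1 S2] := pairs_shift L0.
have qn : q ^+ (2 * size L) != 0 by rewrite expf_neq0.
have nz2 : all (fun x => x != 0) [seq q ^+ 2 * x | x <- pairs L].
  by rewrite all_map; apply: sub_all nz => x x0 /=; rewrite mulf_neq0 ?expf_neq0.
rewrite /good_P Pl_size //= pairs_size Pl_comp !Pl_revp // S1 S2.
split=> //; first by rewrite oddM.
- exact: Pl0.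
- by rewrite scalerA mulVf // scale1r.
move=> r; have := f_equal (fun f : ps C => f r) E; rewrite psM => Er; apply: (etrans Er).
rewrite psM /ser_mul mulr_sumr; apply: eq_bigr => i _.
by rewrite coefZ mulrCA mulKf.
Qed.

(* The fixed points of hat are 1/q and -1/q, and the condition on the product makes the multiplicity
   of the latter even. *)
Lemma pair_up rs : ~~ odd (size rs) -> all (fun x => x != 0) rs ->
  perm_eq rs (map hat rs) -> \prod_(x <- rs) (q * x) = 1 ->
  exists L, all (fun x => x != 0) L /\ perm_eq rs (pairs L).
Proof.
have [n] := ubnP (size rs); elim: n rs => // n IH rs lt ev nz pe pr.
have hat0 x : x != 0 -> hat x != 0 by move=> x0; rewrite invr_eq0 mulf_neq0 ?expf_neq0.
have [[x xin hin]|no] := EM (exists2 x, x \in rs & hat x \in rem x rs).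
  have x0 : x != 0 by exact: (allP nz).
  have P1 : perm_eq rs (x :: hat x :: rem (hat x) (rem x rs)).
    by rewrite (perm_trans (perm_to_rem xin)) // perm_cons perm_to_rem.
  move: (rem _ _) P1 => r P1 {hin xin}.
  have [L [L0 HL]] : exists L, all (fun x => x != 0) L /\ perm_eq r (pairs L).
    apply: IH.
    - by move: lt; rewrite (perm_size P1) /= ltnS => /ltnW.
    - by move: ev; rewrite (perm_size P1) /= negbK.
    - by move: nz; rewrite (perm_all _ P1) /= => /and3P[].
    - have := perm_map hat P1; rewrite /= hatK => P2.
      have : perm_eq (x :: hat x :: r) (x :: hat x :: map hat r).
        rewrite -(permPl P1) (permPl pe) (permPl P2).
        by rewrite -[hat x :: x :: _]/([:: hat x; x] ++ _) -[x :: hat x :: _]/([:: x;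
          hat x] ++ _) perm_cat2r; apply/permP=> a /=; rewrite addnCA.
      by rewrite !perm_cons.
    move: pr; rewrite (perm_big _ P1) !big_cons /= mulrA.
    have -> : q * x * (q * hat x) = 1 by rewrite /hat; field; rewrite q0 x0.
    by rewrite mul1r.
  exists (x :: L); rewrite /= x0 L0; split=> //.
  by apply: (perm_trans P1); rewrite !perm_cons.
(* When nothing can be paired off, [rs] consists of distinct fixed points of [hat]. Its length being
   even, it is empty or contains exactly 1/q and -1/q, and then the product would be -1. *)
have hin x : x \in rs -> hat x = x.
  move=> xin; apply: contrapT => ne; apply: no; exists x => //.
  have : hat x \in rs by rewrite (perm_mem pe) map_f.
  by rewrite (perm_mem (perm_to_rem xin)) inE => /orP[/eqP|].
have sq x : x \in rs -> (q * x) ^+ 2 = 1.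
  move=> xin; have x0 := allP nz x xin; rewrite exprMn [x ^+ 2]expr2 mulrA.
  by rewrite -{2}(hin x xin) mulfV // mulf_neq0 ?expf_neq0.
have nrem x : x \in rs -> x \notin rem x rs.
  by move=> xin; apply/negP=> H; apply: no; exists x => //; rewrite hin.
have ur : uniq rs.
  elim: (rs) nrem => [//|x r IHr] H /=; apply/andP; split.
    by have := H x (mem_head _ _); rewrite /= eqxx.
  apply: IHr => y yin; have := H y; rewrite inE yin orbT => /(_ isT) /=.
  by case: ifP => _; rewrite ?yin // inE negb_or => /andP[].
have eqN x y : x \in rs -> y \in rs -> x != y -> x = - y.
  move=> xin yin ne; have /eqP := sq x xin; rewrite -(sq y yin) eqf_sqr => /orP[/eqP /(mulfI q0)
    E|/eqP].
    by rewrite E eqxx in ne.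
  by rewrite -mulrN => /(mulfI q0).
case: rs {lt pe no hin nrem nz} ev pr sq ur eqN => [|x [|y [|z r]]] //; first by exists [::].
  move=> _; rewrite !big_cons big_nil mulr1 => pr sq; rewrite /= inE andbT => xy _; exfalso.
  have qx := sq x (mem_head _ _); have qx0 : q * x != 0.
    by apply: contra_eq_neq qx => ->; rewrite expr0n eq_sym oner_eq0.
  move/negP: xy; apply; apply/eqP/(mulfI q0)/(mulfI qx0).
  by rewrite -expr2 qx pr.
move=> _ _ _; rewrite /= !inE !negb_or => /and3P[/and3P[xy xz _] /andP[yz _] _] eqN; exfalso.
move/eqP: yz; apply; apply: oppr_inj; rewrite -(eqN x y) ?inE ?eqxx ?orbT //.
by rewrite -(eqN x z) ?inE ?eqxx ?orbT.
Qed.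

Lemma revp_isrev (P : {poly C}) : isrev (size P).-1 P (revp P).
Proof.
have [->|P0] := eqVneq P 0.
  by rewrite /revp size_poly0 (_ : \poly_(k < 0) _ = 0) ?poly_def ?big_ord0 //; exact: isrev0.
have sP : (size P).-1.+1 = size P by rewrite prednK // lt0n size_poly_eq0.
set d := (size P).-1.
have H : isrev d (\sum_(i < d.+1) (P`_i)%:P * 'X^i) (\sum_(i < d.+1) (P`_i)%:P * 'X^(d - i)).
  by apply: (@isrev_sum d d.+1 (fun i => (P`_i)%:P * 'X^i) (fun i => (P`_i)%:P * 'X^(d - i))) => i lt;
    apply: isrev_scale; exact: isrev_mon.
have EP : \sum_(i < d.+1) (P`_i)%:P * 'X^i = P.
  by rewrite -[RHS]coefK poly_def sP; apply: eq_bigr => i _; rewrite mul_polyC.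
rewrite EP in H; suff -> : revp P = \sum_(i < d.+1) (P`_i)%:P * 'X^(d - i) by [].
apply/polyP=> i; have [_ ->] := isrev_coef H i.
by rewrite coef_poly -sP ltnS.
Qed.

Lemma Pl_shift_hat rs : all (fun x => x != 0) rs ->
  q ^- size rs *: Pl [seq q ^+ 2 * x | x <- rs]
  = ((-1) ^+ size rs * \prod_(x <- rs) (q * x)) *: Rl (map hat rs).
Proof.
elim: rs => [|x rs IH] /=; first by rewrite /Pl /Rl !big_nil expr0 invr1 mulr1.
move=> /andP[x0 /IH {}IH]; rewrite Pl_cons Rl_cons big_cons.
have -> : 1 - (q ^+ 2 * x) *: 'X = - (q ^+ 2 * x) *: ('X - (hat x)%:P).
  by rewrite scalerBr scale_polyC mulNr mulfV ?mulf_neq0 ?expf_neq0 // polyCN opprK scaleNr addrC.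
transitivity (- (q * x) *: (('X - (hat x)%:P) *
    (q ^- size rs *: Pl [seq q ^+ 2 * x0 | x0 <- rs]))).
  rewrite -scalerAl -scalerAr !scalerA; congr (_ *: _).
  by rewrite exprS; field; rewrite q0 expf_neq0.
by rewrite IH -scalerAr scalerA exprS; congr (_ *: _); ring.
Qed.

Lemma good_P_pairs mu mub P : good_P q mu mub P -> exists L,
  [/\ all (fun x => x != 0) L, P = Pl (pairs L) &
      (mub : ps C) * pser (Rl (pairs L)) = (mu : ps C) * pser (Pl (pairs L))].
Proof.
move=> [ev P0 rv mu0 E].
have H := revp_isrev P.
have Pn0 : P != 0 by apply: contra_eq_neq P0 => ->; rewrite coef0 eq_sym oner_eq0.
have R0 : (revp P)`_0 != 0.
  by have [_ ->] := isrev_coef H 0; rewrite subn0 -lead_coefE lead_coef_eq0.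
have [|rs [srs nz EP ER]] := isrev_roots H _ R0; first by rewrite P0 oner_eq0.
rewrite P0 !scale1r -/(Pl _) -/(Rl _) in EP ER.
have E1 : Rl rs = ((-1) ^+ size rs * \prod_(x <- rs) (q * x)) *: Rl (map hat rs).
  by rewrite -Pl_shift_hat // -Pl_comp -EP -ER rv srs.
have ev' : ~~ odd (size rs) by rewrite srs.
(* The condition on the product comes from comparing leading coefficients in the symmetry of P. *)
have pr : \prod_(x <- rs) (q * x) = 1.
  have := f_equal lead_coef E1; rewrite lead_coefZ !lead_coef_prod_XsubC mulr1.
  by rewrite -signr_odd (negPf ev') expr0 mul1r.
have [L [L0 pL]] : exists L, all (fun x => x != 0) L /\ perm_eq rs (pairs L).
  by apply: pair_up => //; apply: prod_XsubC_eq; rewrite -/(Rl rs) E1 pr -signr_odd (negPf ev')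
    mul1r scale1r.
exists L; rewrite -(Pl_perm pL) -(Rl_perm pL) -EP -ER; split=> //.
apply/psP=> r; rewrite psM [LHS]E {E}.
have nz2 : all (fun x => x != 0) [seq q ^+ 2 * x | x <- rs].
  by rewrite all_map; apply: sub_all nz => x x0 /=; rewrite mulf_neq0 ?expf_neq0.
have EQ : revp (P \Po (q ^+ 2 *: 'X)) = q ^+ (size P).-1 *: P.
  rewrite EP Pl_comp Pl_revp // (Rl_perm (perm_map _ pL)) (pairs_shift L0).2 (Pl_perm pL) Pl_size
    ?pairs_neq0 //.
  by rewrite pairs_size.
rewrite EQ psM /ser_mul mulr_sumr; apply: eq_bigr => i _.
by rewrite coefZ mulrCA mulKf // expf_neq0.
Qed.

(** Both ratios equal that of [mub] and [mu], which by the symmetry means P(q^2 u) P'(u) = P'(q^2 u)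
    P(u). So P/P' is invariant under u -> q^2 u; by induction on n, the inequality q^(2n) <> 1
    forces the coefficients of index n to agree. *)
Lemma good_P_unique mu mub P P' : good_P q mu mub P -> good_P q mu mub P' -> P = P'.
Proof.
move=> GP GP'; have [_ P0 rv mu0 _] := GP; have [_ P0' rv' _ _] := GP'.
have [L [L0 EP E]] := good_P_pairs GP; have [L' [L0' EP' E']] := good_P_pairs GP'.
have ER : revp P = Rl (pairs L) by rewrite EP Pl_revp // pairs_neq0.
have ER' : revp P' = Rl (pairs L') by rewrite EP' Pl_revp // pairs_neq0.
have C1 : revp P * P' = revp P' * P.
  apply: pser_inj; rewrite !rmorphM /=; apply/eqP; rewrite -subr_eq0; apply/eqP.
  apply: (@ps_unit_cancel mu) => //; rewrite mulrBr; apply/eqP; rewrite subr_eq0; apply/eqP.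
  rewrite mulrCA EP' -E' -EP' [RHS]mulrCA EP -E -EP ER ER'.
  by rewrite mulrCA; ring.
have d0 (P1 : {poly C}) : P1`_0 = 1 -> (P1 \Po (q ^+ 2 *: 'X))`_0 = 1.
  by rewrite -!horner_coef0 horner_comp !hornerE ?mulr0.
have C2 : (P \Po (q ^+ 2 *: 'X)) * P' = (P' \Po (q ^+ 2 *: 'X)) * P.
  have := C1; rewrite rv rv' -!scalerAl => C3.
  (* Comparing constant terms shows that the powers of q contributed by the two degrees coincide, so
     they cancel. *)
  have := f_equal (fun p : {poly C} => p`_0) C3; rewrite !coefZ !coef0M !d0 // P0 P0' !mulr1 => Eq.
  by move: C3; rewrite Eq => /(scalerI _); apply; rewrite invr_eq0 expf_neq0.
apply/polyP; elim/ltn_ind=> -[_|n IH]; first by rewrite P0 P0'.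
have coefq (p : {poly C}) i : (p \Po (q ^+ 2 *: 'X))`_i = q ^+ (2 * i) * p`_i.
  elim/poly_ind: p i => [|p c IHp] [|i]; rewrite ?comp_poly0 ?coef0 ?mulr0 //.
    by rewrite comp_poly_MXaddC -scalerAr !coefD coefZ !coefMX /= mulr0 add0r expr0 mul1r.
  rewrite comp_poly_MXaddC -scalerAr !coefD coefZ !coefMX !coefC /= !addr0 IHp.
  by rewrite mulrA -exprD mulnS.
have SE (p p' : {poly C}) : (p * p')`_n.+1
    = p`_0 * p'`_n.+1 + (\sum_(i < n) p`_i.+1 * p'`_(n - i) + p`_n.+1 * p'`_0).
  by rewrite coefM big_ord_recl big_ord_recr /= subn0 subnn.
have := f_equal (fun p : {poly C} => p`_n.+1) C2; rewrite /= !SE !d0 // P0 P0' !coefq !mul1r !mulr1.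
set S := \sum_(i < n) _; set S' := \sum_(i < n) _.
have -> : S = S'.
  apply: eq_bigr => i _; have lt : (i.+1 < n.+1)%N by rewrite ltnS.
  by rewrite !coefq (IH _ lt) (IH (n - i)%N) // ltnS leq_subr.
move=> EQ; apply/eqP; rewrite -subr_eq0.
have /eqP : (q ^+ (2 * n.+1) - 1) * (P`_n.+1 - P'`_n.+1) = 0.
  have -> : (q ^+ (2 * n.+1) - 1) * (P`_n.+1 - P'`_n.+1)
    = P'`_n.+1 + (S' + q ^+ (2 * n.+1) * P`_n.+1) - (P`_n.+1 + (S' + q ^+ (2 * n.+1) * P'`_n.+1))
      by ring.
  by rewrite EQ subrr.
have qn : q ^+ (2 * n.+1) != 1 by apply: hq; rewrite muln_gt0.
by rewrite mulf_eq0 !subr_eq0 (negPf qn).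
Qed.
End RootLists.

(** * Grouping the roots into strings *)

Section Factors.
Variables (q : C) (q0 : q != 0).
Hypothesis hq : forall n : nat, (0 < n)%N -> q ^+ n != 1.
Implicit Types (rs L : seq C) (fs : seq factor).

Definition fs_roots fs : seq C := flatten [seq [:: f.1.1; f.1.2] | f <- fs].

Lemma muP_roots fs : muP fs = - Rl (fs_roots fs) /\ mubP fs = - Pl (fs_roots fs).
Proof.
elim: fs => [|[[x y] m] fs [IH1 IH2]]; first by rewrite /Rl /Pl !big_nil.
rewrite [muP _]/= [mubP _]/= IH1 IH2 /fs_roots [flatten _]/= !Rl_cons !Pl_cons.
by split; ring.
Qed.

Lemma factors_of_roots rs : ~~ odd (size rs) -> all (fun x => x != 0) rs ->
  exists fs, [/\ valid q fs, ns q fs, perm_eq rs (fs_roots fs) &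
                 forall f, f \in fs -> f.2 = None -> free_factor q f].
Proof.
have [n] := ubnP (size rs); elim: n rs => // n IH [|x [|z r]] // lt ev; first by exists [::].
move=> /= /and3P[x0 z0 r0].
(* A string beginning at x can close at j with one of the remaining roots as its other parameter.
   Condition [ns] for x follows once no [hit] occurs before the chosen end. *)
pose hit j := [exists i : 'I_(size (z :: r)), (z :: r)`_i * x * q ^+ (2 * j) == 1].
have hitP j y : y \in z :: r -> y * x * q ^+ (2 * j) = 1 -> hit j.
  move=> yin E; apply/existsP; have lti : (index y (z :: r) < size (z :: r))%N by rewrite index_mem.
  by exists (Ordinal lti); rewrite /= nth_index // E.
have build y m : y \in z :: r -> (forall k, m = Some k -> x * y * q ^+ (2 * k) = 1) ->
    (forall j, (forall k, m = Some k -> (j < k)%N) -> ~~ hit j) ->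
    exists fs, [/\ valid q fs, ns q fs, perm_eq [:: x, z & r] (fs_roots fs) &
                 forall f, f \in fs -> f.2 = None -> free_factor q f].
  move=> yin Hm Hhit; have y0 : y != 0 by move: yin; rewrite inE => /orP[/eqP -> //|/(allP r0)].
  have P := perm_to_rem yin.
  have [|||fs [V NS Pf free]] := IH (rem y (z :: r)).
  - by rewrite size_rem //= ltnW.
  - by rewrite size_rem //=; move: ev; rewrite negbK.
  - by apply/allP=> w /mem_rem; rewrite inE => /orP[/eqP -> //|/(allP r0)].
  have Pr : perm_eq [:: x, z & r] (fs_roots ((x, y, m) :: fs)).
    by rewrite perm_cons; apply: (perm_trans P); rewrite perm_cons.
  exists ((x, y, m) :: fs); split=> //.
  - split=> // f' Hf' j Hj; have nh := Hhit j Hj.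
    have mem w : w \in [:: f'.1.1; f'.1.2] -> w \in z :: r.
      move=> win; apply: (mem_rem (x := y)); rewrite (perm_mem Pf).
      by apply/flattenP; exists [:: f'.1.1; f'.1.2] => //; exact: map_f.
    by split; apply: contraNneq nh; apply: hitP; apply: mem; rewrite !inE eqxx ?orbT.
  move=> f; rewrite inE => /orP[/eqP -> /= Em|]; last exact: free.
  move=> j /=; rewrite (mulrC x); apply: contraNneq (Hhit j _); first exact: hitP.
  by move=> k; rewrite Em.
(* Choosing the shortest possible string for x gives condition ns. *)
have [hj|/forallNP nh] := EM (exists j, hit j); last first.
  by apply: (build z None) => //; [exact: mem_head | move=> j _; apply/negP].
have [k hk kmin] := ex_minnP hj.
have /existsP [i /eqP Ei] := hk.
apply: (build (z :: r)`_i (Some k)); first exact: mem_nth.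
- by move=> _ [<-]; rewrite (mulrC x).
by move=> j /(_ k erefl) ltj; apply/negP=> /kmin; rewrite leqNgt ltj.
Qed.

Lemma abs_chain (K : comNzRingType) (X a h Q c x xi P R : K) : Q * a * h = 1 ->
  P * ((1 - a * X) * (1 - xi * X)) = c * (R * ((1 - x * X) * (1 - Q * h * X))) ->
  (1 - a * X) * ((1 - h * X) * P) * ((1 - Q * a * X) * (1 - xi * X))
  = Q * c * ((X - a) * ((X - h) * R) * ((1 - x * X) * (1 - h * X))).
Proof.
move=> E IH; have [F _] := abs_pair X E.
transitivity (P * ((1 - a * X) * (1 - xi * X)) * (1 - h * X) * (1 - Q * a * X)); first by ring.
transitivity (c * R * (1 - x * X) * (1 - h * X) * ((1 - Q * a * X) * (1 - Q * h * X))).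
  by rewrite IH; ring.
by rewrite F; ring.
Qed.

(** The list L consists of x q^(2j) for j < k. The factor of [Rl] at hat(a) is proportional to the
    factor of [Pl] at q^2 a, the next element of the string, so in the quotient all factors cancel
    except those at the two ends. *)
Lemma chain_pairs x k : x != 0 -> exists L, all (fun x => x != 0) L /\
  Pl (pairs q L) * ((1 - (x * q ^+ (2 * k)) *: 'X) * (1 - x^-1 *: 'X))
  = q ^+ (2 * k) *: (Rl (pairs q L) * ((1 - x *: 'X) * (1 - (x * q ^+ (2 * k))^-1 *: 'X))).
Proof.
move=> x0; elim: k => [|k [L [L0 IH]]].
  by exists [::]; rewrite /Pl /Rl !big_nil muln0 expr0 mulr1 scale1r.
pose a := x * q ^+ (2 * k); have a0 : a != 0 by rewrite mulf_neq0 ?expf_neq0.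
exists (a :: L); split; first by rewrite /= a0.
rewrite (_ : pairs q (a :: L) = [:: a, hat q a & pairs q L]) // !Pl_cons !Rl_cons.
have E : x * q ^+ (2 * k.+1) = q ^+ 2 * a by rewrite /a mulnS exprD; ring.
rewrite E mulnS exprD; rewrite -/a in IH; clearbody a.
have Eh : (q ^+ 2 * a)^-1 = hat q a by [].
have Ea : a^-1 = q ^+ 2 * hat q a by rewrite /hat invfM mulVKf ?expf_neq0.
have h1 : (q ^+ 2)%:P * a%:P * (hat q a)%:P = 1 :> {poly C}.
  by rewrite -!polyCM mulfV // mulf_neq0 ?expf_neq0.
rewrite Eh; rewrite Ea in IH; rewrite -!mul_polyC !(polyCM (q ^+ 2)) in IH *.
by apply: abs_chain h1 IH.
Qed.

Lemma chains_pairs fs : valid q fs -> all (fun f => f.2 != None) fs ->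
  exists L, all (fun x => x != 0) L /\ Pl (pairs q L) * muP fs = Rl (pairs q L) * mubP fs.
Proof.
elim: fs => [|[[x y] [k|]] fs IH] //= V; first by exists [::]; rewrite /Pl /Rl !big_nil.
have [x0 y0 /(_ k erefl) /= Exy V'] := V; move=> /(IH V') [L [L0 E]].
have [L' [L0' E']] := chain_pairs k x0.
exists (L' ++ L); split; first by rewrite all_cat L0' L0.
have PE : Pl (pairs q (L' ++ L)) = Pl (pairs q L') * Pl (pairs q L).
  by rewrite /pairs map_cat flatten_cat /Pl big_cat.
have RE : Rl (pairs q (L' ++ L)) = Rl (pairs q L') * Rl (pairs q L).
  by rewrite /pairs map_cat flatten_cat /Rl big_cat.
rewrite PE RE; have qk : (q ^+ (2 * k))%:P != 0 :> {poly C} by rewrite polyC_eq0 expf_neq0.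
have Ea : x * q ^+ (2 * k) = y^-1 by apply: (mulIf y0); rewrite mulVf // -Exy; ring.
have Eq : q ^+ (2 * k) = x^-1 * y^-1 by rewrite -Ea mulKf.
rewrite Ea invrK -!mul_polyC in E'.
have cy : (y^-1)%:P * y%:P = 1 :> {poly C} by rewrite -polyCM mulVf.
have cx : (x^-1)%:P * x%:P = 1 :> {poly C} by rewrite -polyCM mulVf.
have E2 : Pl (pairs q L') * ((y%:P - 'X) * (x%:P - 'X))
   = Rl (pairs q L') * ((1 - x%:P * 'X) * (1 - y%:P * 'X)).
  apply: (mulfI qk); rewrite -[RHS]E' Eq polyCM.
  transitivity (Pl (pairs q L') * (((y^-1)%:P * y%:P - (y^-1)%:P * 'X) * ((x^-1)%:P * x%:P -
    (x^-1)%:P * 'X))).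
    by ring.
  by rewrite cx cy.
rewrite -!mul_polyC.
transitivity (Pl (pairs q L') * ((y%:P - 'X) * (x%:P - 'X)) * (Pl (pairs q L) * muP fs));
  first by ring.
by rewrite E2 E; ring.
Qed.
End Factors.

(** * The two implications of the criterion *)

Section Main.
Variables (q : C) (q0 : q != 0).
Hypothesis hq : forall n : nat, (0 < n)%N -> q ^+ n != 1.
Variables (A : algType C) (t tb : 'I_2 -> 'I_2 -> nat -> A) (ti tbi : 'I_2 -> A).
Hypothesis HE : is_Uext q t tb ti tbi.
Variables mu mub : nat -> C.

(* If 1 were in the Verma ideal, max_sub would be 0 and V would be Y' itself, where s12^(0) is
   transcendental since it takes infinitely many values in one-dimensional representations. *)
Lemma verma_nonzero : V_findim q t tb ti tbi mu mub -> ~ verma_ideal q t tb ti tbi mu mub 1.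
Proof.
move=> [n [v [_ Hv]]] Z1; pose e0 := s_coef q t tb o1 o2 0%N.
have Ye i : Yq q t tb ti tbi (e0 ^+ i).
  elim: i => [|i IH]; first exact: Yq1.
  by rewrite exprS; apply: YqM => //; exact: Yq_s.
have [|i|ga [m [gm /= E]]] := @lin_dep A (eq^~ 0) n v (fun i => e0 ^+ i); first exact: zero_lin.
  by have [c Hc] := Hv _ (Ye i); exists c; exact: max_sub_trivial Z1 Hc.
pose p := \poly_(i < m.+1) ga i.
have p0 : p != 0.
  by apply: contra_neq gm => p0; have := f_equal (fun r : {poly C} => r`_m) p0;
    rewrite /= coef_poly ltnSn coef0.
have [_ univ] := HE.
have root_p x : x != 0 -> p.[q * x] = 0.
  move=> x0; have [rho [[rhoD rhoZ rhoM rho1] rho_t _ _]] := univ _ _ _ _ _ (@Uext_rels_diag q oper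
    x x0).
  have rho0 : rho 0 = 0 by rewrite -(scale0r 0) rhoZ scale0r.
  have Ee : rho e0 = (q * x) *: 1.
    rewrite /e0 /s_coef big_ord1 -scaleN1r rhoD !rhoZ !rhoM !(proj1 (rho_t _ _ _)) !(proj2 (rho_t _
      _ _)).
    rewrite /diag_t /diag_val !eqxx o_eqs scale0r mul0r scaler0 addr0 !mul1r scale1r mulr1 scalerA //.
  have Ek k : rho (e0 ^+ k) = (q * x) ^+ k *: 1.
    elim: k => [|k IHk]; first by rewrite !expr0 rho1 scale1r.
    by rewrite !exprS rhoM IHk Ee -scalerAl mul1r scalerA.
  have Es : rho (\sum_(i < m.+1) ga i *: e0 ^+ i) = p.[q * x] *: 1.
    rewrite horner_poly scaler_suml.
    by elim/big_rec2: _ => // i y z _ <-; rewrite rhoD rhoZ Ek scalerA.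
  move: Es; rewrite E rho0 => /esym/eqP; rewrite scaler_eq0 oner_eq0 orbF => /eqP //.
have := @max_poly_roots C p [seq q ^+ i.+1 | i <- iota 0 (size p)] p0.
rewrite size_map size_iota ltnn => H; suff: false by []; apply: H.
  apply/allP=> _ /mapP[i _ ->]; apply/rootP; rewrite exprS; apply: root_p.
  by rewrite expf_neq0.
rewrite map_inj_uniq ?iota_uniq // => i j; wlog le : i j / (i <= j)%N.
  by move=> H; have [/H|/ltnW /H K /esym/K] := leqP i j.
rewrite -(subnKC le) -addSn exprD => /eqP; rewrite -{1}(mulr1 (q ^+ i.+1)) => /eqP /mulfI.
rewrite expf_neq0 // => /(_ isT) /esym E1; case: (j - i)%N E1 => [|k E1]; first by rewrite addn0.
by have := @hq k.+1 isT; rewrite E1 eqxx.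
Qed.

Lemma pairs_of_findim : V_findim q t tb ti tbi mu mub -> exists L,
  [/\ all (fun x => x != 0) L, mu 0%N != 0 &
      (mub : ps C) * pser (Rl (pairs q L)) = (mu : ps C) * pser (Pl (pairs q L))].
Proof.
move=> fd; have HU : Uext_rels q t tb ti tbi by case: HE.
have HJ := max_sub_proper q0 hq HU (verma_nonzero fd); have [_ _ J1] := HJ.
have HJ' := proper_sub_hw q0 HU HJ.
have fq : findim_quotient q t tb ti tbi (max_sub q t tb ti tbi mu mub).
  by have [n [v [_ Hv]]] := fd; exists n, v.
have mu0 := mu0_neq0 q0 hq HU HJ' J1 fq.
have mub0 : mub 0%N != 0.
  by have := sig0_neq0 q0 HU HJ' J1; rewrite sig0 oppr_eq0 mulf_eq0 negb_or => /andP[].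
have [ga [m [G [gm HG HS]]]] := findim_series q0 HU HJ' J1 fq.
have ka0 : (q - q^-1) * q ^+ 2 != 0.
  rewrite mulf_neq0 ?expf_neq0 // (_ : q - q^-1 = (q ^+ 2 - 1) / q); last by field.
  by rewrite mulf_neq0 ?invr_eq0 // subr_eq0 hq.
have [rs [ev nz E]] := series_roots ka0 mu0 mub0 HG gm HS.
have [fs [V NS Pfs free]] := factors_of_roots q ev nz.
rewrite -/(Rl rs) -/(Pl rs) (Rl_perm Pfs) (Pl_perm Pfs) in E.
have [mE mbE] := muP_roots fs.
have Hmu : (mub : ps C) * pser (muP fs) = (mu : ps C) * pser (mubP fs).
  by rewrite mE mbE !rmorphN /= !mulrN E.
(* By construction a string without end is free, and a free factor would make V
   infinite-dimensional. *)
have bd : all (fun f => f.2 != None) fs.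
  apply/allP=> f Hf; apply/eqP=> fN.
  by apply: (not_findim_of_free q0 hq HE V mu0 Hmu NS _ fd); exists f; last exact: free.
have [L [L0 EL]] := chains_pairs q0 V bd; exists L; split=> //.
(* The identity for [pairs q L] is proved after multiplication by [mubP fs], where it follows from
   [EL] and [Hmu]; the nonzero constant term allows this series to be cancelled. *)
have mub1 : pser (mubP fs) 0%N != 0 by rewrite /pser mubP0 oppr_eq0 oner_eq0.
apply/eqP; rewrite -subr_eq0; apply/eqP; apply: (ps_unit_cancel mub1).
have {}EL := f_equal pser EL; rewrite !rmorphM /= in EL.
transitivity ((mub : ps C) * (pser (Rl (pairs q L)) * pser (mubP fs))
  - (mu : ps C) * pser (mubP fs) * pser (Pl (pairs q L))); first by ring.
by rewrite -EL -Hmu; ring.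
Qed.

Lemma findim_of_pairs L : all (fun x => x != 0) L -> mu 0%N != 0 ->
  (mub : ps C) * pser (Rl (pairs q L)) = (mu : ps C) * pser (Pl (pairs q L)) ->
  V_findim q t tb ti tbi mu mub.
Proof.
move=> L0 mu0 E; pose fs : seq factor := [seq (x, hat q x, Some 1%N) | x <- L].
have V : valid q fs.
  rewrite /fs; elim: (L) L0 => [//|x l IH] /= /andP[x0 /IH Vl]; split=> //.
    by rewrite invr_eq0 mulf_neq0 ?expf_neq0.
  by move=> _ [<-]; rewrite muln1 mulrC mulrA mulfV // mulf_neq0 ?expf_neq0.
have Ef : fs_roots fs = pairs q L by rewrite /fs_roots /fs -map_comp.
have [mE mbE] := muP_roots fs.
apply: (@findim_of_bounded q q0 A t tb ti tbi HE mu mub fs) => //.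
  by rewrite mE mbE Ef !rmorphN /= !mulrN E.
by rewrite /fs all_map; apply/allP.
Qed.
End Main.

Theorem theorem4p6 (q : C) (hq0 : q != 0)
  (hq : forall n : nat, (0 < n)%N -> q ^+ n != 1)
  (A : algType C) (t tb : 'I_2 -> 'I_2 -> nat -> A) (ti tbi : 'I_2 -> A)
  (HU : is_Uext q t tb ti tbi)
  (mu mub : nat -> C) :
  (V_findim q t tb ti tbi mu mub <-> exists P : {poly C}, good_P q mu mub P) /\
  (forall P1 P2 : {poly C}, good_P q mu mub P1 -> good_P q mu mub P2 -> P1 = P2).
Proof.
split; last by move=> P1 P2; exact: good_P_unique.
split=> [/(pairs_of_findim hq0 hq HU) [L [L0 mu0 E]]|[P GP]].
  by exists (Pl (pairs q L)); exact: good_pairs.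
have [_ _ _ mu0 _] := GP; have [L [L0 _ E]] := good_P_pairs hq0 GP.
exact: findim_of_pairs E.
Qed.
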